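(* Let $f\in\mathscr{E}'(\mathbb{T})$ and let $I\subset\mathbb{T}$ be a closed interval such that $\mathop{\rm supp} f\subset\mathscr{R}_2(I)$ and there is no closed interval $I'\subsetneq I$ with $\mathop{\rm supp} f\subset\mathscr{R}_2(I')$. Assume $I\subset(-\pi/2,\pi/2)$ and $|I|<\pi/2$. If $\mathop{\rm supp} f\ast f^\sharp\subset\{0,\pi\}$, then $\mathop{\rm supp} f\subset\{\inf I,\ \sup I,\ \pi+\inf I,\ \pi+\sup I\}$, and moreover there exist distributions $\mu,\nu\in\mathscr{E}'(\mathbb{T})$, each supported at a single point, such that $f=\mu+S_\pi\mu+\nu-S_\pi\nu$.
   Context: $\mathbb{T}=\mathbb{R}/2\pi\mathbb{Z}$ and $\mathscr{E}'(\mathbb{T})$ is the space of distributions on $\mathbb{T}$. For $y\in\mathbb{T}$ the shift $S_y$ is defined by $(S_yf)(\omega)=f(\omega-y)$ in the sense of distributions. $f^\sharp$ is defined by $f^\sharp(\omega)=f(-\omega)$. For $I\subset\mathbb{T}$, $\mathscr{R}_2(I)=I\cup S_\pi I$. A closed interval $I\subset(-\pi/2,\pi/2)$ is $[\inf I,\sup I]$ with $|I|=\sup I-\inf I$. *)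

(* Defs.v *)
From Stdlib Require Import Reals ZArith.
From Coquelicot Require Import Coquelicot.
Open Scope R_scope.

Definition smooth (g : R -> R) : Prop := forall (n : nat) (x : R), ex_derive_n g n x.

(** Test functions on T = R/2piZ: smooth 2pi-periodic complex-valued
    functions on R (smoothness of real and imaginary parts). *)
Definition test_fn (phi : R -> C) : Prop :=
  smooth (fun x => fst (phi x)) /\ smooth (fun x => snd (phi x)) /\
  (forall x, phi (x + 2 * PI) = phi x).

(** Candidate distributions: functionals on functions R -> C;
    only their values on test functions are meaningful. *)
Definition distrT := (R -> C) -> C.

(** u is a distribution on T (an element of E'(T) = D'(T)): linear on test
    functions and continuous for the C^infty topology, i.e. bounded by a
    finite number of C^k seminorms. *)
Definition is_distribution (u : distrT) : Prop :=
  (forall phi psi, test_fn phi -> test_fn psi ->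
     u (fun x => Cplus (phi x) (psi x)) = Cplus (u phi) (u psi)) /\
  (forall (c : C) phi, test_fn phi ->
     u (fun x => Cmult c (phi x)) = Cmult c (u phi)) /\
  (exists (K : R) (k : nat), forall phi (M : R), test_fn phi ->
     (forall (j : nat) (x : R), (j <= k)%nat ->
        Rabs (Derive_n (fun t => fst (phi t)) j x) <= M /\
        Rabs (Derive_n (fun t => snd (phi t)) j x) <= M) ->
     Cmod (u phi) <= K * M).

(** Subsets of T are represented by 2pi-periodic subsets of R. *)
Definition lift (A : R -> Prop) : R -> Prop :=
  fun x => exists k : Z, A (x - 2 * PI * IZR k).

Definition shift_set (y : R) (A : R -> Prop) : R -> Prop := fun x => A (x - y).

Definition R2 (A : R -> Prop) : R -> Prop := fun x => A x \/ shift_set PI A x.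

Definition Icc_T (a b : R) : R -> Prop := lift (fun x => a <= x <= b).

(** supp u is contained in the closed set A (of T): u vanishes on every test
    function vanishing on a neighbourhood of A. *)
Definition supp_in (u : distrT) (A : R -> Prop) : Prop :=
  forall phi, test_fn phi ->
    (exists eps : R, 0 < eps /\
       forall x, (exists y, A y /\ Rabs (x - y) < eps) -> phi x = RtoC 0) ->
    u phi = RtoC 0.

(** Shift (S_y u)(w) = u(w - y): <S_y u, phi> = <u, phi(. + y)>. *)
Definition shiftT (y : R) (u : distrT) : distrT := fun phi => u (fun x => phi (x + y)).

Definition sharp (u : distrT) : distrT := fun phi => u (fun x => phi (- x)).

Definition conv (u v : distrT) : distrT :=
  fun phi => u (fun x => v (fun y => phi (x + y))).

(* Main.v *)
Require Import Defs.
From Stdlib Require Import Reals ZArith Lra Lia FunctionalExtensionality Classical.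
From Coquelicot Require Import Coquelicot.
Open Scope R_scope.

(** Folding the circle by [x ~ x + PI] turns [f] into two compactly supported distributions on
    the line: its [PI]-periodic part and its [PI]-antiperiodic part. As the interval is shorter
    than [PI / 2], the hypothesis on [f * f^#] says that each of them, say [g], satisfies
    [supp (g * g^#)] inside [{0}], and the claim becomes: such a [g] sits at a single point.

    Let [F s] be [g] applied to [exp (s x)], for real [s] only. Then [P s = F s * F (- s)] and
    [H s = F' s * F (- s)] are transforms of compactly supported distributions. The functions
    [P^m F^(m) / F] grow at most like [exp (L s)] with [L] independent of [m], but up to terms of
    lower growth they are equal to [H^m]: hence [H] grows subexponentially, in both directions.
    A transform that is subexponential in both directions is a polynomial (test against
    [(x - e)^j (1 - exp (- exp (n (x - e))))], whose expansion in powers of [exp (n x)] is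
    controlled by the transform). So [P] and [H] are polynomials, [F' / F = H / P], and
    [ln |F s|^2] is asymptotically linear, with the same slope [c] at both ends. Therefore
    [exp (- c s / 2) F s] is subexponential in both directions, hence polynomial, and [g] is
    supported at [c / 2]. *)


(** With [s] real there are no Cauchy estimates; growth rates on a half-line ([rate]) take their
    place. They are usable because differentiating a transform does not raise its rate ([rate_xm]),
    a consequence of Landau's inequality.

    The obstacle is division: [F] may have zeros, so [F' / F] is never formed. Quotients are cleared
    by powers of [P], which leaves products [F^(m) (s) F (- s)], transforms of convolutions again.
    If [H] has rate [t], then [H^(n+1)] differs by rate [n t] only from a transform of rate [L]. So
    [H] has rate [max (L, n t) / (n + 1)], and iterating with [n] large brings the rate below any
    positive number.

    The bound [PI / 2] on the length makes the passage to the line faithful: differences of points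
    of the interval stay in [(- PI / 2, PI / 2)], where folding is injective, and both 0 and [PI]
    fold to the single point 0.

    Minimality of the interval enters at the end. The two parts sit at points [p] and [q] of the
    interval; if these were not its two ends, the interval between them would be a smaller
    admissible one. *)

(** * Real calculus: smooth functions and [C^N] bounds *)

Lemma is_derive_Rmult (f g : R -> R) (x a b : R) :
  is_derive f x a -> is_derive g x b ->
  is_derive (fun t => f t * g t) x (a * g x + f x * b).
Proof.
  intros Hf Hg; apply (is_derive_mult (K := R_AbsRing) f g x a b Hf Hg).
  intros; apply Rmult_comm.
Qed.

Lemma is_derive_Rplus (f g : R -> R) (x a b : R) :
  is_derive f x a -> is_derive g x b ->
  is_derive (fun t => f t + g t) x (a + b).
Proof. intros Hf Hg; exact (is_derive_plus (K := R_AbsRing) f g x a b Hf Hg). Qed.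

Lemma is_derive_Rminus (f g : R -> R) (x a b : R) :
  is_derive f x a -> is_derive g x b ->
  is_derive (fun t => f t - g t) x (a - b).
Proof. intros Hf Hg; exact (is_derive_minus (K := R_AbsRing) f g x a b Hf Hg). Qed.

Lemma is_derive_Rconst (c x : R) : is_derive (fun _ : R => c) x 0.
Proof. exact (is_derive_const (K := R_AbsRing) (V := R_NormedModule) c x). Qed.

Lemma is_derive_Rid (x : R) : is_derive (fun t : R => t) x 1.
Proof. exact (is_derive_id (K := R_AbsRing) x). Qed.

Lemma is_derive_Ropp (x : R) : is_derive (fun t : R => - t) x (-1).
Proof. exact (is_derive_opp (K := R_AbsRing) (V := R_NormedModule) _ _ _ (is_derive_Rid x)). Qed.

Lemma is_derive_Rcomp (f g : R -> R) (x a b : R) :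
  is_derive f (g x) a -> is_derive g x b ->
  is_derive (fun t => f (g t)) x (b * a).
Proof. intros Hf Hg; exact (is_derive_comp (K := R_AbsRing) f g x a b Hf Hg). Qed.

Lemma is_derive_eq (f : R -> R) (x a b : R) : is_derive f x a -> a = b -> is_derive f x b.
Proof. intros H <-; exact H. Qed.

Lemma MVT_everywhere (f f' : R -> R) :
  (forall x : R, is_derive f x (f' x)) ->
  forall a b, exists c, Rmin a b <= c <= Rmax a b /\ f b - f a = f' c * (b - a).
Proof.
  intros H a b. apply MVT_gen.
  - intros; apply H.
  - intros x _. apply continuity_pt_filterlim, (@ex_derive_continuous R_AbsRing R_NormedModule f x).
    eexists; apply H.
Qed.

Lemma derive_zero_const (f : R -> R) :
  (forall x : R, is_derive f x 0) -> forall x, f x = f 0.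
Proof.
  intros H x. destruct (MVT_everywhere f (fun _ => 0) H 0 x) as [c [_ E]]. lra.
Qed.

(** Finite orders make closure under products, compositions and inverses an induction, each step
    trading one order for one derivative. *)
Definition Cn (n : nat) (f : R -> R) : Prop :=
  forall k x, (k <= n)%nat -> ex_derive_n f k x.

Lemma Derive_n_S_l (f : R -> R) n x : Derive_n f (S n) x = Derive_n (Derive f) n x.
Proof.
  replace (S n) with (n + 1)%nat by lia. rewrite <- Derive_n_comp. reflexivity.
Qed.

Lemma ex_derive_n_S_l (f : R -> R) n x :
  ex_derive_n f (S (S n)) x <-> ex_derive_n (Derive f) (S n) x.
Proof.
  simpl. split; apply ex_derive_ext; intros t.
  - apply (Derive_n_S_l f n t).
  - symmetry; apply (Derive_n_S_l f n t).
Qed.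

Lemma Cn_S n (f f' : R -> R) : (forall x : R, is_derive f x (f' x)) -> Cn n f' -> Cn (S n) f.
Proof.
  intros Hd Hf' k x Hk.
  assert (E : Derive f = f').
  { apply functional_extensionality; intro t; apply is_derive_unique, Hd. }
  destruct k as [|[|k]]; [exact I | | ].
  - simpl. eexists; apply Hd.
  - apply (proj2 (ex_derive_n_S_l f k x)). rewrite E. apply (Hf' (S k) x). lia.
Qed.

Lemma Cn_S_inv n f : Cn (S n) f ->
  (forall x : R, is_derive f x (Derive f x)) /\ Cn n (Derive f) /\ Cn n f.
Proof.
  intros H; split; [|split].
  - intro x. apply Derive_correct. apply (H 1%nat x). lia.
  - intros k x Hk. destruct k as [|k]; [exact I|].
    apply (proj1 (ex_derive_n_S_l f k x)). apply (H (S (S k)) x). lia.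
  - intros k x Hk. apply (H k x). lia.
Qed.

Lemma smooth_Cn f : smooth f <-> forall n, Cn n f.
Proof.
  split; [intros H n k x _; apply H | intros H n x; apply (H n n x); lia].
Qed.

Lemma smooth_is_derive f : smooth f -> forall x, is_derive f x (Derive f x).
Proof. intros H x. apply Derive_correct. apply (H 1%nat x). Qed.

Lemma smooth_Derive f : smooth f -> smooth (Derive f).
Proof. rewrite !smooth_Cn. intros H n. apply (Cn_S_inv n f (H (S n))). Qed.

Lemma smooth_Derive_n f n : smooth f -> smooth (Derive_n f n).
Proof.
  intros H. induction n as [|n IH]; [exact H|]. exact (smooth_Derive _ IH).
Qed.

Lemma smooth_is_derive_n f n : smooth f ->
  forall x, is_derive (Derive_n f n) x (Derive_n f (S n) x).
Proof. intros H x. apply (smooth_is_derive _ (smooth_Derive_n f n H)). Qed.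

Lemma smooth_of_derive (f f' : R -> R) : (forall x : R, is_derive f x (f' x)) -> smooth f' -> smooth f.
Proof.
  rewrite !smooth_Cn. intros Hd Hf n. destruct n as [|n].
  - intros k x Hk. replace k with 0%nat by lia. exact I.
  - apply Cn_S with f'; auto.
Qed.

Lemma Derive_n_of_derive (f f' : R -> R) : (forall x : R, is_derive f x (f' x)) ->
  forall n x, Derive_n f (S n) x = Derive_n f' n x.
Proof.
  intros H n x. rewrite Derive_n_S_l. apply Derive_n_ext.
  intro t; apply is_derive_unique, H.
Qed.

(** No formula for the [n]-th derivative is asked for. This suits families closed under
    differentiation: spans of explicit terms, or translates paired with a distribution. *)
Lemma smooth_class (S : (R -> R) -> Prop) :
  (forall f, S f -> exists f', S f' /\ forall x, is_derive f x (f' x)) ->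
  forall f, S f -> smooth f.
Proof.
  intros H f Hf. apply smooth_Cn. intro n. revert f Hf.
  induction n as [|n IH]; intros f Hf.
  - intros k x Hk. replace k with 0%nat by lia. exact I.
  - destruct (H f Hf) as [f' [H1 H2]]. apply Cn_S with f'; auto.
Qed.

Lemma smooth_const c : smooth (fun _ => c).
Proof. intros n x. apply ex_derive_n_const. Qed.

Lemma smooth_id : smooth (fun x => x).
Proof.
  apply smooth_of_derive with (fun _ => 1); [|apply smooth_const].
  intro x; apply (is_derive_id (K := R_AbsRing)).
Qed.

Lemma smooth_pow n : smooth (fun x => x ^ n).
Proof. intros k x. apply ex_derive_n_pow. Qed.

Lemma smooth_exp : smooth exp.
Proof.
  apply smooth_class with (fun f => f = exp); [|reflexivity].
  intros f ->. exists exp. split; [reflexivity|]. intro; apply is_derive_exp.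
Qed.

Lemma Cn_plus n f g : Cn n f -> Cn n g -> Cn n (fun x => f x + g x).
Proof.
  intros Hf Hg k x Hk. apply ex_derive_n_plus; exists (mkposreal 1 Rlt_0_1);
  intros y _ j Hj; [apply Hf | apply Hg]; lia.
Qed.

Lemma Cn_mult n : forall f g, Cn n f -> Cn n g -> Cn n (fun x => f x * g x).
Proof.
  induction n as [|n IH]; intros f g Hf Hg.
  - intros k x Hk. replace k with 0%nat by lia. exact I.
  - destruct (Cn_S_inv _ _ Hf) as [f1 [f2 f3]], (Cn_S_inv _ _ Hg) as [g1 [g2 g3]].
    apply Cn_S with (fun x => Derive f x * g x + f x * Derive g x).
    + intro x. apply is_derive_Rmult; auto.
    + apply Cn_plus; apply IH; auto.
Qed.

Lemma Cn_comp n : forall f g, smooth g -> Cn n f -> Cn n (fun x => f (g x)).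
Proof.
  induction n as [|n IH]; intros f g Hg Hf.
  - intros k x Hk. replace k with 0%nat by lia. exact I.
  - destruct (Cn_S_inv _ _ Hf) as [f1 [f2 f3]].
    apply Cn_S with (fun x => Derive g x * Derive f (g x)).
    + intro x. apply is_derive_Rcomp; auto. apply smooth_is_derive; auto.
    + apply Cn_mult; [|apply IH; auto].
      apply smooth_Cn, smooth_Derive, Hg.
Qed.

Lemma Cn_inv n : forall f, smooth f -> (forall x, f x <> 0) -> Cn n (fun x => / f x).
Proof.
  induction n as [|n IH]; intros f Hf H0.
  - intros k x Hk. replace k with 0%nat by lia. exact I.
  - apply Cn_S with (fun x => (-1) * Derive f x * ((/ f x) * (/ f x))).
    + intro x. eapply is_derive_eq.
      { apply is_derive_inv; [apply smooth_is_derive; auto | auto]. }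
      simpl. field. auto.
    + apply Cn_mult; [|apply Cn_mult; auto].
      apply Cn_mult; [apply smooth_Cn, smooth_const | apply smooth_Cn, smooth_Derive, Hf].
Qed.

Lemma smooth_plus f g : smooth f -> smooth g -> smooth (fun x => f x + g x).
Proof. rewrite !smooth_Cn; intros; apply Cn_plus; auto. Qed.

Lemma smooth_mult f g : smooth f -> smooth g -> smooth (fun x => f x * g x).
Proof. rewrite !smooth_Cn; intros; apply Cn_mult; auto. Qed.

Lemma smooth_comp f g : smooth f -> smooth g -> smooth (fun x => f (g x)).
Proof. rewrite (smooth_Cn f), (smooth_Cn (fun x => f (g x))); intros; apply Cn_comp; auto. Qed.

Lemma smooth_inv f : smooth f -> (forall x, f x <> 0) -> smooth (fun x => / f x).
Proof. intros H1 H2; apply smooth_Cn; intro; apply Cn_inv; auto. Qed.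

Lemma smooth_scal c f : smooth f -> smooth (fun x => c * f x).
Proof. intros; apply smooth_mult; auto using smooth_const. Qed.

Lemma smooth_minus f g : smooth f -> smooth g -> smooth (fun x => f x - g x).
Proof.
  intros Hf Hg.
  replace (fun x => f x - g x) with (fun x => f x + (-1) * g x)
    by (apply functional_extensionality; intro; ring).
  apply smooth_plus; auto using smooth_scal.
Qed.

Lemma smooth_opp f : smooth f -> smooth (fun x => - f x).
Proof.
  intros Hf. replace (fun x => - f x) with (fun x => (-1) * f x)
    by (apply functional_extensionality; intro; ring).
  auto using smooth_scal.
Qed.

Lemma smooth_loc f :
  (forall x, exists g, smooth g /\ locally x (fun t => g t = f t)) -> smooth f.
Proof.
  intros H n x. destruct (H x) as [g [Hg Hl]].
  apply ex_derive_n_ext_loc with g; auto.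
Qed.

Lemma Rabs_between a b c : Rmin a b <= c <= Rmax a b -> Rabs (c - a) <= Rabs (b - a).
Proof.
  unfold Rmin, Rmax; destruct (Rle_dec a b); intros; unfold Rabs;
  destruct (Rcase_abs (c - a)), (Rcase_abs (b - a)); lra.
Qed.

#[export] Hint Resolve smooth_const smooth_id smooth_pow smooth_exp smooth_plus smooth_mult
  smooth_scal smooth_minus smooth_opp smooth_Derive smooth_Derive_n : smooth.

Lemma smooth_trans f c : smooth f -> smooth (fun x => f (x + c)).
Proof. intros; apply (smooth_comp f (fun x => x + c)); auto with smooth. Qed.

Lemma smooth_trans_l f c : smooth f -> smooth (fun x => f (c + x)).
Proof. intros; apply (smooth_comp f (fun x => c + x)); auto with smooth. Qed.

Lemma smooth_reflect f : smooth f -> smooth (fun x => f (- x)).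
Proof. intros; apply (smooth_comp f (fun x => - x)); auto with smooth. Qed.

Lemma smooth_expl s : smooth (fun x => exp (s * x)).
Proof. apply (smooth_comp exp (fun x => s * x)); auto with smooth. Qed.

#[export] Hint Resolve smooth_expl : smooth.

Lemma smooth_locally f n x : smooth f ->
  locally x (fun y => forall k, (k <= n)%nat -> ex_derive_n f k y).
Proof. intros H; exists (mkposreal 1 Rlt_0_1); intros y _ k _; apply H. Qed.

Lemma Derive_n_Rplus f g n x : smooth f -> smooth g ->
  Derive_n (fun t => f t + g t) n x = Derive_n f n x + Derive_n g n x.
Proof. intros; apply Derive_n_plus; apply smooth_locally; auto. Qed.

Lemma Derive_n_Rminus f g n x : smooth f -> smooth g ->
  Derive_n (fun t => f t - g t) n x = Derive_n f n x - Derive_n g n x.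
Proof. intros; apply Derive_n_minus; apply smooth_locally; auto. Qed.

Lemma Derive_n_trans_l f c n x : Derive_n (fun t => f (c + t)) n x = Derive_n f n (c + x).
Proof.
  rewrite (Rplus_comm c x), <- Derive_n_comp_trans. apply Derive_n_ext.
  intro; f_equal; ring.
Qed.

Lemma Derive_n_expl s n x : Derive_n (fun t => exp (s * t)) n x = s ^ n * exp (s * x).
Proof.
  rewrite (Derive_n_comp_scal exp s n x) by (apply smooth_locally, smooth_exp).
  f_equal. generalize (s * x). intro y. clear. revert y.
  induction n as [|n IH]; intro y; [reflexivity|].
  rewrite (Derive_n_of_derive exp exp) by (intro; apply is_derive_exp). apply IH.
Qed.

Definition bd (N : nat) (D : R -> Prop) (f : R -> R) (M : R) : Prop :=
  forall j x, (j <= N)%nat -> D x -> Rabs (Derive_n f j x) <= M.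

Lemma Derive_n_mult_bound j x M M' : forall f g, smooth f -> smooth g ->
  (forall i, (i <= j)%nat -> Rabs (Derive_n f i x) <= M) ->
  (forall i, (i <= j)%nat -> Rabs (Derive_n g i x) <= M') ->
  Rabs (Derive_n (fun t => f t * g t) j x) <= 2 ^ j * M * M'.
Proof.
  induction j as [|j IH]; intros f g Hf Hg Bf Bg.
  - simpl. rewrite Rabs_mult, Rmult_1_l.
    apply Rmult_le_compat; try apply Rabs_pos; [apply (Bf 0%nat) | apply (Bg 0%nat)]; lia.
  - rewrite (Derive_n_of_derive _ (fun x => Derive f x * g x + f x * Derive g x))
      by (intro; apply is_derive_Rmult; apply smooth_is_derive; auto).
    rewrite Derive_n_Rplus by auto with smooth.
    eapply Rle_trans; [apply Rabs_triang|].
    assert (H1 : Rabs (Derive_n (fun t => Derive f t * g t) j x) <= 2 ^ j * M * M').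
    { apply IH; auto with smooth. intros i Hi. rewrite <- Derive_n_S_l. apply Bf; lia. }
    assert (H2 : Rabs (Derive_n (fun t => f t * Derive g t) j x) <= 2 ^ j * M * M').
    { apply IH; auto with smooth. intros i Hi. rewrite <- Derive_n_S_l. apply Bg; lia. }
    simpl. lra.
Qed.

Lemma bd_mult N D f g M M' : smooth f -> smooth g -> bd N D f M -> bd N D g M' ->
  bd N D (fun x => f x * g x) (2 ^ N * M * M').
Proof.
  intros Hf Hg Bf Bg j x Hj Hx.
  assert (0 <= M) by (eapply Rle_trans; [apply Rabs_pos | apply (Bf 0%nat x); auto; lia]).
  assert (0 <= M') by (eapply Rle_trans; [apply Rabs_pos | apply (Bg 0%nat x); auto; lia]).
  eapply Rle_trans.
  - apply (Derive_n_mult_bound j x M M'); auto; intros; [apply Bf | apply Bg]; auto; lia.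
  - apply Rmult_le_compat_r; auto. apply Rmult_le_compat_r; auto.
    apply Rle_pow; auto; lra.
Qed.

Lemma bd_le N D f M M' : M <= M' -> bd N D f M -> bd N D f M'.
Proof. intros H B j x Hj Hx. eapply Rle_trans; [apply B|]; auto. Qed.

Lemma bd_S N D (f f' : R -> R) M : (forall x : R, is_derive f x (f' x)) ->
  (forall x, D x -> Rabs (f x) <= M) -> bd N D f' M -> bd (S N) D f M.
Proof.
  intros Hd H0 B j x Hj Hx. destruct j as [|j]; [apply H0; auto|].
  rewrite (Derive_n_of_derive f f') by auto. apply B; auto; lia.
Qed.

Lemma smooth_bounded f A : smooth f -> exists M, 0 <= M /\ forall x, Rabs x <= A -> Rabs (f x) <= M.
Proof.
  intros Hf. destruct (Rle_dec 0 A) as [HA|HA].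
  - destruct (continuity_ab_maj (fun x => Rabs (f x)) (-A) A ltac:(lra)) as [m [Hm _]].
    { intros x _. apply continuity_pt_filterlim.
      apply (continuous_comp f Rabs).
      - apply (@ex_derive_continuous R_AbsRing R_NormedModule f x). apply (Hf 1%nat x).
      - apply continuity_pt_filterlim, Rcontinuity_abs. }
    exists (Rabs (f m)). split; [apply Rabs_pos|].
    intros x Hx. apply Hm. apply Rabs_le_between in Hx. lra.
  - exists 0. split; [lra|]. intros x Hx. pose proof (Rabs_pos x). lra.
Qed.

Lemma smooth_bd f N A : smooth f -> exists M, 0 <= M /\ bd N (fun x => Rabs x <= A) f M.
Proof.
  revert f. induction N as [|N IH]; intros f Hf.
  - destruct (smooth_bounded f A Hf) as [M [HM B]]. exists M. split; auto.
    intros j x Hj Hx. replace j with 0%nat by lia. apply B, Hx.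
  - destruct (smooth_bounded f A Hf) as [M [HM B]], (IH _ (smooth_Derive _ Hf)) as [M' [HM' B']].
    exists (M + M'). split; [lra|]. apply bd_S with (Derive f).
    + apply smooth_is_derive, Hf.
    + intros x Hx. specialize (B x Hx). lra.
    + eapply bd_le; [|apply B']. lra.
Qed.

Lemma bd_expl N A s : bd N (fun x => Rabs x <= A) (fun x => exp (s * x))
  ((1 + Rabs s) ^ N * exp (A * Rabs s)).
Proof.
  intros j x Hj Hx. rewrite Derive_n_expl, Rabs_mult, (Rabs_pos_eq (exp _)) by (left; apply exp_pos).
  rewrite <- RPow_abs. pose proof (Rabs_pos s) as Hs.
  apply Rmult_le_compat.
  - apply pow_le, Rabs_pos.
  - left; apply exp_pos.
  - apply Rle_trans with ((1 + Rabs s) ^ j); [apply pow_incr; lra | apply Rle_pow; auto; lra].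
  - assert (H : s * x <= A * Rabs s).
    { eapply Rle_trans; [apply Rle_abs|]. rewrite Rabs_mult, Rmult_comm.
      apply Rmult_le_compat_r; auto. }
    destruct H as [H|H]; [left; apply exp_increasing, H | rewrite H; lra].
Qed.


(** A quadratic remainder is what brackets [u (phi t)] provide: continuity of [u] turns a seminorm
    bound into a bound on numbers. [C] carries no sign, hence [Rabs C + 1] below. *)
Lemma is_derive_quadratic (f : R -> R) s l C :
  (forall h, Rabs h <= 1 -> Rabs (f (s + h) - f s - h * l) <= C * (h * h)) ->
  is_derive f s l.
Proof.
  intros H. apply is_derive_Reals. intros eps Heps.
  assert (HC : 0 < Rabs C + 1) by (pose proof (Rabs_pos C); lra).
  assert (Hd : 0 < Rmin 1 (eps / (Rabs C + 1))).
  { apply Rmin_pos; [lra|]. apply Rdiv_lt_0_compat; lra. }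
  exists (mkposreal _ Hd). intros h Hh0 Hh. simpl in Hh.
  assert (h1 : Rabs h <= 1) by (pose proof (Rmin_l 1 (eps / (Rabs C + 1))); lra).
  assert (h2 : Rabs h < eps / (Rabs C + 1)) by (pose proof (Rmin_r 1 (eps / (Rabs C + 1))); lra).
  specialize (H h h1).
  assert (hp : 0 < Rabs h) by (apply Rabs_pos_lt; auto).
  replace ((f (s + h) - f s) / h - l) with ((f (s + h) - f s - h * l) / h) by (field; auto).
  unfold Rdiv. rewrite Rabs_mult, Rabs_inv.
  apply Rmult_lt_reg_r with (Rabs h); auto. rewrite Rmult_assoc, Rinv_l, Rmult_1_r by lra.
  eapply Rle_lt_trans; [apply H|].
  assert (E : h * h = Rabs h * Rabs h) by (rewrite <- Rabs_mult; symmetry; apply Rabs_pos_eq, Rle_0_sqr).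
  rewrite E, <- Rmult_assoc. apply Rmult_lt_compat_r; auto.
  assert (C * Rabs h <= Rabs C * Rabs h) by (apply Rmult_le_compat_r; [lra | apply Rle_abs]).
  assert ((Rabs C + 1) * Rabs h < eps).
  { apply Rmult_lt_reg_r with (/ (Rabs C + 1)); [apply Rinv_0_lt_compat; auto|].
    replace ((Rabs C + 1) * Rabs h * / (Rabs C + 1)) with (Rabs h) by (field; lra). exact h2. }
  lra.
Qed.

(** Two uses of the mean value theorem; they lose the factor 1/2 of Taylor's formula, which is
    harmless. *)
Lemma taylor1_bound f a b M :
  smooth f -> (forall t, Rabs (t - a) <= Rabs (b - a) -> Rabs (Derive_n f 2 t) <= M) ->
  Rabs (f b - f a - (b - a) * Derive f a) <= M * ((b - a) * (b - a)).
Proof.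
  intros Hf HM.
  destruct (MVT_everywhere f (Derive f) (smooth_is_derive f Hf) a b) as [c [Hc E]].
  destruct (MVT_everywhere (Derive f) (Derive_n f 2) (smooth_is_derive_n f 1 Hf) a c) as [d [Hd E']].
  replace (f b - f a - (b - a) * Derive f a) with (Derive_n f 2 d * ((c - a) * (b - a))).
  2:{ rewrite E. transitivity ((Derive f c - Derive f a) * (b - a)); [rewrite E'|]; ring. }
  apply Rabs_between in Hc, Hd.
  assert (B : Rabs (Derive_n f 2 d) <= M) by (apply HM; lra).
  rewrite Rabs_mult. replace ((b - a) * (b - a)) with (Rabs (b - a) * Rabs (b - a)).
  2:{ rewrite <- Rabs_mult. apply Rabs_pos_eq, Rle_0_sqr. }
  apply Rmult_le_compat; auto using Rabs_pos.
  rewrite Rabs_mult. apply Rmult_le_compat_r; auto using Rabs_pos.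
Qed.

(** * Compactly supported distributions on the line *)

(* Only real test functions are needed: the complex-linear extension is [extC]. *)
Definition rdist (u : (R -> R) -> C) : Prop :=
  (forall f g, smooth f -> smooth g -> u (fun x => f x + g x) = Cplus (u f) (u g)) /\
  (forall c f, smooth f -> u (fun x => c * f x) = Cmult (RtoC c) (u f)) /\
  (exists K N A, 0 <= K /\ 0 <= A /\ forall f M, smooth f ->
     bd N (fun x => Rabs x <= A) f M -> Cmod (u f) <= K * M).

Lemma rdist_plus u f g : rdist u -> smooth f -> smooth g ->
  u (fun x => f x + g x) = Cplus (u f) (u g).
Proof. intros [H _]; apply H. Qed.

Lemma rdist_scal u c f : rdist u -> smooth f ->
  u (fun x => c * f x) = Cmult (RtoC c) (u f).
Proof. intros [_ [H _]]; apply H. Qed.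

Lemma rdist_minus u f g : rdist u -> smooth f -> smooth g ->
  u (fun x => f x - g x) = Cminus (u f) (u g).
Proof.
  intros Hu Hf Hg.
  replace (fun x => f x - g x) with (fun x => f x + (-1) * g x)
    by (apply functional_extensionality; intro; ring).
  rewrite rdist_plus, rdist_scal by auto with smooth.
  ring.
Qed.

Lemma rdist_zero u : rdist u -> u (fun _ => 0) = RtoC 0.
Proof.
  intros Hu. replace (fun _ : R => 0) with (fun x : R => 0 * 0)
    by (apply functional_extensionality; intro; ring).
  rewrite (rdist_scal u 0 (fun _ => 0)) by auto with smooth. ring.
Qed.

Lemma rdist_eq_of_minus u f g : rdist u -> smooth f -> smooth g ->
  u (fun x => f x - g x) = RtoC 0 -> u f = u g.
Proof.
  intros Hu Hf Hg H. rewrite rdist_minus in H by auto.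
  replace (u f) with (Cplus (Cminus (u f) (u g)) (u g)) by ring. rewrite H; ring.
Qed.

Lemma Cmod_le_Re_Im z : Cmod z <= Rabs (Re z) + Rabs (Im z).
Proof.
  unfold Cmod. pose proof (Rabs_pos (Re z)). pose proof (Rabs_pos (Im z)).
  rewrite <- (sqrt_Rsqr (Rabs (Re z) + Rabs (Im z))) by lra.
  apply sqrt_le_1_alt. change (fst z) with (Re z). change (snd z) with (Im z).
  rewrite <- (pow2_abs (Re z)), <- (pow2_abs (Im z)). unfold Rsqr. nra.
Qed.

Lemma im_le_Cmod z : Rabs (Im z) <= Cmod z.
Proof. eapply Rle_trans; [apply Rmax_r | apply (Rmax_Cmod z)]. Qed.

Definition dC (F : R -> C) (s : R) (l : C) : Prop :=
  is_derive (fun t => Re (F t)) s (Re l) /\ is_derive (fun t => Im (F t)) s (Im l).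

Lemma dC_unique F s l l' : dC F s l -> dC F s l' -> l = l'.
Proof.
  intros [H1 H2] [H3 H4].
  apply is_derive_unique in H1, H2, H3, H4.
  rewrite (surjective_pairing l), (surjective_pairing l'). unfold Re, Im in *. congruence.
Qed.

Lemma dC_mult F G s a b : dC F s a -> dC G s b ->
  dC (fun t => Cmult (F t) (G t)) s (Cplus (Cmult a (G s)) (Cmult (F s) b)).
Proof.
  intros [H1 H2] [H3 H4]; split; simpl.
  - eapply is_derive_eq.
    + apply is_derive_Rminus; apply is_derive_Rmult; eauto.
    + unfold Re, Im. ring.
  - eapply is_derive_eq.
    + apply is_derive_Rplus; apply is_derive_Rmult; eauto.
    + unfold Re, Im. ring.
Qed.

Lemma dC_const c s : dC (fun _ => c) s (RtoC 0).
Proof. split; apply is_derive_Rconst. Qed.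

Lemma dC_pow F s a n : dC F s a ->
  dC (fun t => Cpow (F t) (S n)) s (RtoC (INR (S n)) * a * Cpow (F s) n)%C.
Proof.
  intros H. induction n as [|n IH].
  - simpl. eapply eq_ind; [apply dC_mult; [apply H | apply dC_const]|]. simpl. ring.
  - eapply eq_ind.
    + apply (dC_mult F (fun t => Cpow (F t) (S n))); [apply H | apply IH].
    + rewrite (S_INR (S n)), RtoC_plus, !Cpow_S. ring.
Qed.

Lemma dC_comp_opp F s a : dC F (- s) a -> dC (fun t => F (- t)) s (Copp a).
Proof.
  pose proof (is_derive_Ropp s) as D.
  intros [H1 H2]; split.
  - eapply is_derive_eq;
      [apply (is_derive_Rcomp (fun t => Re (F t)) (fun t => - t) s (Re a) (-1)); auto|].
    simpl; unfold Re; ring.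
  - eapply is_derive_eq;
      [apply (is_derive_Rcomp (fun t => Im (F t)) (fun t => - t) s (Im a) (-1)); auto|].
    simpl; unfold Im; ring.
Qed.

(** Differentiation under the bracket. The remainder is quadratic in every seminorm, in particular
    in the one that controls [u]. *)
Lemma rdist_derive u (phi : R -> R -> R) psi s :
  rdist u -> (forall t, smooth (phi t)) -> smooth psi ->
  (forall N A, 0 <= A -> exists C, forall h, Rabs h <= 1 ->
     bd N (fun x => Rabs x <= A) (fun x => phi (s + h) x - phi s x - h * psi x) (C * (h * h))) ->
  dC (fun t => u (phi t)) s (u psi).
Proof.
  intros Hu Hphi Hpsi H. pose proof Hu as [_ [_ [K [N [A [HK [HA B]]]]]]].
  destruct (H N A HA) as [C HC].
  assert (E : forall h, Rabs h <= 1 ->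
    Cmod (Cminus (Cminus (u (phi (s + h))) (u (phi s))) (Cmult (RtoC h) (u psi))) <= K * C * (h * h)).
  { intros h Hh. rewrite <- rdist_scal, <- !rdist_minus by auto with smooth.
    rewrite Rmult_assoc. apply B; auto 6 with smooth. }
  split; apply is_derive_quadratic with (K * C); intros h Hh;
  (eapply Rle_trans; [|apply (E h Hh)]).
  - eapply Rle_trans; [|apply re_le_Cmod]. right. f_equal. simpl. unfold Re, Im. ring.
  - eapply Rle_trans; [|apply im_le_Cmod]. right. f_equal. simpl. unfold Re, Im. ring.
Qed.

Lemma rdist_derive_trans u f s : rdist u -> smooth f ->
  dC (fun t => u (fun y => f (t + y))) s (u (fun y => Derive f (s + y))).
Proof.
  intros Hu Hf. apply (rdist_derive u (fun t y => f (t + y))); auto using smooth_trans_l with smooth.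
  intros N A HA.
  (* The Taylor remainder of the [j]-th derivative involves order [j + 2]; the radius allows for
     [Rabs h <= 1]. *)
  destruct (smooth_bd f (2 + N) (Rabs s + 1 + A) Hf) as [M [HM B]].
  exists M. intros h Hh j x Hj Hx.
  rewrite Derive_n_Rminus, Derive_n_Rminus, Derive_n_scal_l, !Derive_n_trans_l
    by auto using smooth_trans_l with smooth.
  rewrite <- Derive_n_S_l.
  replace (h * h) with ((s + h + x - (s + x)) * (s + h + x - (s + x))) by ring.
  replace (h * Derive_n f (S j) (s + x))
    with ((s + h + x - (s + x)) * Derive (Derive_n f j) (s + x)) by (simpl; ring).
  apply taylor1_bound; auto with smooth.
  intros t Ht. rewrite Derive_n_comp. apply B; [lia|].
  replace (s + h + x - (s + x)) with h in Ht by ring.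
  replace t with (s + (x + (t - (s + x)))) by ring.
  eapply Rle_trans; [apply Rabs_triang|]. rewrite Rplus_assoc. apply Rplus_le_compat_l.
  eapply Rle_trans; [apply Rabs_triang|]. lra.
Qed.

Lemma exp_taylor0 y : Rabs (exp y - 1) <= Rabs y * exp (Rabs y).
Proof.
  destruct (MVT_everywhere exp exp is_derive_exp 0 y) as [c [Hc E]].
  rewrite exp_0 in E. rewrite E, Rminus_0_r, Rabs_mult, Rmult_comm.
  apply Rmult_le_compat_l; [apply Rabs_pos|].
  rewrite (Rabs_pos_eq (exp c)) by (left; apply exp_pos).
  apply Rabs_between in Hc. rewrite !Rminus_0_r in Hc. pose proof (Rle_abs c).
  destruct (Rle_lt_or_eq_dec c (Rabs y)) as [L|L]; [lra | left; apply exp_increasing, L | rewrite L; lra].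
Qed.

Lemma exp_le x y : x <= y -> exp x <= exp y.
Proof. intros [H|H]; [left; apply exp_increasing, H | rewrite H; lra]. Qed.

Lemma exp_taylor1 y : Rabs (exp y - 1 - y) <= exp (Rabs y) * (y * y).
Proof.
  pose proof (taylor1_bound exp 0 y (exp (Rabs y)) smooth_exp) as H.
  rewrite (is_derive_unique exp 0 (exp 0) (is_derive_exp 0)), exp_0, Rminus_0_r, Rmult_1_r in H.
  apply H. intros t Ht. rewrite Rminus_0_r in Ht.
  simpl. rewrite (Derive_ext (Derive exp) exp)
    by (intro; apply is_derive_unique, is_derive_exp).
  rewrite (is_derive_unique _ _ _ (is_derive_exp t)), Rabs_pos_eq by (left; apply exp_pos).
  apply exp_le. pose proof (Rle_abs t). lra.
Qed.

Lemma is_derive_expl s x : is_derive (fun t => exp (s * t)) x (s * exp (s * x)).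
Proof.
  eapply is_derive_eq.
  - apply (is_derive_Rcomp exp (fun t => s * t)); [apply is_derive_exp|].
    apply is_derive_scal, is_derive_Rid.
  - ring.
Qed.

(** Three cases: order 0 is Taylor's bound to second order, order 1 is [h] times a first-order
    bound, and higher orders carry an explicit factor [h * h]. *)
Lemma bd_exp_remainder N A : 0 <= A -> exists C, forall h, Rabs h <= 1 ->
  bd N (fun x => Rabs x <= A) (fun x => exp (h * x) - 1 - h * x) (C * (h * h)).
Proof.
  intros HA. exists (2 ^ N * exp A * (1 + A + A * A)). intros h Hh.
  assert (h0 := Rabs_pos h).
  assert (Ehh : h * h = Rabs h * Rabs h) by (rewrite <- Rabs_mult; symmetry; apply Rabs_pos_eq, Rle_0_sqr).
  assert (He : 1 <= exp A) by (rewrite <- exp_0; apply exp_le; auto).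
  assert (H2 : 1 <= 2 ^ N) by (apply pow_R1_Rle; lra).
  assert (Hb : forall x, Rabs x <= A -> exp (Rabs (h * x)) <= exp A).
  { intros x Hx. apply exp_le. rewrite Rabs_mult. pose proof (Rabs_pos x). nra. }
  assert (HQ : exp A * (1 + A + A * A) <= 2 ^ N * exp A * (1 + A + A * A)).
  { assert (0 <= exp A * (1 + A + A * A)) by (apply Rmult_le_pos; nra).
    rewrite Rmult_assoc. nra. }
  assert (Hhh : 0 <= h * h) by nra.
  assert (D0 : forall x, Rabs x <= A ->
    Rabs (exp (h * x) - 1 - h * x) <= 2 ^ N * exp A * (1 + A + A * A) * (h * h)).
  { intros x Hx. eapply Rle_trans; [apply exp_taylor1|].
    apply Rle_trans with (exp A * (1 + A + A * A) * (h * h)); [|apply Rmult_le_compat_r; auto].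
    rewrite (Rmult_assoc (exp A)).
    apply Rmult_le_compat; [left; apply exp_pos | apply Rle_0_sqr | apply Hb; auto |].
    apply Rabs_le_between in Hx. assert (x * x <= A * A) by nra. nra. }
  assert (d0 : forall x : R, is_derive (fun x => exp (h * x) - 1 - h * x) x (h * exp (h * x) - h)).
  { intro x. eapply is_derive_eq.
    - apply is_derive_Rminus; [apply is_derive_Rminus|].
      + apply is_derive_expl.
      + apply is_derive_Rconst.
      + apply is_derive_scal, is_derive_Rid.
    - ring. }
  assert (d1 : forall x : R, is_derive (fun x => h * exp (h * x) - h) x (h * h * exp (h * x))).
  { intro x. eapply is_derive_eq.
    - apply is_derive_Rminus; [apply is_derive_scal, is_derive_expl | apply is_derive_Rconst].
    - ring. }
  intros j x Hj Hx. destruct j as [|[|j]]; [apply D0; auto | |].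
  - rewrite (Derive_n_of_derive _ _ d0). simpl.
    replace (h * exp (h * x) - h) with (h * (exp (h * x) - 1)) by ring.
    rewrite Rabs_mult, Ehh, (Rmult_comm (_ * _) (Rabs h * Rabs h)), Rmult_assoc.
    apply Rmult_le_compat_l; auto.
    eapply Rle_trans; [apply exp_taylor0|].
    pose proof (Hb x Hx) as Hbx. rewrite Rabs_mult in Hbx |- *. rewrite Rmult_assoc.
    apply Rmult_le_compat_l; auto.
    apply Rle_trans with (A * exp A); [apply Rmult_le_compat; auto using Rabs_pos; left; apply exp_pos|].
    eapply Rle_trans; [|apply HQ]. rewrite Rmult_comm. apply Rmult_le_compat_l; nra.
  - rewrite (Derive_n_of_derive _ _ d0), (Derive_n_of_derive _ _ d1).
    rewrite Derive_n_scal_l, Rabs_mult, (Rabs_pos_eq (h * h)), Rmult_comm by auto.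
    apply Rmult_le_compat_r; auto.
    eapply Rle_trans; [apply (bd_expl j A h); auto; lia|].
    rewrite Rmult_assoc. apply Rmult_le_compat; [apply pow_le; lra | left; apply exp_pos | |].
    + apply Rle_trans with (2 ^ j); [apply pow_incr; lra | apply Rle_pow; [lra | lia]].
    + apply Rle_trans with (exp A); [apply exp_le; nra|]. nra.
Qed.

Definition mulf (w : R -> R) (u : (R -> R) -> C) : (R -> R) -> C :=
  fun f => u (fun x => w x * f x).

Definition xm := mulf (fun x => x).

Lemma rdist_mulf w u : smooth w -> rdist u -> rdist (mulf w u).
Proof.
  intros Hw Hu. pose proof Hu as [_ [_ [K [N [A [HK [HA B]]]]]]]. unfold mulf.
  split; [|split].
  - intros f g Hf Hg. rewrite <- rdist_plus by auto with smooth.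
    f_equal. apply functional_extensionality; intro; ring.
  - intros c f Hf. rewrite <- rdist_scal by auto with smooth.
    f_equal. apply functional_extensionality; intro; ring.
  - destruct (smooth_bd w N A Hw) as [M [HM Bw]].
    exists (K * 2 ^ N * M), N, A. split; [|split; auto].
    + apply Rmult_le_pos; auto. apply Rmult_le_pos; auto. apply pow_le; lra.
    + intros f M' Hf Bf. replace (K * 2 ^ N * M * M') with (K * (2 ^ N * M * M')) by ring.
      apply B; auto with smooth. apply bd_mult; auto.
Qed.

Lemma rdist_xm u : rdist u -> rdist (xm u).
Proof. intros; apply rdist_mulf; auto with smooth. Qed.

(** The Laplace transform with the sign of the exponent reversed, at real [s]. *)
Definition lap (u : (R -> R) -> C) (s : R) : C := u (fun x => exp (s * x)).

Lemma dC_lap u s : rdist u -> dC (lap u) s (lap (xm u) s).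
Proof.
  intros Hu. apply (rdist_derive u (fun t x => exp (t * x))); auto with smooth.
  intros N A HA. destruct (bd_exp_remainder N A HA) as [C HC].
  destruct (smooth_bd (fun x => exp (s * x)) N A (smooth_expl s)) as [M [HM B]].
  exists (2 ^ N * M * C). intros h Hh.
  replace (fun x => exp ((s + h) * x) - exp (s * x) - h * (x * exp (s * x)))
    with (fun x => exp (s * x) * (exp (h * x) - 1 - h * x)).
  - rewrite Rmult_assoc. apply bd_mult; auto 6 with smooth.
  - apply functional_extensionality; intro x. rewrite Rmult_plus_distr_r, exp_plus. ring.
Qed.

(** * Convolution *)

(** The inner bracket of a convolution is complex-valued, whereas [u] acts on real functions. *)
Definition extC (u : (R -> R) -> C) (phi : R -> C) : C :=
  Cplus (u (fun x => Re (phi x))) (Cmult Ci (u (fun x => Im (phi x)))).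

Definition convR (u v : (R -> R) -> C) : (R -> R) -> C :=
  fun f => extC u (fun x => v (fun y => f (x + y))).

Definition refl (u : (R -> R) -> C) : (R -> R) -> C := fun f => u (fun x => f (- x)).

Lemma Derive_n_corr v f n : rdist v -> smooth f ->
  forall x, Derive_n (fun x => Re (v (fun y => f (x + y)))) n x = Re (v (fun y => Derive_n f n (x + y)))
  /\ Derive_n (fun x => Im (v (fun y => f (x + y)))) n x = Im (v (fun y => Derive_n f n (x + y))).
Proof.
  intros Hv. revert f. induction n as [|n IH]; intros f Hf x; [split; reflexivity|].
  rewrite (Derive_n_of_derive (fun x => Re (v (fun y => f (x + y))))
      (fun x => Re (v (fun y => Derive f (x + y)))))
    by (intro; apply (rdist_derive_trans v f); auto).
  rewrite (Derive_n_of_derive (fun x => Im (v (fun y => f (x + y))))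
      (fun x => Im (v (fun y => Derive f (x + y)))))
    by (intro; apply (rdist_derive_trans v f); auto).
  destruct (IH (Derive f) (smooth_Derive f Hf) x) as [E1 E2]. rewrite E1, E2.
  replace (fun y => Derive_n f (S n) (x + y)) with (fun y => Derive_n (Derive f) n (x + y)); auto.
  apply functional_extensionality; intro; symmetry; apply Derive_n_S_l.
Qed.

Lemma smooth_corr v f : rdist v -> smooth f ->
  smooth (fun x => Re (v (fun y => f (x + y)))) /\ smooth (fun x => Im (v (fun y => f (x + y)))).
Proof.
  intros Hv Hf. split.
  - apply smooth_class with
      (S := fun k => exists f, smooth f /\ k = fun x => Re (v (fun y => f (x + y)))); [|eauto].
    intros k [f' [Hf' ->]]. exists (fun x => Re (v (fun y => Derive f' (x + y)))).
    split; [eauto with smooth|]. intro x; apply (rdist_derive_trans v f'); auto.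
  - apply smooth_class with
      (S := fun k => exists f, smooth f /\ k = fun x => Im (v (fun y => f (x + y)))); [|eauto].
    intros k [f' [Hf' ->]]. exists (fun x => Im (v (fun y => Derive f' (x + y)))).
    split; [eauto with smooth|]. intro x; apply (rdist_derive_trans v f'); auto.
Qed.

Lemma rdist_convR u v : rdist u -> rdist v -> rdist (convR u v).
Proof.
  intros Hu Hv. unfold convR, extC.
  pose proof Hu as [_ [_ [K [N [A [HK [HA B]]]]]]].
  pose proof Hv as [_ [_ [K' [N' [A' [HK' [HA' B']]]]]]].
  split; [|split].
  - intros f g Hf Hg.
    destruct (smooth_corr v f Hv Hf), (smooth_corr v g Hv Hg).
    assert (E : forall x, v (fun y => f (x + y) + g (x + y)) =
                Cplus (v (fun y => f (x + y))) (v (fun y => g (x + y))))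
      by (intro; apply rdist_plus; auto using smooth_trans_l).
    replace (fun x => Re (v (fun y => f (x + y) + g (x + y)))) with
      (fun x => Re (v (fun y => f (x + y))) + Re (v (fun y => g (x + y))))
      by (apply functional_extensionality; intro; rewrite E; reflexivity).
    replace (fun x => Im (v (fun y => f (x + y) + g (x + y)))) with
      (fun x => Im (v (fun y => f (x + y))) + Im (v (fun y => g (x + y))))
      by (apply functional_extensionality; intro; rewrite E; reflexivity).
    rewrite !rdist_plus by auto. ring.
  - intros c f Hf.
    destruct (smooth_corr v f Hv Hf).
    assert (E : forall x, v (fun y => c * f (x + y)) = Cmult (RtoC c) (v (fun y => f (x + y))))
      by (intro; apply rdist_scal; auto using smooth_trans_l).
    replace (fun x => Re (v (fun y => c * f (x + y)))) with
      (fun x => c * Re (v (fun y => f (x + y))))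
      by (apply functional_extensionality; intro; rewrite E; simpl; unfold Re; ring).
    replace (fun x => Im (v (fun y => c * f (x + y)))) with
      (fun x => c * Im (v (fun y => f (x + y))))
      by (apply functional_extensionality; intro; rewrite E; simpl; unfold Im; ring).
    rewrite !rdist_scal by auto. ring.
  - exists (2 * K * K'), (N + N')%nat, (A + A'). split; [nra|]. split; [lra|].
    intros f M Hf Bf.
    destruct (smooth_corr v f Hv Hf).
    assert (I : forall j x, (j <= N)%nat -> Rabs x <= A ->
              Cmod (v (fun y => Derive_n f j (x + y))) <= K' * M).
    { intros j x Hj Hx. apply B'; [auto using smooth_trans_l with smooth|].
      intros i y Hi Hy. rewrite Derive_n_trans_l, Derive_n_comp. apply Bf; [lia|].
      eapply Rle_trans; [apply Rabs_triang|]. lra. }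
    eapply Rle_trans; [apply Cmod_triangle|]. rewrite Cmod_mult, Cmod_Ci, Rmult_1_l.
    replace (2 * K * K' * M) with (K * (K' * M) + K * (K' * M)) by ring.
    apply Rplus_le_compat; apply B; auto; intros j x Hj Hx;
      destruct (Derive_n_corr v f j Hv Hf x) as [E1 E2]; [rewrite E1 | rewrite E2];
      (eapply Rle_trans; [|apply (I j x Hj Hx)]); [apply re_le_Cmod | apply im_le_Cmod].
Qed.

Lemma Rabs_m1 : Rabs (-1) = 1.
Proof. rewrite Rabs_left; lra. Qed.

Lemma rdist_refl u : rdist u -> rdist (refl u).
Proof.
  intros Hu. unfold refl. pose proof Hu as [_ [_ [K [N [A [HK [HA B]]]]]]].
  split; [|split].
  - intros f g Hf Hg. apply (rdist_plus u (fun x => f (- x)) (fun x => g (- x)));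
      auto using smooth_reflect.
  - intros c f Hf. apply (rdist_scal u c (fun x => f (- x))); auto using smooth_reflect.
  - exists K, N, A. split; auto. split; auto. intros f M Hf Bf.
    apply B; auto using smooth_reflect. intros j x Hj Hx.
    rewrite Derive_n_comp_opp by (apply smooth_locally, Hf).
    rewrite Rabs_mult, <- RPow_abs, Rabs_m1, pow1, Rmult_1_l.
    apply Bf; auto. rewrite Rabs_Ropp; auto.
Qed.

Lemma lap_refl u s : lap (refl u) s = lap u (- s).
Proof.
  unfold lap, refl. f_equal. apply functional_extensionality; intro. f_equal. ring.
Qed.

Lemma extC_scal u f c : rdist u -> smooth f ->
  extC u (fun x => Cmult (RtoC (f x)) c) = Cmult (u f) c.
Proof.
  intros Hu Hf. unfold extC.
  replace (fun x => Re (RtoC (f x) * c)%C) with (fun x => Re c * f x)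
    by (apply functional_extensionality; intro; simpl; unfold Re; ring).
  replace (fun x => Im (RtoC (f x) * c)%C) with (fun x => Im c * f x)
    by (apply functional_extensionality; intro; simpl; unfold Im; ring).
  rewrite !rdist_scal by auto.
  transitivity (u f * (RtoC (Re c) + Ci * RtoC (Im c)))%C; [ring|]. f_equal.
  rewrite (surjective_pairing c) at 3. unfold Re, Im, Cplus, Cmult, Ci, RtoC; simpl. f_equal; ring.
Qed.

Lemma lap_convR u v s : rdist u -> rdist v -> lap (convR u v) s = Cmult (lap u s) (lap v s).
Proof.
  intros Hu Hv. unfold lap at 1, convR.
  rewrite <- (extC_scal u (fun x => exp (s * x))) by auto with smooth.
  f_equal. apply functional_extensionality; intro x. unfold lap.
  rewrite <- rdist_scal by auto with smooth. f_equal.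
  apply functional_extensionality; intro y. rewrite Rmult_plus_distr_l. apply exp_plus.
Qed.


(** * Exponential growth rates *)

(** Exponential type at most [t] towards plus infinity; the other end is reached through [refl]. The
    slack [d] absorbs polynomial factors, and [rate 0] is subexponential growth. *)
Definition rate (t : R) (B : R -> C) : Prop :=
  forall d, 0 < d -> exists C, 0 <= C /\ forall s, 0 <= s -> Cmod (B s) <= C * exp ((t + d) * s).

Lemma rate_le t t' B : t <= t' -> rate t B -> rate t' B.
Proof.
  intros Ht H d Hd. destruct (H d Hd) as [C [HC HB]]. exists C; split; auto.
  intros s Hs. eapply Rle_trans; [apply HB; auto|].
  apply Rmult_le_compat_l; auto. apply exp_le. apply Rmult_le_compat_r; lra.
Qed.

Lemma rate_plus t B B' : rate t B -> rate t B' -> rate t (fun s => Cplus (B s) (B' s)).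
Proof.
  intros H H' d Hd. destruct (H d Hd) as [C [HC HB]], (H' d Hd) as [C' [HC' HB']].
  exists (C + C'); split; [lra|]. intros s Hs.
  eapply Rle_trans; [apply Cmod_triangle|]. rewrite Rmult_plus_distr_r.
  apply Rplus_le_compat; auto.
Qed.

Lemma rate_mult t t' B B' : rate t B -> rate t' B' -> rate (t + t') (fun s => Cmult (B s) (B' s)).
Proof.
  intros H H' d Hd.
  destruct (H (d / 2) ltac:(lra)) as [C [HC HB]], (H' (d / 2) ltac:(lra)) as [C' [HC' HB']].
  exists (C * C'); split; [nra|]. intros s Hs. rewrite Cmod_mult.
  replace ((t + t' + d) * s) with ((t + d / 2) * s + (t' + d / 2) * s) by field.
  rewrite exp_plus.
  replace (C * C' * (exp ((t + d / 2) * s) * exp ((t' + d / 2) * s)))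
    with ((C * exp ((t + d / 2) * s)) * (C' * exp ((t' + d / 2) * s))) by ring.
  apply Rmult_le_compat; auto using Cmod_ge_0.
Qed.

Lemma rate_const c : rate 0 (fun _ => c).
Proof.
  intros d Hd. exists (Cmod c); split; [apply Cmod_ge_0|]. intros s Hs.
  assert (1 <= exp ((0 + d) * s)) by (rewrite <- exp_0; apply exp_le; nra).
  pose proof (Cmod_ge_0 c). nra.
Qed.

Lemma rate_scal t c B : rate t B -> rate t (fun s => Cmult c (B s)).
Proof.
  intros H. replace t with (0 + t) by ring. apply (rate_mult 0 t (fun _ => c)); auto using rate_const.
Qed.

Lemma rate_pow t B n : rate t B -> rate (INR n * t) (fun s => Cpow (B s) n).
Proof.
  intros H. induction n as [|n IH].
  - simpl. rewrite Rmult_0_l. apply rate_const.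
  - rewrite S_INR. replace ((INR n + 1) * t) with (t + INR n * t) by ring.
    apply (rate_mult t (INR n * t) B (fun s => Cpow (B s) n)); auto.
Qed.

Lemma pow_le_inv a b n : 0 <= b -> a ^ S n <= b ^ S n -> a <= b.
Proof.
  intros Hb H. destruct (Rle_lt_dec a b) as [L|L]; auto.
  assert (b ^ S n < a ^ S n); [|lra].
  clear H. induction n as [|n IH]; [simpl; lra|].
  simpl. simpl in IH. assert (0 <= b * b ^ n) by (apply Rmult_le_pos; auto using pow_le). nra.
Qed.

Lemma exp_INR n x : exp (INR n * x) = exp x ^ n.
Proof.
  induction n as [|n IH]; [simpl; rewrite Rmult_0_l; apply exp_0|].
  rewrite S_INR, Rmult_plus_distr_r, Rmult_1_l, exp_plus, IH. simpl. ring.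
Qed.

Lemma rate_root t B n : rate (INR (S n) * t) (fun s => Cpow (B s) (S n)) -> rate t B.
Proof.
  intros H d Hd. assert (Hn : 0 < INR (S n)) by (apply lt_0_INR; lia).
  destruct (H (INR (S n) * d) ltac:(nra)) as [C [HC HB]].
  (* [1 + C] dominates the root of [C], because [C <= (1 + C) ^ S n]. *)
  exists (1 + C); split; [lra|]. intros s Hs. apply (pow_le_inv _ _ n).
  { apply Rmult_le_pos; [lra | left; apply exp_pos]. }
  rewrite <- Cmod_pow. eapply Rle_trans; [apply HB; auto|].
  rewrite Rpow_mult_distr, <- exp_INR.
  replace ((INR (S n) * t + INR (S n) * d) * s) with (INR (S n) * ((t + d) * s)) by ring.
  apply Rmult_le_compat_r; [left; apply exp_pos|].
  assert (1 <= (1 + C) ^ n) by (apply pow_R1_Rle; lra). simpl. nra.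
Qed.

Lemma pow_le_exp N d : 0 < d -> exists C, 0 <= C /\ forall s, 0 <= s -> (1 + s) ^ N <= C * exp (d * s).
Proof.
  intros Hd. assert (HN : 0 < INR (S N)) by (apply lt_0_INR; lia).
  set (e := d / INR (S N)). assert (He : 0 < e) by (apply Rdiv_lt_0_compat; auto).
  assert (H1 : 0 < / e) by (apply Rinv_0_lt_compat; auto).
  exists ((1 + / e) ^ N); split; [apply pow_le; lra|]. intros s Hs.
  apply Rle_trans with (((1 + / e) * exp (e * s)) ^ N).
  - apply pow_incr. split; [lra|].
    apply Rle_trans with ((1 + / e) * (1 + e * s)).
    + replace ((1 + / e) * (1 + e * s)) with (1 + s + (/ e + e * s)) by (field; lra). nra.
    + apply Rmult_le_compat_l; [lra|].
      destruct (Req_dec (e * s) 0) as [E|E]; [rewrite E, exp_0; lra | left; apply exp_ineq1; auto].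
  - rewrite Rpow_mult_distr. apply Rmult_le_compat_l; [apply pow_le; lra|].
    rewrite <- exp_INR. apply exp_le. unfold e.
    rewrite <- Rmult_assoc. apply Rmult_le_compat_r; auto.
    apply Rmult_le_reg_r with (INR (S N)); auto.
    replace (INR N * (d / INR (S N)) * INR (S N)) with (INR N * d) by (field; lra).
    rewrite Rmult_comm. apply Rmult_le_compat_l; [lra|]. rewrite S_INR. lra.
Qed.

(** The type is the radius of the ball that controls [v], which multiplication by powers of [x]
    leaves unchanged. The powers of [1 + s] produced by differentiating the exponential go into the
    slack. *)
Lemma rate_lap v : rdist v -> exists l, 0 <= l /\ forall j, rate l (lap (mulf (fun x => x ^ j) v)).
Proof.
  intros Hv. pose proof Hv as [_ [_ [K [N [A [HK [HA B]]]]]]].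
  exists A. split; auto. intros j d Hd.
  destruct (smooth_bd (fun x => x ^ j) N A (smooth_pow j)) as [M [HM Bj]].
  destruct (pow_le_exp N d Hd) as [C [HC HP]].
  exists (K * (2 ^ N * M * C)).
  assert (0 <= 2 ^ N) by (apply pow_le; lra).
  split; [apply Rmult_le_pos; auto; apply Rmult_le_pos; auto; apply Rmult_le_pos; auto|].
  intros s Hs. unfold lap, mulf.
  eapply Rle_trans; [apply B; [auto with smooth|]; apply bd_mult;
    [auto with smooth | auto with smooth | apply Bj | apply bd_expl]|].
  rewrite (Rabs_pos_eq s Hs), !Rmult_assoc. apply Rmult_le_compat_l; auto.
  apply Rmult_le_compat_l; auto. apply Rmult_le_compat_l; auto.
  rewrite Rmult_plus_distr_r, exp_plus, (Rmult_comm (exp (A * s))), <- Rmult_assoc.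
  apply Rmult_le_compat_r; [left; apply exp_pos | auto].
Qed.

Lemma mulf_pow_xm v j : mulf (fun x => x ^ j) (xm v) = mulf (fun x => x ^ S j) v.
Proof.
  apply functional_extensionality; intro f. unfold xm, mulf. f_equal.
  apply functional_extensionality; intro; simpl; ring.
Qed.

Lemma xm_mulf_pow v j : xm (mulf (fun x => x ^ j) v) = mulf (fun x => x ^ S j) v.
Proof.
  apply functional_extensionality; intro f. unfold xm, mulf. f_equal.
  apply functional_extensionality; intro; simpl; ring.
Qed.

Lemma mulf_pow0 v : mulf (fun x => x ^ 0) v = v.
Proof.
  apply functional_extensionality; intro f. unfold mulf. f_equal.
  apply functional_extensionality; intro; simpl; ring.
Qed.

Lemma mulf_pow1 v : mulf (fun x => x ^ 1) v = xm v.
Proof. rewrite <- xm_mulf_pow, mulf_pow0. reflexivity. Qed.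

(** [f' s] differs by at most [M * h] from the slope of [f] across the window, and that slope is at
    most [2 * m / h]. *)
Lemma landau_local (f f' f'' : R -> R) s h M m :
  (forall x, is_derive f x (f' x)) -> (forall x, is_derive f' x (f'' x)) -> 0 < h ->
  (forall x, s <= x <= s + h -> Rabs (f'' x) <= M) ->
  (forall x, s <= x <= s + h -> Rabs (f x) <= m) ->
  Rabs (f' s) <= 2 * m / h + M * h.
Proof.
  intros Hf Hf' Hh HM Hm.
  destruct (MVT_everywhere f f' Hf s (s + h)) as [c [Hc E]].
  rewrite Rmin_left, Rmax_right in Hc by lra.
  destruct (MVT_everywhere f' f'' Hf' s c) as [d [Hd E']].
  rewrite Rmin_left, Rmax_right in Hd by lra.
  replace (f' s) with ((f (s + h) - f s) / h - f'' d * (c - s)).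
  2:{ rewrite E, <- E'. field. lra. }
  unfold Rminus at 1. eapply Rle_trans; [apply Rabs_triang|]. rewrite Rabs_Ropp.
  apply Rplus_le_compat.
  - unfold Rdiv. rewrite Rabs_mult, (Rabs_pos_eq (/ h)) by (left; apply Rinv_0_lt_compat; auto).
    apply Rmult_le_compat_r; [left; apply Rinv_0_lt_compat; auto|].
    unfold Rminus. eapply Rle_trans; [apply Rabs_triang|]. rewrite Rabs_Ropp.
    assert (Rabs (f (s + h)) <= m) by (apply Hm; lra). assert (Rabs (f s) <= m) by (apply Hm; lra). lra.
  - rewrite Rabs_mult. apply Rmult_le_compat; auto using Rabs_pos; [apply HM; lra|].
    rewrite Rabs_pos_eq by lra. lra.
Qed.

(* Landau's inequality on a window of length [exp (- (r2 - r0) / 2 * s)]. *)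
Lemma rate_midpoint v r0 r2 : rdist v -> r0 <= r2 ->
  rate r0 (lap v) -> rate r2 (lap (xm (xm v))) -> rate ((r0 + r2) / 2) (lap (xm v)).
Proof.
  intros Hv Hr H0 H2 d Hd.
  destruct (H0 d Hd) as [C0 [HC0 B0]], (H2 d Hd) as [C2 [HC2 B2]].
  set (g := (r2 - r0) / 2).
  set (K0 := exp (Rabs (r0 + d))). set (K2 := exp (Rabs (r2 + d))).
  assert (k0 : 0 < K0) by apply exp_pos. assert (k2 : 0 < K2) by apply exp_pos.
  exists (2 * (2 * C0 * K0 + C2 * K2)). split; [nra|]. intros s Hs.
  set (h := exp (- (g * s))).
  assert (Hh : 0 < h) by apply exp_pos.
  assert (Hgs : 0 <= g * s) by (apply Rmult_le_pos; unfold g; lra).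
  assert (Hh1 : h <= 1) by (rewrite <- exp_0; apply exp_le; lra).
  assert (W : forall r t, s <= t <= s + h -> exp (r * t) <= exp (Rabs r) * exp (r * s)).
  { intros r t Ht. rewrite <- exp_plus. apply exp_le.
    replace (r * t) with (r * (t - s) + r * s) by ring. apply Rplus_le_compat_r.
    eapply Rle_trans; [apply Rle_abs|]. rewrite Rabs_mult, (Rabs_pos_eq (t - s)) by lra.
    pose proof (Rabs_pos r). nra. }
  set (m := C0 * (K0 * exp ((r0 + d) * s))). set (M := C2 * (K2 * exp ((r2 + d) * s))).
  assert (Bm : forall t, s <= t <= s + h -> Cmod (lap v t) <= m).
  { intros t Ht. eapply Rle_trans; [apply B0; lra|]. apply Rmult_le_compat_l; auto. }
  assert (BM : forall t, s <= t <= s + h -> Cmod (lap (xm (xm v)) t) <= M).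
  { intros t Ht. eapply Rle_trans; [apply B2; lra|]. apply Rmult_le_compat_l; auto. }
  assert (E : 2 * m / h + M * h = (2 * C0 * K0 + C2 * K2) * exp (((r0 + r2) / 2 + d) * s)).
  { assert (E1 : exp ((r0 + d) * s) / h = exp (((r0 + r2) / 2 + d) * s)).
    { unfold h, Rdiv. rewrite <- exp_Ropp, <- exp_plus. f_equal. unfold g. field. }
    assert (E2 : exp ((r2 + d) * s) * h = exp (((r0 + r2) / 2 + d) * s)).
    { unfold h. rewrite <- exp_plus. f_equal. unfold g. field. }
    transitivity (2 * C0 * K0 * (exp ((r0 + d) * s) / h) + C2 * K2 * (exp ((r2 + d) * s) * h)).
    - unfold m, M. field. lra.
    - rewrite E1, E2. ring. }
  eapply Rle_trans; [apply Cmod_le_Re_Im|].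
  rewrite Rmult_assoc, <- E.
  assert (H1 : Rabs (Re (lap (xm v) s)) <= 2 * m / h + M * h).
  { apply (landau_local (fun t => Re (lap v t)) (fun t => Re (lap (xm v) t)) (fun t => Re (lap (xm (xm v)) t))); auto.
    - intro; apply dC_lap; auto.
    - intro; apply dC_lap; auto using rdist_xm.
    - intros; eapply Rle_trans; [apply re_le_Cmod | auto].
    - intros; eapply Rle_trans; [apply re_le_Cmod | auto]. }
  assert (H3 : Rabs (Im (lap (xm v) s)) <= 2 * m / h + M * h).
  { apply (landau_local (fun t => Im (lap v t)) (fun t => Im (lap (xm v) t)) (fun t => Im (lap (xm (xm v)) t))); auto.
    - intro; apply dC_lap; auto.
    - intro; apply dC_lap; auto using rdist_xm.
    - intros; eapply Rle_trans; [apply im_le_Cmod | auto].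
    - intros; eapply Rle_trans; [apply im_le_Cmod | auto]. }
  lra.
Qed.

(** A bootstrap on [c = 2 / (n + 2)], the fraction of the gap [l - t] lost by one differentiation.
    It starts at [c = 1], the a priori rate [l]. The induction hypothesis for [v] and then for
    [xm v] bounds the second derivative; the midpoint of rates then loses only [c * (1 - c / 2)],
    which is at most [2 / (n + 3)]. *)
Lemma rate_xm_approx l n : forall v t, rdist v -> (forall j, rate l (lap (mulf (fun x => x ^ j) v))) ->
  t <= l -> rate t (lap v) -> rate (t + 2 / INR (n + 2) * (l - t)) (lap (xm v)).
Proof.
  induction n as [|n IH]; intros v t Hv Hl Htl Ht.
  - simpl. replace (t + 2 / (1 + 1) * (l - t)) with l by field.
    rewrite <- mulf_pow1. apply Hl.
  - set (c := 2 / INR (n + 2)).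
    assert (Hn : 2 <= INR (n + 2)) by (rewrite plus_INR; simpl; pose proof (pos_INR n); lra).
    assert (Hc : 0 < c) by (apply Rdiv_lt_0_compat; lra).
    assert (Hc1 : c <= 1).
    { unfold c. apply Rmult_le_reg_r with (INR (n + 2)); [lra|].
      unfold Rdiv. rewrite Rmult_assoc, Rinv_l; lra. }
    pose proof (IH v t Hv Hl Htl Ht) as R1. fold c in R1.
    assert (Hr1 : t + c * (l - t) <= l) by nra.
    assert (Hl' : forall j, rate l (lap (mulf (fun x => x ^ j) (xm v)))).
    { intro j. rewrite mulf_pow_xm. apply Hl. }
    pose proof (IH (xm v) _ (rdist_xm v Hv) Hl' Hr1 R1) as R2. fold c in R2.
    eapply rate_le; [|apply (rate_midpoint v t (t + c * (l - t) + c * (l - (t + c * (l - t))))); auto; nra].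
    assert (c * (1 - c / 2) <= 2 / INR (S n + 2)); [|nra].
    replace (INR (S n + 2)) with (INR (n + 2) + 1) by (rewrite !plus_INR, (S_INR n); ring).
    unfold c. set (k := INR (n + 2)) in *.
    apply Rmult_le_reg_r with (k * k * (k + 1)); [nra|].
    replace (2 / k * (1 - 2 / k / 2) * (k * k * (k + 1))) with (2 * (k - 1) * (k + 1)) by (field; lra).
    replace (2 / (k + 1) * (k * k * (k + 1))) with (2 * k * k) by (field; lra). nra.
Qed.

Lemma rate_closed t B : (forall e, 0 < e -> rate (t + e) B) -> rate t B.
Proof.
  intros H d Hd. destruct (H (d / 2) ltac:(lra) (d / 2) ltac:(lra)) as [C [HC HB]].
  exists C; split; auto. intros s Hs.
  replace (t + d) with (t + d / 2 + d / 2) by field. auto.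
Qed.

(** Stands in for a Cauchy estimate. The type [l] common to all derivatives feeds the bootstrap,
    whose loss tends to 0. *)
Lemma rate_xm v t : rdist v -> rate t (lap v) -> rate t (lap (xm v)).
Proof.
  intros Hv Ht. destruct (rate_lap v Hv) as [l [_ Hl]].
  destruct (Rle_dec t l) as [L|L].
  - apply rate_closed. intros e He.
    destruct (INR_archimed e (2 * (l - t))) as [n Hn]; [auto|].
    eapply rate_le; [|apply (rate_xm_approx l n v t); auto].
    apply Rplus_le_compat_l.
    assert (Hn2 : 0 < INR (n + 2)) by (apply lt_0_INR; lia).
    apply Rmult_le_reg_r with (INR (n + 2)); auto.
    replace (2 / INR (n + 2) * (l - t) * INR (n + 2)) with (2 * (l - t)) by (field; lra).
    rewrite plus_INR. simpl. nra.
  - apply rate_le with l; [lra|]. rewrite <- mulf_pow1. apply Hl.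
Qed.


(** * Polynomials and density *)

(** Horner form: proofs peel off the constant term, and no degree has to be tracked. *)
Inductive polyf : (R -> R) -> Prop :=
| poly_const c : polyf (fun _ => c)
| poly_horner c Q : polyf Q -> polyf (fun s => c + s * Q s).

Lemma poly_ext P Q : (forall x, P x = Q x) -> polyf P -> polyf Q.
Proof. intros H HP. replace Q with P; auto. apply functional_extensionality, H. Qed.

Lemma poly_plus P Q : polyf P -> polyf Q -> polyf (fun x => P x + Q x).
Proof.
  intros HP. revert Q. induction HP as [c|c P HP IH]; intros Q [d|d Q' HQ].
  - apply (poly_const (c + d)).
  - apply poly_ext with (fun x => (c + d) + x * Q' x); [intro; ring | apply poly_horner, HQ].
  - apply poly_ext with (fun x => (c + d) + x * P x); [intro; ring | apply poly_horner, HP].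
  - apply poly_ext with (fun x => (c + d) + x * (P x + Q' x)); [intro; ring | apply poly_horner, IH, HQ].
Qed.

Lemma poly_scal c P : polyf P -> polyf (fun x => c * P x).
Proof.
  intros HP. induction HP as [d|d P HP IH].
  - apply (poly_const (c * d)).
  - apply poly_ext with (fun x => c * d + x * (c * P x)); [intro; ring | apply poly_horner, IH].
Qed.

Lemma poly_mult P Q : polyf P -> polyf Q -> polyf (fun x => P x * Q x).
Proof.
  intros HP HQ. induction HP as [d|d P HP IH].
  - apply poly_scal, HQ.
  - apply poly_ext with (fun x => d * Q x + (0 + x * (P x * Q x))); [intro; ring|].
    apply poly_plus; [apply poly_scal, HQ | apply poly_horner, IH].
Qed.

Lemma poly_id : polyf (fun x => x).
Proof. apply poly_ext with (fun x => 0 + x * 1); [intro; ring | apply poly_horner, poly_const]. Qed.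

Lemma poly_pow n : polyf (fun x => x ^ n).
Proof. induction n as [|n IH]; [apply (poly_const 1) | apply (poly_mult _ _ poly_id IH)]. Qed.

Lemma poly_comp P Q : polyf P -> polyf Q -> polyf (fun x => P (Q x)).
Proof.
  intros HP HQ. induction HP as [d|d P HP IH]; [apply poly_const|].
  apply poly_plus; [apply poly_const | apply poly_mult; auto].
Qed.

Lemma smooth_poly P : polyf P -> smooth P.
Proof. intros HP. induction HP; auto with smooth. Qed.

Lemma is_derive_monomial k c (x : R) : is_derive (fun t => c / INR (S k) * t ^ S k) x (x ^ k * c).
Proof.
  eapply is_derive_eq.
  - apply is_derive_scal. apply (is_derive_pow (fun t => t) (S k) x 1), is_derive_Rid.
  - simpl Init.Nat.pred. field. apply not_0_INR. lia.
Qed.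

(** The weight [x ^ k] carries the induction: Horner's factor [s] turns weight [k] into weight
    [S k]. *)
Lemma poly_antiderivative_aux Q : polyf Q -> forall k, exists P, polyf P /\
  forall x : R, is_derive P x (x ^ k * Q x).
Proof.
  intros HQ. induction HQ as [c|c Q HQ IH]; intro k.
  - exists (fun x => c / INR (S k) * x ^ S k). split; [apply poly_scal, poly_pow|].
    intro; apply is_derive_monomial.
  - destruct (IH (S k)) as [P [HP D]].
    exists (fun x => c / INR (S k) * x ^ S k + P x). split.
    + apply poly_plus; auto. apply poly_scal, poly_pow.
    + intro x. eapply is_derive_eq; [apply is_derive_Rplus; [apply is_derive_monomial | apply D]|].
      simpl; ring.
Qed.

Lemma poly_antiderivative Q : polyf Q -> exists P, polyf P /\ forall x : R, is_derive P x (Q x).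
Proof.
  intros HQ. destruct (poly_antiderivative_aux Q HQ 0) as [P [HP D]].
  exists P; split; auto. intro x. eapply is_derive_eq; [apply D|]. simpl; ring.
Qed.

Lemma poly_of_derive (f Q : R -> R) : polyf Q -> (forall x : R, is_derive f x (Q x)) -> polyf f.
Proof.
  intros HQ D. destruct (poly_antiderivative Q HQ) as [P [HP DP]].
  apply poly_ext with (fun x => (f 0 - P 0) + P x).
  - intro x. assert (E : (fun t => f t - P t) x = (fun t => f t - P t) 0).
    { apply (derive_zero_const (fun t => f t - P t)). intro t. eapply is_derive_eq.
      - apply is_derive_Rminus; auto.
      - ring. }
    simpl in E. lra.
  - apply poly_plus; auto. apply poly_const.
Qed.

(* The value at [x] of the Bernstein polynomial of the samples [f 0, ..., f n]:
   the mean of [f] under the binomial law, by conditioning on the first trial. *)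
Fixpoint bern (n : nat) (f : nat -> R) (x : R) : R :=
  match n with
  | O => f O
  | S n => (1 - x) * bern n f x + x * bern n (fun i => f (S i)) x
  end.

Lemma poly_bern n : forall f, polyf (bern n f).
Proof.
  induction n as [|n IH]; intro f; simpl; [apply poly_const|].
  apply poly_plus; [apply poly_mult; auto | apply (poly_mult (fun x => x)); auto using poly_id].
  apply poly_ext with (fun x => 1 + x * (-1)); [intro; ring | apply poly_horner, poly_const].
Qed.

Lemma bern_le n x : 0 <= x <= 1 -> forall f g, (forall i, (i <= n)%nat -> f i <= g i) ->
  bern n f x <= bern n g x.
Proof.
  intros Hx. induction n as [|n IH]; intros f g H; simpl; [apply H; lia|].
  assert (bern n f x <= bern n g x) by (apply IH; intros; apply H; lia).
  assert (bern n (fun i => f (S i)) x <= bern n (fun i => g (S i)) x)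
    by (apply IH; intros; apply H; lia).
  nra.
Qed.

(** The first two moments of the binomial law. General coefficients are forced by the recursion,
    where passing from [i] to [S i] mixes them. *)
Lemma bern_quadratic n x : forall a b c,
  bern n (fun i => a + b * INR i + c * (INR i * INR i)) x
  = a + b * (INR n * x) + c * (INR n * x * (1 - x) + INR n * x * (INR n * x)).
Proof.
  induction n as [|n IH]; intros a b c; [simpl; ring|].
  change (bern (S n) ?f x) with ((1 - x) * bern n f x + x * bern n (fun i => f (S i)) x).
  cbv beta. rewrite IH.
  replace (fun i => a + b * INR (S i) + c * (INR (S i) * INR (S i)))
    with (fun i => (a + b + c) + (b + 2 * c) * INR i + c * (INR i * INR i)).
  - rewrite IH, S_INR. ring.
  - apply functional_extensionality; intro i. rewrite S_INR. ring.
Qed.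

(** Taylor squeezes [f] between two quadratics centred at [x], on which [bern] is exact and returns
    [f x] up to a variance term. Nodes are within [2 * A] of [x], whence the radius [3 * A]. *)
Lemma bern_approx f A M n x : smooth f -> 0 < A -> (0 < n)%nat -> Rabs x <= A ->
  (forall t, Rabs t <= 3 * A -> Rabs (Derive_n f 2 t) <= M) ->
  Rabs (bern n (fun i => f (- A + 2 * A * (INR i / INR n))) ((x + A) / (2 * A)) - f x)
    <= M * (A * A) / INR n.
Proof.
  intros Hf HA Hn Hx HM. set (t := (x + A) / (2 * A)).
  assert (Hn' : 0 < INR n) by (apply lt_0_INR; auto).
  pose proof Hx as Hx'. apply Rabs_le_between in Hx'.
  assert (Ht : 0 <= t <= 1).
  { unfold t; split.
    - apply Rmult_le_pos; [lra | left; apply Rinv_0_lt_compat; lra].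
    - apply Rmult_le_reg_r with (2 * A); [lra|]. unfold Rdiv. rewrite Rmult_assoc, Rinv_l; lra. }
  assert (Et : x = - A + 2 * A * t) by (unfold t; field; lra).
  assert (HM0 : 0 <= M) by (eapply Rle_trans; [apply Rabs_pos | apply (HM x); lra]).
  set (y := fun i => - A + 2 * A * (INR i / INR n)).
  assert (Hy : forall i, (i <= n)%nat -> - A <= y i <= A).
  { intros i Hi. assert (0 <= INR i / INR n <= 1).
    - split; [apply Rmult_le_pos; [apply pos_INR | left; apply Rinv_0_lt_compat; auto]|].
      apply Rmult_le_reg_r with (INR n); auto. unfold Rdiv.
      rewrite Rmult_assoc, Rinv_l, Rmult_1_r, Rmult_1_l by lra. apply le_INR, Hi.
    - unfold y. nra. }
  set (q := fun m i => f x + (y i - x) * Derive f x + m * ((y i - x) * (y i - x))).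
  assert (Hq : forall m, bern n (q m) t = f x + m * (4 * (A * A)) * (t * (1 - t)) / INR n).
  { intro m. set (h := 2 * A / INR n). set (z := - A - x).
    replace (q m) with (fun i => (f x + z * Derive f x + m * (z * z))
       + (h * Derive f x + 2 * m * z * h) * INR i + (m * (h * h)) * (INR i * INR i)).
    - rewrite bern_quadratic. unfold z, h. rewrite Et. field. lra.
    - apply functional_extensionality; intro i. unfold q, y, z, h. field. lra. }
  assert (HT : forall i, (i <= n)%nat -> q (- M) i <= f (y i) <= q M i).
  { intros i Hi. specialize (Hy i Hi).
    assert (B : Rabs (f (y i) - f x - (y i - x) * Derive f x) <= M * ((y i - x) * (y i - x))).
    - apply taylor1_bound; auto. intros s Hs. apply HM.
      replace s with (x + (s - x)) by ring. eapply Rle_trans; [apply Rabs_triang|].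
      assert (Rabs (y i - x) <= 2 * A) by (apply Rabs_le_between; lra). lra.
    - apply Rabs_le_between in B. unfold q. lra. }
  assert (L1 : bern n (q (- M)) t <= bern n (fun i => f (y i)) t)
    by (apply bern_le; auto; intros; apply HT; auto).
  assert (L2 : bern n (fun i => f (y i)) t <= bern n (q M) t)
    by (apply bern_le; auto; intros; apply HT; auto).
  rewrite Hq in L1, L2.
  assert (E : M * (4 * (A * A)) * (t * (1 - t)) / INR n <= M * (A * A) / INR n).
  { apply Rmult_le_compat_r; [left; apply Rinv_0_lt_compat; auto|].
    rewrite Rmult_assoc. apply Rmult_le_compat_l; auto.
    assert (0 <= (2 * t - 1) * (2 * t - 1)) by apply Rle_0_sqr.
    assert (4 * (t * (1 - t)) <= 1) by nra.
    replace (4 * (A * A) * (t * (1 - t))) with (A * A * (4 * (t * (1 - t)))) by ring.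
    assert (0 < A * A) by nra. nra. }
  replace (- M * (4 * (A * A)) * (t * (1 - t)) / INR n)
    with (- (M * (4 * (A * A)) * (t * (1 - t)) / INR n)) in L1 by (field; lra).
  apply Rabs_le_between. unfold y in L1, L2. lra.
Qed.

Lemma weierstrass0 f A e : smooth f -> 0 < A -> 0 < e ->
  exists Q, polyf Q /\ forall x, Rabs x <= A -> Rabs (f x - Q x) <= e.
Proof.
  intros Hf HA He.
  destruct (smooth_bounded (Derive_n f 2) (3 * A) (smooth_Derive_n f 2 Hf)) as [M [HM B]].
  destruct (INR_archimed e (M * (A * A)) He) as [n Hn].
  assert (Hn1 : 0 < INR (S n)) by (apply lt_0_INR; lia).
  exists (fun x => bern (S n) (fun i => f (- A + 2 * A * (INR i / INR (S n)))) ((x + A) / (2 * A))).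
  split.
  - apply (poly_comp (bern (S n) (fun i => f (- A + 2 * A * (INR i / INR (S n)))))
      (fun x => (x + A) / (2 * A))); [apply poly_bern|].
    apply poly_ext with (fun x => A / (2 * A) + x * (/ (2 * A))); [intro; field; lra|].
    apply poly_horner, poly_const.
  - intros x Hx. rewrite Rabs_minus_sym.
    eapply Rle_trans; [apply (bern_approx f A M (S n) x); auto; lia|].
    apply Rmult_le_reg_r with (INR (S n)); auto. unfold Rdiv.
    rewrite Rmult_assoc, Rinv_l, Rmult_1_r by lra. rewrite S_INR. lra.
Qed.

(** Bernstein polynomials serve at order 0 only. Otherwise the derivative is approximated and then
    integrated from 0, which costs a factor of at most [1 + A]. *)
Lemma weierstrass N A : 0 < A -> forall f e, smooth f -> 0 < e ->
  exists Q, polyf Q /\ bd N (fun x => Rabs x <= A) (fun x => f x - Q x) e.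
Proof.
  intros HA. induction N as [|N IH]; intros f e Hf He.
  - destruct (weierstrass0 f A e Hf HA He) as [Q [HQ B]]. exists Q; split; auto.
    intros j x Hj Hx. replace j with 0%nat by lia. apply B, Hx.
  - destruct (IH (Derive f) (e / (1 + A))) as [Q0 [HQ0 B]]; auto with smooth.
    { apply Rdiv_lt_0_compat; lra. }
    destruct (poly_antiderivative Q0 HQ0) as [P [HP D]].
    assert (Hd : forall x : R, is_derive (fun x => f x - (f 0 - P 0 + P x)) x (Derive f x - Q0 x)).
    { intro x. eapply is_derive_eq.
      - apply is_derive_Rminus; [apply smooth_is_derive, Hf|].
        apply is_derive_Rplus; [apply is_derive_Rconst | apply D].
      - ring. }
    assert (He' : e / (1 + A) * (1 + A) = e) by (field; lra).
    assert (0 < e / (1 + A)) by (apply Rdiv_lt_0_compat; lra).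
    exists (fun x => (f 0 - P 0) + P x). split.
    { apply poly_plus; auto. apply poly_const. }
    apply bd_S with (fun x => Derive f x - Q0 x); [apply Hd | |].
    + intros x Hx. destruct (MVT_everywhere _ _ Hd 0 x) as [c [Hc E]].
      replace (f x - (f 0 - P 0 + P x)) with ((Derive f c - Q0 c) * (x - 0)) by (rewrite <- E; ring).
      apply Rabs_between in Hc. rewrite !Rminus_0_r in Hc.
      rewrite Rabs_mult, Rminus_0_r.
      assert (Rabs (Derive f c - Q0 c) <= e / (1 + A)) by (apply (B 0%nat c); [lia | lra]).
      pose proof (Rabs_pos (Derive f c - Q0 c)). pose proof (Rabs_pos x). nra.
    + eapply bd_le; [|apply B]. nra.
Qed.

Lemma rdist_zero_on_poly v Q : rdist v -> (forall j, v (fun x => x ^ j) = RtoC 0) ->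
  polyf Q -> v Q = RtoC 0.
Proof.
  intros Hv H HQ.
  assert (G : forall k, v (fun x => x ^ k * Q x) = RtoC 0).
  { induction HQ as [c|c Q HQ IH]; intro k.
    - replace (fun x => x ^ k * c) with (fun x => c * x ^ k)
        by (apply functional_extensionality; intro; ring).
      rewrite rdist_scal, H by auto with smooth. ring.
    - replace (fun x => x ^ k * (c + x * Q x)) with (fun x => c * x ^ k + x ^ S k * Q x)
        by (apply functional_extensionality; intro; simpl; ring).
      pose proof (smooth_poly Q HQ).
      rewrite rdist_plus, rdist_scal, H, IH by auto with smooth. ring. }
  rewrite <- (G 0%nat). f_equal. apply functional_extensionality; intro; simpl; ring.
Qed.

Lemma rdist_moments_zero v : rdist v -> (forall j, v (fun x => x ^ j) = RtoC 0) ->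
  forall f, smooth f -> v f = RtoC 0.
Proof.
  intros Hv H f Hf. pose proof Hv as [_ [_ [K [N [A [HK [HA B]]]]]]].
  apply Cmod_eq_0. apply Rle_antisym; [|apply Cmod_ge_0].
  apply le_epsilon. intros e He. rewrite Rplus_0_l.
  (* [A] and [K] may be 0; adding 1 keeps the radius and the denominator positive. *)
  destruct (weierstrass N (A + 1) ltac:(lra) f (e / (K + 1)) Hf) as [Q [HQ BQ]].
  { apply Rdiv_lt_0_compat; lra. }
  pose proof (smooth_poly Q HQ).
  replace (v f) with (v (fun x => f x - Q x)).
  2:{ rewrite rdist_minus, (rdist_zero_on_poly v Q) by auto. ring. }
  apply Rle_trans with (K * (e / (K + 1))).
  - apply B; auto with smooth. intros j x Hj Hx. apply BQ; auto; lra.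
  - apply Rmult_le_reg_r with (K + 1); [lra|].
    replace (K * (e / (K + 1)) * (K + 1)) with (K * e) by (field; lra). nra.
Qed.


(** * Subexponential transforms are polynomials *)

Fixpoint esum (K : nat) (w : R) : R :=
  match K with
  | O => 1
  | S K => esum K w + w ^ S K / INR (fact (S K))
  end.

Lemma is_derive_pow_fact k (x : R) :
  is_derive (fun w => w ^ S k / INR (fact (S k))) x (x ^ k / INR (fact k)).
Proof.
  eapply is_derive_ext; [|apply (is_derive_monomial k (/ INR (fact k)) x)].
  intro t; cbv beta. rewrite fact_simpl, mult_INR. unfold Rdiv. rewrite Rinv_mult. simpl. ring.
Qed.

Lemma is_derive_esum K (w : R) : is_derive (esum (S K)) w (esum K w).
Proof.
  induction K as [|K IH].
  - eapply is_derive_eq.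
    + apply (is_derive_Rplus (fun _ => 1) (fun w => w ^ 1 / INR (fact 1)));
        [apply is_derive_Rconst | apply is_derive_pow_fact].
    + simpl. field.
  - apply (is_derive_Rplus (esum (S K)) (fun w => w ^ S (S K) / INR (fact (S (S K)))));
      [apply IH | apply is_derive_pow_fact].
Qed.

Lemma smooth_esum K : smooth (esum K).
Proof.
  induction K as [|K IH]; [exact (smooth_const 1)|].
  exact (smooth_of_derive _ _ (is_derive_esum K) IH).
Qed.

Definition erem (K : nat) (w : R) : R := exp (- w) - esum K (- w).

Lemma is_derive_erem K (w : R) : is_derive (erem (S K)) w (- erem K w).
Proof.
  unfold erem. eapply is_derive_eq.
  - apply (is_derive_Rminus (fun w => exp (- w)) (fun w => esum (S K) (- w))).
    + apply (is_derive_Rcomp exp (fun t => - t)); [apply is_derive_exp | apply is_derive_Ropp].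
    + apply (is_derive_Rcomp (esum (S K)) (fun t => - t)); [apply is_derive_esum | apply is_derive_Ropp].
  - ring.
Qed.

Lemma smooth_erem K : smooth (erem K).
Proof.
  apply smooth_minus; [apply (smooth_comp exp) | apply (smooth_comp (esum K))];
  auto using smooth_esum with smooth.
Qed.

Lemma derive_nonneg_le (f f' : R -> R) w : (forall x : R, is_derive f x (f' x)) ->
  (forall x, 0 <= x -> 0 <= f' x) -> 0 <= w -> f 0 <= f w.
Proof.
  intros D H Hw. destruct (MVT_everywhere f f' D 0 w) as [c [Hc E]].
  rewrite Rmin_left, Rmax_right in Hc by lra.
  specialize (H c ltac:(lra)). nra.
Qed.

Lemma erem_at_0 K : erem K 0 = 0.
Proof.
  unfold erem. rewrite Ropp_0, exp_0.
  assert (H : esum K 0 = 1); [|lra].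
  induction K as [|K IH]; [reflexivity|]. simpl. rewrite IH. unfold Rdiv. ring.
Qed.

(** For [w >= 0] the series of [exp (- w)] alternates, so the first omitted term bounds the
    remainder. Each remainder is minus the derivative of the next, and the bound integrates from
    0. *)
Lemma erem_bound K w : 0 <= w -> Rabs (erem K w) <= w ^ S K / INR (fact (S K)).
Proof.
  revert w. induction K as [|K IH]; intros w Hw.
  - unfold erem. simpl. replace (w * 1 / 1) with w by field.
    pose proof (exp_ineq1_le (- w)).
    assert (exp (- w) <= 1) by (rewrite <- exp_0; apply exp_le; lra).
    apply Rabs_le_between. lra.
  - pose proof (is_derive_pow_fact (S K)) as P.
    assert (Z : 0 ^ S (S K) / INR (fact (S (S K))) = 0) by (simpl; unfold Rdiv; ring).
    apply Rabs_le_between. split.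
    + pose proof (derive_nonneg_le (fun x => x ^ S (S K) / INR (fact (S (S K))) + erem (S K) x)
        (fun x => x ^ S K / INR (fact (S K)) + - erem K x) w) as L.
      cbv beta in L. rewrite Z, erem_at_0 in L.
      apply Rplus_le_reg_l with (w ^ S (S K) / INR (fact (S (S K)))).
      rewrite Rplus_opp_r. replace 0 with (0 + 0) by ring. apply L; auto.
      * intro x. apply is_derive_Rplus; [apply P | apply is_derive_erem].
      * intros x Hx. specialize (IH x Hx). apply Rabs_le_between in IH. lra.
    + pose proof (derive_nonneg_le (fun x => x ^ S (S K) / INR (fact (S (S K))) - erem (S K) x)
        (fun x => x ^ S K / INR (fact (S K)) + erem K x) w) as L.
      cbv beta in L. rewrite Z, erem_at_0 in L.
      enough (0 - 0 <= w ^ S (S K) / INR (fact (S (S K))) - erem (S K) w) by lra.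
      apply L; auto.
      * intro x. eapply is_derive_eq.
        -- apply is_derive_Rminus; [apply P | apply is_derive_erem].
        -- ring.
      * intros x Hx. specialize (IH x Hx). apply Rabs_le_between in IH. lra.
Qed.

(** Powers of [om n e] are exponentials in [x], so a distribution evaluated on them is a value of
    its transform. The form [x + - e] fits the lemmas on translates [x + c]. *)
Definition om (n e x : R) : R := exp (n * (x + - e)).

Lemma is_derive_om n e (x : R) : is_derive (om n e) x (n * om n e x).
Proof.
  unfold om. eapply is_derive_eq.
  - apply (is_derive_Rcomp (fun y => exp (n * y)) (fun x => x + - e)); [apply is_derive_expl|].
    apply is_derive_Rplus; [apply is_derive_Rid | apply is_derive_Rconst].
  - ring.
Qed.

Lemma smooth_om n e : smooth (om n e).
Proof. unfold om. apply (smooth_comp (fun y => exp (n * y)) (fun x => x + - e)); auto with smooth. Qed.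

(** Factorials beat the powers of [exp (n * A)]. One derivative replaces the remainder by the
    preceding one times [- n * om n e x], so the induction on [N] lowers [K] by one. *)
Lemma erem_om_small N A n e : 0 <= n -> 0 <= e -> 0 <= A -> forall eta, 0 < eta -> exists K0, forall K, (K0 <= K)%nat ->
  bd N (fun x => Rabs x <= A) (fun x => erem K (om n e x)) eta.
Proof.
  intros Hn He HA. induction N as [|N IH]; intros eta Heta.
  - destruct (cv_speed_pow_fact (exp (n * A)) eta Heta) as [K0 HK].
    exists K0. intros K HK0 j x Hj Hx. replace j with 0%nat by lia. simpl.
    assert (W : 0 <= om n e x <= exp (n * A)).
    { split; [left; apply exp_pos|]. apply exp_le. apply Rmult_le_compat_l; auto.
      apply Rabs_le_between in Hx. lra. }
    eapply Rle_trans; [apply erem_bound, W|].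
    specialize (HK (S K) ltac:(lia)). unfold Rdist in HK. rewrite Rminus_0_r in HK.
    apply Rle_trans with (exp (n * A) ^ S K / INR (fact (S K))).
    + apply Rmult_le_compat_r; [left; apply Rinv_0_lt_compat, INR_fact_lt_0|]. apply pow_incr, W.
    + eapply Rle_trans; [apply Rle_abs | lra].
  - destruct (smooth_bd (fun x => - n * om n e x) N A) as [M [HM B]].
    { apply smooth_scal, smooth_om. }
    assert (H2 : 0 < 2 ^ N) by (apply pow_lt; lra).
    destruct (IH (eta / (2 ^ N * (M + 1)))) as [K0 HK0].
    { apply Rdiv_lt_0_compat; auto. apply Rmult_lt_0_compat; lra. }
    destruct (IH eta Heta) as [K1 HK1].
    exists (S (K0 + K1)). intros K HK. destruct K as [|K]; [lia|].
    apply bd_S with (fun x => (- n * om n e x) * erem K (om n e x)).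
    + intro x. eapply is_derive_eq.
      * apply (is_derive_Rcomp (erem (S K)) (om n e)); [apply is_derive_erem | apply is_derive_om].
      * ring.
    + intros x Hx. apply (HK1 (S K) ltac:(lia) 0%nat x); [lia | auto].
    + eapply bd_le; [|apply bd_mult; [apply smooth_scal, smooth_om | | apply B | apply HK0; lia]].
      * set (q := eta / (2 ^ N * (M + 1))).
        assert (Eq : eta = 2 ^ N * (M + 1) * q) by (unfold q; field; split; lra).
        assert (0 < q) by (apply Rdiv_lt_0_compat; auto; apply Rmult_lt_0_compat; lra).
        rewrite Eq. apply Rmult_le_compat_r; [lra|]. apply Rmult_le_compat_l; lra.
      * apply (smooth_comp (erem K)); auto using smooth_erem, smooth_om.
Qed.

Lemma pow2_le_fact k : 2 ^ k <= INR (fact (S k)).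
Proof.
  induction k as [|k IH]; [simpl; lra|].
  rewrite fact_simpl, mult_INR. simpl pow.
  apply Rmult_le_compat; auto; [lra | apply pow_le; lra |].
  rewrite !S_INR. pose proof (pos_INR k). lra.
Qed.

(** A smooth step from 1 down to 0. This profile is chosen because [1 - Mf (n * (x - e))] is a power
    series in [exp (n * x)], on which a distribution is read off from its transform at the multiples
    of [n]. *)
Definition Mf (z : R) : R := exp (- exp z).

Lemma om_pow n e x k : om n e x ^ k = exp (- (INR k * n * e)) * exp (INR k * n * x).
Proof. unfold om. rewrite <- exp_INR, <- exp_plus. f_equal. ring. Qed.

(** Up to sign, the [k]-th term of the series contributes [exp (- k n e) F (k n) / k!], and [rate 0]
    with slack [e / 2] makes it at most [C exp (- n e / 2) / k!]. Only [k >= 1] occurs: the constant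
    term, which would not decay, cancels in [1 - Mf]. *)
Lemma step_test_small v e : rdist v -> rate 0 (lap v) -> 0 < e ->
  exists C, 0 <= C /\ forall n, 0 <= n ->
    Cmod (v (fun x => 1 - Mf (n * (x + - e)))) <= C * exp (- (n * (e / 2))).
Proof.
  intros Hv Hr He. destruct (Hr (e / 2) ltac:(lra)) as [C [HC B]].
  exists (2 * C). split; [lra|]. intros n Hn.
  set (b := C * exp (- (n * (e / 2)))).
  assert (Hb : 0 <= b) by (apply Rmult_le_pos; auto; left; apply exp_pos).
  assert (T : forall k, Cmod (v (fun x => om n e x ^ S k)) <= b).
  { intro k. replace (fun x => om n e x ^ S k)
      with (fun x => exp (- (INR (S k) * n * e)) * exp (INR (S k) * n * x))
      by (apply functional_extensionality; intro; symmetry; apply om_pow).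
    rewrite rdist_scal, Cmod_mult, Cmod_R, Rabs_pos_eq by (auto with smooth; left; apply exp_pos).
    assert (Hk : 1 <= INR (S k)) by (rewrite S_INR; pose proof (pos_INR k); lra).
    assert (Hkn : n <= INR (S k) * n) by nra.
    eapply Rle_trans; [apply Rmult_le_compat_l; [left; apply exp_pos | apply (B (INR (S k) * n)); lra]|].
    rewrite <- Rmult_assoc, (Rmult_comm _ C), Rmult_assoc, <- exp_plus.
    apply Rmult_le_compat_l; auto. apply exp_le. nra. }
  assert (Sm : forall K, smooth (fun x => 1 - esum K (- om n e x))).
  { intro K. apply smooth_minus; auto with smooth.
    apply (smooth_comp (esum K) (fun x => - om n e x)); auto using smooth_esum, smooth_opp, smooth_om. }
  assert (So : forall k, smooth (fun x => om n e x ^ k)).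
  { intro k. apply (smooth_comp (fun y => y ^ k) (om n e)); auto using smooth_om with smooth. }
  (* The sum of [1 / k!] over [1 <= k <= K] is compared with that of [1 / 2 ^ (k - 1)], which is
     [2 - 2 / 2 ^ K]. *)
  assert (P : forall K, Cmod (v (fun x => 1 - esum K (- om n e x))) <= b * (2 - 2 / 2 ^ K)).
  { induction K as [|K IH].
    - simpl. replace (fun _ : R => 1 - 1) with (fun _ : R => 0)
        by (apply functional_extensionality; intro; ring).
      rewrite rdist_zero, Cmod_0 by auto. right. field.
    - replace (fun x => 1 - esum (S K) (- om n e x)) with
        (fun x => (1 - esum K (- om n e x)) + (- ((-1) ^ S K / INR (fact (S K)))) * om n e x ^ S K).
      2:{ apply functional_extensionality; intro x.
          change (esum (S K) (- om n e x)) with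
            (esum K (- om n e x) + (- om n e x) ^ S K / INR (fact (S K))).
          replace (- om n e x) with ((-1) * om n e x) by ring. rewrite Rpow_mult_distr.
          field. apply INR_fact_neq_0. }
      rewrite rdist_plus, rdist_scal by auto with smooth.
      eapply Rle_trans; [apply Cmod_triangle|].
      replace (b * (2 - 2 / 2 ^ S K)) with (b * (2 - 2 / 2 ^ K) + / 2 ^ K * b).
      2:{ simpl. field. apply pow_nonzero; lra. }
      apply Rplus_le_compat; auto. rewrite Cmod_mult, Cmod_R, Rabs_Ropp.
      apply Rmult_le_compat; auto using Rabs_pos, Cmod_ge_0.
      unfold Rdiv. rewrite Rabs_mult, <- RPow_abs, Rabs_m1, pow1, Rmult_1_l, Rabs_pos_eq
        by (left; apply Rinv_0_lt_compat, INR_fact_lt_0).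
      apply Rinv_le_contravar; [apply pow_lt; lra | apply pow2_le_fact]. }
  pose proof Hv as [_ [_ [K' [N [A [HK' [HA Bv]]]]]]].
  (* With [n] fixed, the truncation order goes to infinity; the constant [2 * C] depends on
     neither. *)
  apply le_epsilon. intros eta Heta.
  destruct (erem_om_small N A n e Hn ltac:(lra) HA (eta / (K' + 1))) as [K0 HK0].
  { apply Rdiv_lt_0_compat; lra. }
  specialize (HK0 K0 (Nat.le_refl _)).
  replace (fun x => 1 - Mf (n * (x + - e)))
    with (fun x => (1 - esum K0 (- om n e x)) - erem K0 (om n e x)).
  2:{ apply functional_extensionality; intro x. unfold erem, Mf, om. ring. }
  assert (Se : smooth (fun x => erem K0 (om n e x))).
  { apply (smooth_comp (erem K0)); auto using smooth_erem, smooth_om. }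
  rewrite rdist_minus by auto.
  unfold Cminus. eapply Rle_trans; [apply Cmod_triangle|]. rewrite Cmod_opp.
  apply Rplus_le_compat.
  - eapply Rle_trans; [apply P|]. unfold b.
    assert (0 < 2 / 2 ^ K0) by (apply Rdiv_lt_0_compat; [lra | apply pow_lt; lra]).
    fold b. replace (2 * C * exp (- (n * (e / 2)))) with (b * 2) by (unfold b; ring). nra.
  - eapply Rle_trans; [apply Bv; [auto | apply HK0]|].
    apply Rmult_le_reg_r with (K' + 1); [lra|].
    replace (K' * (eta / (K' + 1)) * (K' + 1)) with (K' * eta) by (field; lra). nra.
Qed.


(** * Derivative bounds for the step on each half-line *)

Lemma is_derive_exp_pow b (z : R) : is_derive (fun z => exp z ^ b) z (INR b * exp z ^ b).
Proof.
  eapply is_derive_ext; [intro t; apply (exp_INR b t)|].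
  rewrite <- exp_INR. apply is_derive_expl.
Qed.

Lemma is_derive_Mf (z : R) : is_derive Mf z (- exp z * Mf z).
Proof.
  eapply is_derive_eq.
  - apply (is_derive_Rcomp exp (fun z => - exp z)); [apply is_derive_exp|].
    apply (is_derive_opp (K := R_AbsRing) (V := R_NormedModule)), is_derive_exp.
  - unfold opp, Mf; simpl. ring.
Qed.

Lemma smooth_Mf : smooth Mf.
Proof. apply (smooth_comp exp (fun z => - exp z)); auto with smooth. Qed.

Lemma Mf_bounds z : 0 < Mf z <= 1.
Proof.
  split; [apply exp_pos|]. unfold Mf. rewrite <- exp_0. apply exp_le.
  pose proof (exp_pos z). lra.
Qed.

Lemma pow_le_fact_exp n x : 0 <= x -> x ^ n <= INR (fact n) * exp x.
Proof.
  revert x. induction n as [|n IH]; intros x Hx.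
  - simpl. rewrite Rmult_1_l, <- exp_0. apply exp_le, Hx.
  - pose proof (derive_nonneg_le (fun x => INR (fact (S n)) * exp x - x ^ S n)
      (fun x => INR (S n) * (INR (fact n) * exp x - x ^ n)) x) as L.
    cbv beta in L. rewrite exp_0, pow_i in L by lia.
    pose proof (INR_fact_lt_0 (S n)).
    enough (INR (fact (S n)) * 1 - 0 <= INR (fact (S n)) * exp x - x ^ S n) by lra.
    apply L; auto.
    + intro t. eapply is_derive_eq.
      * apply is_derive_Rminus; [apply is_derive_scal, is_derive_exp|].
        apply (is_derive_pow (fun t => t) (S n) t 1), is_derive_Rid.
      * rewrite fact_simpl, mult_INR. simpl Init.Nat.pred. ring.
    + intros t Ht. apply Rmult_le_pos; [apply pos_INR|]. specialize (IH t Ht). lra.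
Qed.

(** Derivatives of [z ^ a * Mf z] stay in the span of these terms; for [a = 0] the coefficient of
    the [pred a] term is 0. *)
Definition Mterm (a b : nat) (z : R) : R := z ^ a * (exp z ^ b * Mf z).

Lemma is_derive_Mterm a b (z : R) : is_derive (Mterm a b) z
  (INR a * Mterm (pred a) b z + (INR b * Mterm a b z + (-1) * Mterm a (S b) z)).
Proof.
  unfold Mterm. eapply is_derive_eq.
  - apply is_derive_Rmult.
    + apply (is_derive_pow (fun t => t) a z 1), is_derive_Rid.
    + apply is_derive_Rmult; [apply is_derive_exp_pow | apply is_derive_Mf].
  - simpl. ring.
Qed.

Inductive Mspan : (R -> R) -> Prop :=
| Mspan_term c a b : Mspan (fun z => c * Mterm a b z)
| Mspan_plus f g : Mspan f -> Mspan g -> Mspan (fun z => f z + g z).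

Lemma Mspan_scal c f : Mspan f -> Mspan (fun z => c * f z).
Proof.
  intros H. induction H as [d a b|f g Hf IHf Hg IHg].
  - replace (fun z => c * (d * Mterm a b z)) with (fun z => (c * d) * Mterm a b z)
      by (apply functional_extensionality; intro; ring). constructor.
  - replace (fun z => c * (f z + g z)) with (fun z => c * f z + c * g z)
      by (apply functional_extensionality; intro; ring). constructor; auto.
Qed.

Lemma Mspan_derive f : Mspan f -> exists f', Mspan f' /\ forall z : R, is_derive f z (f' z).
Proof.
  intros H. induction H as [c a b|f g Hf [f' [Hf' Df]] Hg [g' [Hg' Dg]]].
  - exists (fun z => c * (INR a * Mterm (pred a) b z + (INR b * Mterm a b z + (-1) * Mterm a (S b) z))).
    split; [apply Mspan_scal; repeat constructor|].
    intro z. apply is_derive_scal, is_derive_Mterm.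
  - exists (fun z => f' z + g' z). split; [constructor; auto|].
    intro z; apply is_derive_Rplus; auto.
Qed.

(** The double exponential decay on the right beats all other factors: [x ^ n <= n! exp x] is used
    at [z] and again at [exp z]. *)
Lemma Mspan_bounded f : Mspan f -> exists C, 0 <= C /\ forall z, 0 <= z -> Rabs (f z) <= C.
Proof.
  intros H. induction H as [c a b|f g Hf [C [HC B]] Hg [C' [HC' B']]].
  - exists (Rabs c * (INR (fact a) * INR (fact (S b)))).
    split; [apply Rmult_le_pos; [apply Rabs_pos | apply Rmult_le_pos; apply pos_INR]|].
    intros z Hz. rewrite Rabs_mult. apply Rmult_le_compat_l; [apply Rabs_pos|].
    pose proof (Mf_bounds z) as Hm. pose proof (exp_pos z) as Hw.
    assert (Hwb : 0 < exp z ^ b) by (apply pow_lt; auto).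
    assert (Hza : 0 <= z ^ a) by (apply pow_le; auto).
    unfold Mterm. rewrite Rabs_pos_eq by (apply Rmult_le_pos; auto; nra).
    apply Rle_trans with (INR (fact a) * exp z * (exp z ^ b * Mf z)).
    + apply Rmult_le_compat_r; [nra | apply pow_le_fact_exp; auto].
    + rewrite Rmult_assoc. apply Rmult_le_compat_l; [apply pos_INR|].
      replace (exp z * (exp z ^ b * Mf z)) with (exp z ^ S b * Mf z) by (simpl; ring).
      apply Rmult_le_reg_r with (exp (exp z)); [apply exp_pos|].
      unfold Mf. rewrite Rmult_assoc, <- exp_plus, Rplus_opp_l, exp_0, Rmult_1_r.
      apply pow_le_fact_exp. lra.
  - exists (C + C'). split; [lra|]. intros z Hz. eapply Rle_trans; [apply Rabs_triang|].
    specialize (B z Hz). specialize (B' z Hz). lra.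
Qed.

Lemma Mspan_Derive_n_bounded i : forall f, Mspan f ->
  exists C, 0 <= C /\ forall z, 0 <= z -> Rabs (Derive_n f i z) <= C.
Proof.
  induction i as [|i IH]; intros f Hf; [apply Mspan_bounded, Hf|].
  destruct (Mspan_derive f Hf) as [f' [Hf' D]].
  destruct (IH f' Hf') as [C [HC B]]. exists C; split; auto.
  intros z Hz. rewrite (Derive_n_of_derive f f') by auto. auto.
Qed.

Definition Eterm (a : nat) (z : R) : R := z ^ a * (1 - Mf z).

(** The exponent [S b] excludes [z ^ a * Mf z], which is unbounded on the left once [a > 0].
    Differentiating [Eterm] yields exponents at least 1, so the span is still closed. *)
Inductive Espan : (R -> R) -> Prop :=
| Espan_E c a : Espan (fun z => c * Eterm a z)
| Espan_M c a b : Espan (fun z => c * Mterm a (S b) z)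
| Espan_plus f g : Espan f -> Espan g -> Espan (fun z => f z + g z).

Lemma Espan_scal c f : Espan f -> Espan (fun z => c * f z).
Proof.
  intros H. induction H as [d a|d a b|f g Hf IHf Hg IHg].
  - replace (fun z => c * (d * Eterm a z)) with (fun z => (c * d) * Eterm a z)
      by (apply functional_extensionality; intro; ring). constructor.
  - replace (fun z => c * (d * Mterm a (S b) z)) with (fun z => (c * d) * Mterm a (S b) z)
      by (apply functional_extensionality; intro; ring). constructor.
  - replace (fun z => c * (f z + g z)) with (fun z => c * f z + c * g z)
      by (apply functional_extensionality; intro; ring). constructor; auto.
Qed.

Lemma Espan_derive f : Espan f -> exists f', Espan f' /\ forall z : R, is_derive f z (f' z).
Proof.
  intros H. induction H as [c a|c a b|f g Hf [f' [Hf' Df]] Hg [g' [Hg' Dg]]].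
  - exists (fun z => c * (INR a * Eterm (pred a) z + 1 * Mterm a 1 z)).
    split; [apply Espan_scal; repeat constructor|].
    intro z. apply is_derive_scal. unfold Eterm, Mterm. eapply is_derive_eq.
    + apply is_derive_Rmult.
      * apply (is_derive_pow (fun t => t) a z 1), is_derive_Rid.
      * apply is_derive_Rminus; [apply is_derive_Rconst | apply is_derive_Mf].
    + simpl. ring.
  - exists (fun z => c * (INR a * Mterm (pred a) (S b) z
      + (INR (S b) * Mterm a (S b) z + (-1) * Mterm a (S (S b)) z))).
    split; [apply Espan_scal; repeat constructor|].
    intro z. apply is_derive_scal, is_derive_Mterm.
  - exists (fun z => f' z + g' z). split; [constructor; auto|].
    intro z; apply is_derive_Rplus; auto.
Qed.

Lemma Rabs_pow_exp_neg a z : z <= 0 -> Rabs (z ^ a) * exp z <= INR (fact a).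
Proof.
  intros Hz. rewrite <- RPow_abs, Rabs_left1 by auto.
  apply Rmult_le_reg_r with (exp (- z)); [apply exp_pos|].
  rewrite Rmult_assoc, <- exp_plus, Rplus_opp_r, exp_0, Rmult_1_r.
  apply pow_le_fact_exp. lra.
Qed.

Lemma Espan_bounded f : Espan f -> exists C, 0 <= C /\ forall z, z <= 0 -> Rabs (f z) <= C.
Proof.
  intros H. induction H as [c a|c a b|f g Hf [C [HC B]] Hg [C' [HC' B']]].
  - exists (Rabs c * INR (fact a)).
    split; [apply Rmult_le_pos; [apply Rabs_pos | apply pos_INR]|].
    intros z Hz. rewrite Rabs_mult. apply Rmult_le_compat_l; [apply Rabs_pos|].
    eapply Rle_trans; [|apply (Rabs_pow_exp_neg a z Hz)].
    unfold Eterm. rewrite Rabs_mult. apply Rmult_le_compat_l; [apply Rabs_pos|].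
    pose proof (Mf_bounds z) as Hm. rewrite Rabs_pos_eq by lra.
    unfold Mf. pose proof (exp_ineq1_le (- exp z)). lra.
  - exists (Rabs c * INR (fact a)).
    split; [apply Rmult_le_pos; [apply Rabs_pos | apply pos_INR]|].
    intros z Hz. rewrite Rabs_mult. apply Rmult_le_compat_l; [apply Rabs_pos|].
    eapply Rle_trans; [|apply (Rabs_pow_exp_neg a z Hz)].
    unfold Mterm. rewrite Rabs_mult. apply Rmult_le_compat_l; [apply Rabs_pos|].
    pose proof (Mf_bounds z) as Hm. pose proof (exp_pos z) as Hw.
    assert (Hw1 : exp z <= 1) by (rewrite <- exp_0; apply exp_le, Hz).
    assert (Hwb : 0 <= exp z ^ b <= 1).
    { split; [apply pow_le; lra|]. rewrite <- (pow1 b). apply pow_incr; lra. }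
    assert (Hs : 0 <= exp z ^ S b <= exp z) by (simpl; nra).
    rewrite Rabs_pos_eq by (apply Rmult_le_pos; lra). nra.
  - exists (C + C'). split; [lra|]. intros z Hz. eapply Rle_trans; [apply Rabs_triang|].
    specialize (B z Hz). specialize (B' z Hz). lra.
Qed.

Lemma Espan_Derive_n_bounded i : forall f, Espan f ->
  exists C, 0 <= C /\ forall z, z <= 0 -> Rabs (Derive_n f i z) <= C.
Proof.
  induction i as [|i IH]; intros f Hf; [apply Espan_bounded, Hf|].
  destruct (Espan_derive f Hf) as [f' [Hf' D]].
  destruct (IH f' Hf') as [C [HC B]]. exists C; split; auto.
  intros z Hz. rewrite (Derive_n_of_derive f f') by auto. auto.
Qed.

Lemma uniform_bound (N : nat) (P : nat -> R -> Prop) :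
  (forall i c c', c <= c' -> P i c -> P i c') ->
  (forall i, exists c, 0 <= c /\ P i c) ->
  exists c, 0 <= c /\ forall i, (i <= N)%nat -> P i c.
Proof.
  intros Hm H. induction N as [|N [c [Hc HN]]].
  - destruct (H 0%nat) as [c [Hc H0]]. exists c; split; auto.
    intros i Hi. replace i with 0%nat by lia. auto.
  - destruct (H (S N)) as [c' [Hc' HS]]. exists (c + c'). split; [lra|].
    intros i Hi. destruct (Nat.eq_dec i (S N)) as [->|Hne].
    + apply Hm with c'; auto; lra.
    + apply Hm with c; [lra|]. apply HN. lia.
Qed.

Lemma scaled_bound i j n C d : (i < j)%nat -> 1 <= n -> 0 <= C -> Rabs d <= C ->
  Rabs (/ n ^ j * (n ^ i * d)) <= C / n.
Proof.
  intros Hij Hn HC Hd.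
  replace j with (i + S (j - i - 1))%nat by lia. set (k := (j - i - 1)%nat).
  assert (Hi : 0 < n ^ i) by (apply pow_lt; lra).
  assert (Hk : 1 <= n ^ k) by (apply pow_R1_Rle; lra).
  rewrite pow_add. simpl pow.
  replace (/ (n ^ i * (n * n ^ k)) * (n ^ i * d)) with (d * (/ n * / n ^ k)) by (field; repeat split; lra).
  rewrite Rabs_mult. unfold Rdiv.
  assert (0 < / n) by (apply Rinv_0_lt_compat; lra).
  assert (0 < / n ^ k <= 1).
  { split; [apply Rinv_0_lt_compat; lra|]. rewrite <- Rinv_1. apply Rinv_le_contravar; lra. }
  apply Rmult_le_compat; auto using Rabs_pos.
  rewrite Rabs_pos_eq by nra. nra.
Qed.

(** Scaling: the function is [n ^ (- j)] times [Eterm j] at [n * y]. After [i] derivatives the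
    factor is [n ^ (i - j)], at most [1 / n] since [i < j]. *)
Lemma step_neg N j : (N < j)%nat -> exists C, 0 <= C /\ forall n, 1 <= n -> forall i y,
  (i <= N)%nat -> y <= 0 -> Rabs (Derive_n (fun y => y ^ j * (1 - Mf (n * y))) i y) <= C / n.
Proof.
  intros HN.
  assert (SE : smooth (Eterm j)) by (apply smooth_mult; auto using smooth_Mf with smooth).
  destruct (uniform_bound N (fun i c => forall z, z <= 0 -> Rabs (Derive_n (Eterm j) i z) <= c)) as [C [HC B]].
  { intros i c c' H1 H2 z Hz. specialize (H2 z Hz). lra. }
  { intro i. apply Espan_Derive_n_bounded.
    replace (Eterm j) with (fun z => 1 * Eterm j z) by (apply functional_extensionality; intro; ring).
    constructor. }
  exists C; split; auto. intros n Hn i y Hi Hy.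
  rewrite (Derive_n_ext _ (fun y => / n ^ j * (fun y => Eterm j (n * y)) y)).
  2:{ intro t. unfold Eterm. rewrite Rpow_mult_distr. field. apply pow_nonzero; lra. }
  rewrite Derive_n_scal_l, Derive_n_comp_scal by (apply smooth_locally, SE).
  apply scaled_bound; auto; [lia|]. apply B; auto. nra.
Qed.

Lemma step_pos N j : (N < j)%nat -> exists C, 0 <= C /\ forall n, 1 <= n -> forall i y,
  (i <= N)%nat -> 0 <= y -> Rabs (Derive_n (fun y => y ^ j * Mf (n * y)) i y) <= C / n.
Proof.
  intros HN.
  assert (SE : smooth (Mterm j 0)).
  { apply smooth_mult; auto with smooth. apply smooth_mult; [exact (smooth_const 1) | apply smooth_Mf]. }
  destruct (uniform_bound N (fun i c => forall z, 0 <= z -> Rabs (Derive_n (Mterm j 0) i z) <= c)) as [C [HC B]].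
  { intros i c c' H1 H2 z Hz. specialize (H2 z Hz). lra. }
  { intro i. apply Mspan_Derive_n_bounded.
    replace (Mterm j 0) with (fun z => 1 * Mterm j 0 z) by (apply functional_extensionality; intro; ring).
    constructor. }
  exists C; split; auto. intros n Hn i y Hi Hy.
  rewrite (Derive_n_ext _ (fun y => / n ^ j * (fun y => Mterm j 0 (n * y)) y)).
  2:{ intro t. unfold Mterm. rewrite Rpow_mult_distr. simpl. field. apply pow_nonzero; lra. }
  rewrite Derive_n_scal_l, Derive_n_comp_scal by (apply smooth_locally, SE).
  apply scaled_bound; auto; [lia|]. apply B; auto. nra.
Qed.


(** * Smoothed truncated powers and the vanishing of high moments *)

Lemma smooth_Lipschitz f N A : smooth f -> exists L, 0 <= L /\ forall i x y,
  (i <= N)%nat -> Rabs x <= A -> Rabs y <= A ->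
  Rabs (Derive_n f i x - Derive_n f i y) <= L * Rabs (x - y).
Proof.
  intros Hf. destruct (smooth_bd f (S N) A Hf) as [L [HL B]]. exists L; split; auto.
  intros i x y Hi Hx Hy.
  destruct (MVT_everywhere _ _ (smooth_is_derive_n f i Hf) y x) as [c [Hc E]].
  rewrite E, Rabs_mult. apply Rmult_le_compat_r; [apply Rabs_pos|].
  apply B; [lia|]. apply Rabs_le_between in Hx, Hy. apply Rabs_le_between.
  revert Hc. unfold Rmin, Rmax. destruct (Rle_dec y x); lra.
Qed.

(** Smooths, for large [n], the truncated power equal to [y ^ j] on the right and to 0 on the left,
    which is of class [C^N] when [j > N]. *)
Definition ramp (j : nat) (n y : R) : R := y ^ j * (1 - Mf (n * y)).

Lemma smooth_Mf_scal n : smooth (fun y => Mf (n * y)).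
Proof. apply (smooth_comp Mf (fun y => n * y)); auto using smooth_Mf with smooth. Qed.

Lemma smooth_ramp j n : smooth (ramp j n).
Proof. apply smooth_mult; auto using smooth_Mf_scal with smooth. Qed.

Lemma smooth_ramp_trans j n e : smooth (fun x => ramp j n (x + - e)).
Proof. apply (smooth_trans (ramp j n) (- e)), smooth_ramp. Qed.

Lemma smooth_ramp_refl j n e : smooth (fun x => ramp j n (- x + - e)).
Proof. apply (smooth_reflect (fun x => ramp j n (x + - e))), smooth_ramp_trans. Qed.

Lemma m1_pow_sq k : (-1) ^ k * (-1) ^ k = 1.
Proof. rewrite <- Rpow_mult_distr. replace (-1 * -1) with 1 by ring. apply pow1. Qed.

Lemma Rabs_m1_pow k : Rabs ((-1) ^ k) = 1.
Proof. rewrite <- RPow_abs, Rabs_m1. apply pow1. Qed.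

Lemma Derive_n_pow_parity i j y :
  (-1) ^ j * ((-1) ^ i * Derive_n (fun x => x ^ j) i (- y)) = Derive_n (fun x => x ^ j) i y.
Proof.
  rewrite <- (Derive_n_comp_opp (fun x => x ^ j)) by (apply smooth_locally, smooth_pow).
  rewrite (Derive_n_ext _ (fun x => (-1) ^ j * x ^ j)).
  - rewrite Derive_n_scal_l, <- Rmult_assoc, m1_pow_sq. ring.
  - intro t. rewrite <- Rpow_mult_distr. f_equal. ring.
Qed.

(** Outside [(- e, e)] one ramp carries [x ^ j], up to the shift by [e] that costs [L * e], and the
    other is [O (1 / n)]. Inside, both ramps are small, and so are the derivatives of [x ^ j] up to
    order [N < j], which vanish at 0. *)
Lemma ramp_defect_small N j A : (N < j)%nat -> 0 <= A ->
  exists C, 0 <= C /\ forall n e, 1 <= n -> 0 < e <= 1 ->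
  bd N (fun x => Rabs x <= A)
    (fun x => x ^ j - ramp j n (x + - e) - (-1) ^ j * ramp j n (- x + - e)) (C * (e + / n)).
Proof.
  intros HN HA.
  destruct (step_neg N j HN) as [C1 [HC1 B1]], (step_pos N j HN) as [C2 [HC2 B2]].
  (* Radius [A + 1] leaves room for the shift by [e <= 1]. *)
  destruct (smooth_Lipschitz (fun x => x ^ j) N (A + 1) (smooth_pow j)) as [L [HL BL]].
  exists (L + 2 * C1 + C2). split; [lra|]. intros n e Hn He i x Hi Hx.
  set (mu := fun i => Derive_n (fun x => x ^ j) i) in *.
  set (ph := Derive_n (ramp j n) i).
  assert (Hn' : 0 < / n) by (apply Rinv_0_lt_compat; lra).
  assert (E : Derive_n (fun x => x ^ j - ramp j n (x + - e) - (-1) ^ j * ramp j n (- x + - e)) i x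
    = mu i x - ph (x + - e) - (-1) ^ j * ((-1) ^ i * ph (- x + - e))).
  { rewrite Derive_n_Rminus, Derive_n_Rminus, Derive_n_scal_l
      by auto using smooth_pow, smooth_ramp_trans, smooth_ramp_refl with smooth.
    rewrite Derive_n_comp_trans.
    rewrite (Derive_n_comp_opp (fun y => ramp j n (y + - e)))
      by (apply smooth_locally, smooth_ramp_trans).
    rewrite Derive_n_comp_trans. reflexivity. }
  rewrite E. clear E.
  assert (Hneg : forall y, y <= 0 -> Rabs (ph y) <= C1 * / n) by (intros; apply B1; auto).
  assert (Hpos : forall y, 0 <= y -> Rabs (mu i y - ph y) <= C2 * / n).
  { intros y Hy. unfold mu, ph. rewrite <- Derive_n_Rminus by auto using smooth_ramp with smooth.
    rewrite (Derive_n_ext _ (fun y => y ^ j * Mf (n * y))); [apply B2; auto|].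
    intro t; unfold ramp; ring. }
  assert (S : forall y, Rabs ((-1) ^ j * ((-1) ^ i * y)) = Rabs y).
  { intro y. rewrite !Rabs_mult, !Rabs_m1_pow. ring. }
  assert (Z : mu i 0 = 0).
  { unfold mu. rewrite Derive_n_pow_smalli by lia. rewrite pow_i by lia. ring. }
  apply Rabs_le_between in Hx.
  assert (HLx : forall y y', - (A + 1) <= y <= A + 1 -> - (A + 1) <= y' <= A + 1 -> Rabs (y - y') <= e ->
    Rabs (mu i y - mu i y') <= L * e).
  { intros y y' Hy Hy' Hd. eapply Rle_trans; [apply BL; auto; apply Rabs_le_between; auto|].
    apply Rmult_le_compat_l; auto. }
  assert (T : forall p q r, Rabs p <= L * e -> Rabs q <= C1 * / n -> Rabs r <= (C1 + C2) * / n ->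
     Rabs (p + q + r) <= (L + 2 * C1 + C2) * (e + / n)).
  { intros p q r Hp Hq Hr. eapply Rle_trans; [apply Rabs_triang|].
    pose proof (Rabs_triang p q).
    assert (0 <= L * / n) by nra. assert (0 <= C1 * e) by nra. assert (0 <= C2 * e) by nra.
    lra. }
  destruct (Rle_lt_dec e x) as [H1|H1]; [|destruct (Rle_lt_dec x (- e)) as [H2|H2]].
  - replace (mu i x - ph (x + - e) - (-1) ^ j * ((-1) ^ i * ph (- x + - e)))
      with ((mu i x - mu i (x + - e)) + - ((-1) ^ j * ((-1) ^ i * ph (- x + - e)))
            + (mu i (x + - e) - ph (x + - e))) by ring.
    apply T.
    + apply HLx; try lra. replace (x - (x + - e)) with e by ring. rewrite Rabs_pos_eq; lra.
    + rewrite Rabs_Ropp, S. apply Hneg. lra.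
    + eapply Rle_trans; [apply Hpos; lra | nra].
  - replace (mu i x - ph (x + - e) - (-1) ^ j * ((-1) ^ i * ph (- x + - e)))
      with ((mu i x - mu i (x + e)) + - ph (x + - e)
            + (-1) ^ j * ((-1) ^ i * (mu i (- x + - e) - ph (- x + - e)))).
    2:{ pose proof (Derive_n_pow_parity i j (x + e)) as P. fold (mu i) in P.
        change (Derive_n (fun x0 : R => x0 ^ j) i) with (mu i) in P.
        replace (- (x + e)) with (- x + - e) in P by ring. rewrite <- P. ring. }
    apply T.
    + apply HLx; try lra. replace (x - (x + e)) with (- e) by ring. rewrite Rabs_Ropp, Rabs_pos_eq; lra.
    + rewrite Rabs_Ropp. apply Hneg. lra.
    + rewrite S. eapply Rle_trans; [apply Hpos; lra | nra].
  - replace (mu i x - ph (x + - e) - (-1) ^ j * ((-1) ^ i * ph (- x + - e)))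
      with ((mu i x - mu i 0) + - ph (x + - e) + - ((-1) ^ j * ((-1) ^ i * ph (- x + - e))))
      by (rewrite Z; ring).
    apply T.
    + apply HLx; try lra. rewrite Rminus_0_r. apply Rabs_le_between. lra.
    + rewrite Rabs_Ropp. apply Hneg. lra.
    + rewrite Rabs_Ropp, S. eapply Rle_trans; [apply Hneg; lra | nra].
Qed.

Lemma rate_mulf_poly v Q t : rdist v -> rate t (lap v) -> polyf Q -> rate t (lap (mulf Q v)).
Proof.
  intros Hv Hr HQ. induction HQ as [c|c Q HQ IH].
  - replace (lap (mulf (fun _ => c) v)) with (fun s => Cmult (RtoC c) (lap v s)).
    + apply rate_scal, Hr.
    + apply functional_extensionality; intro s. unfold lap, mulf.
      rewrite rdist_scal by auto with smooth. reflexivity.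
  - pose proof (smooth_poly Q HQ) as SQ.
    replace (lap (mulf (fun s => c + s * Q s) v))
      with (fun s => Cplus (Cmult (RtoC c) (lap v s)) (lap (xm (mulf Q v)) s)).
    + apply rate_plus; [apply rate_scal, Hr|]. apply rate_xm; auto using rdist_mulf.
    + apply functional_extensionality; intro s. unfold lap, xm, mulf.
      rewrite <- rdist_scal, <- rdist_plus by auto with smooth.
      f_equal. apply functional_extensionality; intro x. ring.
Qed.

Lemma exp_neg_le y : 0 < y -> exp (- y) <= / y.
Proof.
  intros Hy. rewrite exp_Ropp. apply Rinv_le_contravar; auto.
  pose proof (exp_ineq1_le y). lra.
Qed.

(** The polynomial factor is moved onto [v], which keeps rate 0 because differentiation does not
    raise rates; only the bare step is left to test. *)
Lemma ramp_test_small v j e : rdist v -> rate 0 (lap v) -> 0 < e ->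
  exists C, 0 <= C /\ forall n, 0 < n -> Cmod (v (fun x => ramp j n (x + - e))) <= C / n.
Proof.
  intros Hv Hr He.
  assert (HQ : polyf (fun x => (x + - e) ^ j)).
  { apply (poly_comp (fun y => y ^ j) (fun x => x + - e)); [apply poly_pow|].
    apply poly_plus; [apply poly_id | apply poly_const]. }
  destruct (step_test_small (mulf (fun x => (x + - e) ^ j) v) e) as [C [HC B]]; auto.
  { apply rdist_mulf; auto. apply smooth_poly, HQ. }
  { apply rate_mulf_poly; auto. }
  exists (C * (2 / e)). split; [apply Rmult_le_pos; auto; left; apply Rdiv_lt_0_compat; lra|].
  intros n Hn. eapply Rle_trans; [apply (B n); lra|].
  unfold Rdiv. rewrite !Rmult_assoc. apply Rmult_le_compat_l; auto.
  eapply Rle_trans; [apply exp_neg_le; apply Rmult_lt_0_compat; lra|].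
  right. field. lra.
Qed.

(** [N] is the order of [v]. For [j > N], [x ^ j] is close to a sum of two ramps; growth at plus
    infinity makes [v] small on the right one, growth at minus infinity on the reflected one. The
    constants of [ramp_test_small] depend on [e], so [e] is fixed before [n]. *)
Lemma rdist_moments_vanish v : rdist v -> rate 0 (lap v) -> rate 0 (lap (refl v)) ->
  exists N, forall j, (N < j)%nat -> v (fun x => x ^ j) = RtoC 0.
Proof.
  intros Hv Hr Hr'. pose proof Hv as [_ [_ [K [N [A [HK [HA B]]]]]]].
  exists N. intros j Hj.
  destruct (ramp_defect_small N j A Hj HA) as [C [HC BD]].
  apply Cmod_eq_0. apply Rle_antisym; [|apply Cmod_ge_0].
  apply le_epsilon. intros eta Heta. rewrite Rplus_0_l.
  set (e := Rmin 1 (eta / (4 * (K * C + 1)))).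
  assert (HKC : 0 <= K * C) by (apply Rmult_le_pos; auto).
  assert (He : 0 < e <= 1).
  { split; [apply Rmin_pos; [lra | apply Rdiv_lt_0_compat; lra] | apply Rmin_l]. }
  assert (He' : K * C * e <= eta / 4).
  { apply Rle_trans with ((K * C + 1) * (eta / (4 * (K * C + 1)))).
    - apply Rmult_le_compat; try lra. apply Rmin_r.
    - right. field. lra. }
  destruct (ramp_test_small v j e Hv Hr ltac:(lra)) as [C1 [HC1 B1]].
  destruct (ramp_test_small (refl v) j e (rdist_refl v Hv) Hr' ltac:(lra)) as [C2 [HC2 B2]].
  set (n := 1 + (K * C + C1 + C2) * (4 / eta)).
  assert (H4 : 0 < 4 / eta) by (apply Rdiv_lt_0_compat; lra).
  assert (Hn : 1 <= n) by (unfold n; nra).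
  assert (Hsmall : (K * C + C1 + C2) / n <= eta / 4).
  { apply Rmult_le_reg_r with n; [lra|]. unfold Rdiv at 1. rewrite Rmult_assoc, Rinv_l by lra.
    unfold n. replace (eta / 4 * (1 + (K * C + C1 + C2) * (4 / eta)))
      with (eta / 4 + (K * C + C1 + C2)) by (field; lra). lra. }
  specialize (BD n e Hn He). specialize (B1 n ltac:(lra)). specialize (B2 n ltac:(lra)).
  assert (SD : smooth (fun x => x ^ j - ramp j n (x + - e) - (-1) ^ j * ramp j n (- x + - e)))
    by auto using smooth_ramp_trans, smooth_ramp_refl with smooth.
  apply (B _ _ SD) in BD.
  rewrite !rdist_minus, rdist_scal in BD by auto using smooth_ramp_trans, smooth_ramp_refl with smooth.
  change (refl v (fun x => ramp j n (x + - e))) with (v (fun x => ramp j n (- x + - e))) in B2.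
  set (p := v (fun x => x ^ j)) in *. set (q := v (fun x => ramp j n (x + - e))) in *.
  set (r := v (fun x => ramp j n (- x + - e))) in *.
  replace p with (Cplus (Cplus (Cminus (Cminus p q) (Cmult (RtoC ((-1) ^ j)) r)) q)
     (Cmult (RtoC ((-1) ^ j)) r)) by ring.
  eapply Rle_trans; [apply Cmod_triangle|].
  eapply Rle_trans; [apply Rplus_le_compat_r, Cmod_triangle|].
  rewrite Cmod_mult, Cmod_R, Rabs_m1_pow, Rmult_1_l.
  replace (K * (C * (e + / n))) with (K * C * e + K * C / n) in BD by (field; lra).
  unfold Rdiv in *. lra.
Qed.


(** All moments of [x ^ S N] times [v] are high moments of [v], and polynomials are dense. *)
Lemma rdist_pow_annihilates v : rdist v -> rate 0 (lap v) -> rate 0 (lap (refl v)) ->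
  exists k, forall f, smooth f -> mulf (fun x => x ^ k) v f = RtoC 0.
Proof.
  intros Hv Hr Hr'. destruct (rdist_moments_vanish v Hv Hr Hr') as [N HN].
  exists (S N). apply rdist_moments_zero; [apply rdist_mulf; auto with smooth|].
  intro j. unfold mulf. rewrite <- (HN (S N + j)%nat) by lia.
  f_equal. apply functional_extensionality; intro x. symmetry; apply pow_add.
Qed.

Definition polyC (F : R -> C) : Prop := polyf (fun s => Re (F s)) /\ polyf (fun s => Im (F s)).

(** The hypothesis says that the [k]-th derivative of the transform is 0; it is integrated [k]
    times. *)
Lemma lap_polyC_aux k : forall v, rdist v ->
  (forall f, smooth f -> mulf (fun x => x ^ k) v f = RtoC 0) -> polyC (lap v).
Proof.
  induction k as [|k IH]; intros v Hv H.
  - assert (E : forall s, lap v s = RtoC 0).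
    { intro s. rewrite <- (mulf_pow0 v). apply H. apply smooth_expl. }
    split; (apply poly_ext with (fun _ => 0); [intro s; rewrite E; reflexivity | apply poly_const]).
  - destruct (IH (xm v)) as [P1 P2]; [apply rdist_xm, Hv | rewrite mulf_pow_xm; apply H |].
    split.
    + apply (poly_of_derive _ _ P1). intro s; apply dC_lap, Hv.
    + apply (poly_of_derive _ _ P2). intro s; apply dC_lap, Hv.
Qed.

Lemma lap_polyC v : rdist v -> rate 0 (lap v) -> rate 0 (lap (refl v)) -> polyC (lap v).
Proof.
  intros Hv H1 H2. destruct (rdist_pow_annihilates v Hv H1 H2) as [k Hk].
  apply (lap_polyC_aux k); auto.
Qed.

(** * Products [F^(j) (s) F (- s)] and the growth of [H] *)

Definition Fj (g : (R -> R) -> C) (j : nat) : R -> C := lap (mulf (fun x => x ^ j) g).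

Lemma dC_Fj g j s : rdist g -> dC (Fj g j) s (Fj g (S j) s).
Proof.
  intros Hg. unfold Fj. rewrite <- xm_mulf_pow. apply dC_lap, rdist_mulf; auto with smooth.
Qed.

Lemma Fj_0 g : Fj g 0 = lap g.
Proof. unfold Fj. rewrite mulf_pow0. reflexivity. Qed.

Lemma dC_Fj_refl g j s : rdist g ->
  dC (fun t => Cmult (Fj g j t) (Fj g 0 (- t))) s
    (Fj g (S j) s * Fj g 0 (- s)%R - Fj g j s * Fj g 1 (- s)%R)%C.
Proof.
  intros Hg. eapply eq_ind.
  - apply dC_mult; [apply dC_Fj, Hg | apply dC_comp_opp, dC_Fj, Hg].
  - cbv beta. ring.
Qed.

Lemma Cmult_sq_zero z : Cmult z z = RtoC 0 -> z = RtoC 0.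
Proof.
  intros H. apply Cmod_eq_0. assert (E : Cmod z * Cmod z = 0) by (rewrite <- Cmod_mult, H; apply Cmod_0).
  destruct (Rmult_integral _ _ E); auto.
Qed.

(* Mikusinski's trick: differentiating [F_j(s) F(-s) = 0] gives
   [F_{j+1}(s) F(-s) = F_j(s) F_1(-s)], whose square is a multiple of [F_j(s) F(-s)]. *)
Lemma lap_product_zero g : rdist g -> (forall s, Cmult (lap g s) (lap g (- s)) = RtoC 0) ->
  forall f, smooth f -> g f = RtoC 0.
Proof.
  intros Hg H.
  assert (Z : forall j s, Cmult (Fj g j s) (Fj g 0 (- s)) = RtoC 0).
  { induction j as [|j IH]; intro s; [rewrite Fj_0; apply H|].
    pose proof (dC_Fj_refl g j s Hg) as D.
    assert (E : (fun t => Cmult (Fj g j t) (Fj g 0 (- t))) = fun _ => RtoC 0)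
      by (apply functional_extensionality, IH).
    rewrite E in D. pose proof (dC_unique _ _ _ _ D (dC_const _ s)) as E'.
    apply Cmult_sq_zero.
    transitivity (Fj g j s * Fj g 0 (- s)%R * (Fj g (S j) s * Fj g 1 (- s)%R))%C.
    - transitivity (Fj g (S j) s * Fj g 0 (- s)%R *
        ((Fj g (S j) s * Fj g 0 (- s)%R - Fj g j s * Fj g 1 (- s)%R) + Fj g j s * Fj g 1 (- s)%R))%C;
        [ring|]. rewrite E'. ring.
    - rewrite IH. ring. }
  destruct (classic (exists s, lap g s <> RtoC 0)) as [[s0 Hs0]|Hno].
  (* The moments of [exp (- s0 x) g] are the [F_j (- s0)], which vanish because [F (s0) <> 0]. *)
  - assert (V : forall f, smooth f -> mulf (fun x => exp (- s0 * x)) g f = RtoC 0).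
    { apply rdist_moments_zero; [apply rdist_mulf; auto with smooth|].
      intro j. specialize (Z j (- s0)). rewrite Ropp_involutive, Fj_0 in Z.
      replace (mulf (fun x => exp (- s0 * x)) g (fun x => x ^ j)) with (Fj g j (- s0)).
      - transitivity (Fj g j (- s0)%R * lap g s0 / lap g s0)%C; [field; auto|]. rewrite Z. field; auto.
      - unfold Fj, lap, mulf. f_equal. apply functional_extensionality; intro; ring. }
    intros f Hf. rewrite <- (V (fun x => exp (s0 * x) * f x)) by auto with smooth.
    unfold mulf. f_equal. apply functional_extensionality; intro x.
    rewrite <- Rmult_assoc, <- exp_plus. replace (- s0 * x + s0 * x) with 0 by ring.
    rewrite exp_0. ring.
  - apply rdist_moments_zero; auto. intro j.
    assert (G : forall j s, Fj g j s = RtoC 0).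
    { clear j. induction j as [|j IH]; intro s.
      - rewrite Fj_0. apply NNPP. intro Hc. apply Hno. exists s; auto.
      - pose proof (dC_Fj g j s Hg) as D.
        replace (Fj g j) with (fun _ : R => RtoC 0) in D
          by (apply functional_extensionality; intro; symmetry; apply IH).
        exact (dC_unique _ _ _ _ D (dC_const _ s)). }
    rewrite <- (G j 0). unfold Fj, lap, mulf. f_equal.
    apply functional_extensionality; intro x. rewrite Rmult_0_l, exp_0. ring.
Qed.

(** Multiplying the derivative by [F s] gives one formula for all [n], without the exponent
    [n - 1]. *)
Lemma dC_pow_ex F s a n : dC F s a -> exists d, dC (fun t => Cpow (F t) n) s d /\
  Cmult (F s) d = (RtoC (INR n) * a * Cpow (F s) n)%C.
Proof.
  intros H. destruct n as [|n].
  - exists (RtoC 0). split; [exact (dC_const (RtoC 1) s) | simpl; ring].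
  - exists (RtoC (INR (S n)) * a * Cpow (F s) n)%C. split; [apply dC_pow, H|].
    rewrite Cpow_S. ring.
Qed.

(** Makes [P ^ n] times a transform a transform again, as [rate_xm] requires. *)
Fixpoint conv_iter (p u : (R -> R) -> C) (n : nat) : (R -> R) -> C :=
  match n with
  | O => u
  | S n => convR p (conv_iter p u n)
  end.

Lemma rdist_conv_iter p u n : rdist p -> rdist u -> rdist (conv_iter p u n).
Proof. intros Hp Hu. induction n; simpl; auto using rdist_convR. Qed.

Lemma lap_conv_iter p u n s : rdist p -> rdist u ->
  lap (conv_iter p u n) s = Cmult (Cpow (lap p s) n) (lap u s).
Proof.
  intros Hp Hu. induction n as [|n IH]; simpl; [ring|].
  rewrite lap_convR, IH by auto using rdist_conv_iter. ring.
Qed.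

Section LogDerivative.

Variable g : (R -> R) -> C.
Hypothesis Hg : rdist g.

Let p := convR g (refl g).
Let k := convR (xm g) (refl g).
Let P := lap p.
Let H := lap k.
Let A (m : nat) := convR (mulf (fun x => x ^ m) g) (refl g).

Let Hp : rdist p.
Proof. apply rdist_convR; auto using rdist_refl. Qed.

Let Hk : rdist k.
Proof. apply rdist_convR; auto using rdist_refl, rdist_xm. Qed.

Let HA m : rdist (A m).
Proof. apply rdist_convR; auto using rdist_refl. apply rdist_mulf; auto with smooth. Qed.

Lemma lap_A m s : lap (A m) s = Cmult (Fj g m s) (Fj g 0 (- s)).
Proof.
  unfold A. rewrite lap_convR, lap_refl, Fj_0; auto using rdist_refl.
  apply rdist_mulf; auto with smooth.
Qed.

Lemma P_eq s : P s = Cmult (Fj g 0 s) (Fj g 0 (- s)).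
Proof. unfold P, p. rewrite lap_convR, lap_refl, Fj_0; auto using rdist_refl. Qed.

Lemma H_eq s : H s = Cmult (Fj g 1 s) (Fj g 0 (- s)).
Proof.
  unfold H, k, Fj. rewrite lap_convR, lap_refl, mulf_pow0, mulf_pow1; auto using rdist_refl, rdist_xm.
Qed.

Lemma P'_eq s : lap (xm p) s = (Fj g 1 s * Fj g 0 (- s)%R - Fj g 0 s * Fj g 1 (- s)%R)%C.
Proof.
  apply (dC_unique P s); [apply dC_lap, Hp|].
  replace P with (fun t => Cmult (Fj g 0 t) (Fj g 0 (- t)))
    by (apply functional_extensionality; intro; symmetry; apply P_eq).
  apply dC_Fj_refl, Hg.
Qed.

(* [P ^ n * F_{n+1}(s) F(-s)], which is [P ^ (n+1) F_{n+1} / F]. *)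
Let w n := conv_iter p (A (S n)) n.
Let b n := lap (w n).

Lemma b_eq n s : b n s = (Cpow (P s) n * (Fj g (S n) s * Fj g 0 (- s)%R))%C.
Proof. unfold b, w. rewrite lap_conv_iter, lap_A; auto. Qed.

(** Differentiate [b n] and multiply by [P]; the term with [F_1 (- s)] is then rewritten by
    [F (s) F_1 (- s) = H - P']. *)
Lemma b_recurrence n s :
  b (S n) s = (P s * lap (xm (w n)) s - RtoC (INR (S n)) * lap (xm p) s * b n s + H s * b n s)%C.
Proof.
  assert (DP : dC P s (lap (xm p) s)) by (apply dC_lap, Hp).
  destruct (dC_pow_ex P s _ n DP) as [d [Dd Ed]].
  assert (E : lap (xm (w n)) s = (d * (Fj g (S n) s * Fj g 0 (- s)%R) + Cpow (P s) n *
     (Fj g (S (S n)) s * Fj g 0 (- s)%R - Fj g (S n) s * Fj g 1 (- s)%R))%C).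
  { apply (dC_unique (b n) s); [apply dC_lap, rdist_conv_iter; auto|].
    replace (b n) with (fun t => Cmult (Cpow (P t) n) (Cmult (Fj g (S n) t) (Fj g 0 (- t))))
      by (apply functional_extensionality; intro; symmetry; apply b_eq).
    apply dC_mult; [apply Dd | apply dC_Fj_refl, Hg]. }
  rewrite E, Cmult_plus_distr_l, Cmult_assoc, Ed, !b_eq, P'_eq, H_eq, Cpow_S, S_INR, RtoC_plus.
  set (X := Cpow (P s) n). rewrite P_eq. ring.
Qed.

Hypothesis rateP : rate 0 P.

(** [P] and [P'] have rate 0 and differentiating [b n] does not raise its rate [(n + 1) t]. So
    [b (S n)] is [H * b n] up to that rate, one [t] less than the natural rate of [H ^ (n + 2)]. *)
Lemma b_minus_pow_rate n t : 0 <= t -> rate t H ->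
  rate (INR n * t) (fun s => Cminus (b n s) (Cpow (H s) (S n))).
Proof.
  intros Ht HH. assert (HP : rate 0 (lap (xm p))) by (apply rate_xm; auto).
  induction n as [|n IH].
  - replace (fun s => Cminus (b 0 s) (Cpow (H s) 1)) with (fun _ : R => RtoC 0).
    + simpl. rewrite Rmult_0_l. apply rate_const.
    + apply functional_extensionality; intro s. rewrite b_eq, H_eq. simpl. ring.
  - assert (Rb : rate (INR (S n) * t) (b n)).
    { replace (b n) with (fun s => Cplus (Cminus (b n s) (Cpow (H s) (S n))) (Cpow (H s) (S n))).
      - apply rate_plus; [|apply rate_pow, HH].
        eapply rate_le; [|apply IH]. rewrite S_INR. nra.
      - apply functional_extensionality; intro s. ring. }
    assert (Rb' : rate (INR (S n) * t) (lap (xm (w n)))).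
    { apply rate_xm; auto. apply rdist_conv_iter; auto. }
    replace (fun s => Cminus (b (S n) s) (Cpow (H s) (S (S n)))) with
      (fun s => Cplus (Cplus (Cmult (P s) (lap (xm (w n)) s))
         (Cmult (Copp (RtoC (INR (S n)))) (Cmult (lap (xm p) s) (b n s))))
         (Cmult (H s) (Cminus (b n s) (Cpow (H s) (S n))))).
    + apply rate_plus; [apply rate_plus|].
      * replace (INR (S n) * t) with (0 + INR (S n) * t) by ring. apply (rate_mult 0 _ P); auto.
      * apply rate_scal. replace (INR (S n) * t) with (0 + INR (S n) * t) by ring.
        apply (rate_mult 0 _ (lap (xm p))); auto.
      * rewrite S_INR. replace ((INR n + 1) * t) with (t + INR n * t) by ring.
        apply (rate_mult t _ H); auto.
    + apply functional_extensionality; intro s. rewrite b_recurrence, (Cpow_S (H s) (S n)). ring.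
Qed.

(** [b n] is [P ^ n] times a transform of rate [L], so it has rate [L] whatever [n] is. Then
    [H ^ (n + 1)] has rate [max (L, n t)], and the root divides this by [n + 1]. *)
Lemma H_rate_step L n t : (forall m, rate L (lap (A m))) -> 0 <= t -> rate t H ->
  rate (Rmax L (INR n * t) / INR (S n)) H.
Proof.
  intros HL Ht HH. assert (Hn : 0 < INR (S n)) by (apply lt_0_INR; lia).
  apply (rate_root _ _ n).
  replace (INR (S n) * (Rmax L (INR n * t) / INR (S n))) with (Rmax L (INR n * t)) by (field; lra).
  replace (fun s => Cpow (H s) (S n)) with
    (fun s => Cplus (b n s) (Cmult (RtoC (-1)) (Cminus (b n s) (Cpow (H s) (S n))))).
  - apply rate_plus.
    + apply rate_le with (INR n * 0 + L); [rewrite Rmult_0_r, Rplus_0_l; apply Rmax_l|].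
      replace (b n) with (fun s => Cmult (Cpow (P s) n) (lap (A (S n)) s)).
      * apply (rate_mult _ _ (fun s => Cpow (P s) n)); auto. apply rate_pow, rateP.
      * apply functional_extensionality; intro s. rewrite b_eq, lap_A. reflexivity.
    + apply rate_scal. eapply rate_le; [apply Rmax_r|]. apply b_minus_pow_rate; auto.
  - apply functional_extensionality; intro s. ring.
Qed.

Lemma H_rate : rate 0 H.
Proof.
  destruct (rate_lap g Hg) as [l1 [Hl1 R1]], (rate_lap (refl g) (rdist_refl g Hg)) as [l2 [Hl2 R2]].
  set (L := l1 + l2).
  assert (HL : forall m, rate L (lap (A m))).
  { intro m. replace (lap (A m)) with (fun s => Cmult (Fj g m s) (lap (refl g) s)).
    - apply rate_mult; [apply R1|]. specialize (R2 0%nat). rewrite mulf_pow0 in R2. exact R2.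
    - apply functional_extensionality; intro s. rewrite lap_A, lap_refl, Fj_0. reflexivity. }
  assert (HL0 : 0 <= L) by (unfold L; lra).
  assert (RH : rate L H).
  { replace H with (lap (A 1)); [apply HL|]. apply functional_extensionality; intro s.
    rewrite lap_A, H_eq. reflexivity. }
  apply rate_closed. intros e He. rewrite Rplus_0_l.
  (* With [n e > L] and [r = n / (n + 1)], one step improves the rate [max (e, r^i L)] to
     [max (e, r^(i+1) L)]. *)
  destruct (INR_archimed e L He) as [n Hn].
  assert (Hn0 : 0 < INR (S n)) by (apply lt_0_INR; lia).
  set (r := INR n / INR (S n)).
  assert (Hr : 0 <= r < 1).
  { unfold r. split; [apply Rmult_le_pos; [apply pos_INR | left; apply Rinv_0_lt_compat; auto]|].
    apply Rmult_lt_reg_r with (INR (S n)); auto. unfold Rdiv. rewrite Rmult_assoc, Rinv_l by lra.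
    rewrite S_INR. lra. }
  assert (Er : r * INR (S n) = INR n) by (unfold r; field; lra).
  assert (I : forall i, rate (Rmax e (r ^ i * L)) H).
  { induction i as [|i IH].
    - eapply rate_le; [|apply RH]. simpl. rewrite Rmult_1_l. apply Rmax_r.
    - eapply rate_le; [|apply (H_rate_step L n (Rmax e (r ^ i * L))); auto].
      + set (t := Rmax e (r ^ i * L)).
        apply Rmult_le_reg_r with (INR (S n)); auto. unfold Rdiv. rewrite Rmult_assoc, Rinv_l, Rmult_1_r by lra.
        apply Rmax_lub.
        * apply Rle_trans with (e * INR (S n)); [rewrite S_INR; lra|].
          apply Rmult_le_compat_r; [lra | apply Rmax_l].
        * unfold t. rewrite <- RmaxRmult by apply pos_INR. apply Rmax_lub.
          -- rewrite Rmult_comm. apply Rmult_le_compat; [left; exact He | apply pos_INR | apply Rmax_l | apply le_INR; lia].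
          -- replace (INR n * (r ^ i * L)) with (r ^ S i * L * INR (S n))
               by (rewrite <- Er; simpl pow; ring).
             apply Rmult_le_compat_r; [lra | apply Rmax_r].
      + eapply Rle_trans; [|apply Rmax_l]. lra. }
  destruct (pow_lt_1_zero r ltac:(rewrite Rabs_pos_eq; lra) (e / (L + 1))) as [i Hi].
  { apply Rdiv_lt_0_compat; lra. }
  specialize (Hi i (Nat.le_refl _)). rewrite Rabs_pos_eq in Hi by (apply pow_le; lra).
  eapply rate_le; [|apply (I i)]. apply Rmax_lub; [lra|].
  apply Rle_trans with (e / (L + 1) * (L + 1)); [|right; field; lra].
  assert (0 <= r ^ i) by (apply pow_le; lra).
  apply Rmult_le_compat; lra.
Qed.

(** [H (- s) = F (s) F_1 (- s) = H (s) - P' (s)], which transfers the bound to the other end. *)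
Lemma H_refl_rate : rate 0 (lap (refl k)).
Proof.
  replace (lap (refl k)) with (fun s => Cplus (H s) (Cmult (RtoC (-1)) (lap (xm p) s))).
  - apply rate_plus; [apply H_rate|]. apply rate_scal, rate_xm; auto.
  - apply functional_extensionality; intro s. rewrite lap_refl. fold H.
    rewrite !H_eq, P'_eq, Ropp_involutive. ring.
Qed.

End LogDerivative.


(** * Polynomial asymptotics and growth under [W q' = Q q] *)

Definition near_inf (P : R -> Prop) : Prop := exists S, forall s, S <= s -> P s.

Lemma near_inf_and P Q : near_inf P -> near_inf Q -> near_inf (fun s => P s /\ Q s).
Proof.
  intros [S HS] [T HT]. exists (Rmax S T). intros s Hs.
  pose proof (Rmax_l S T). pose proof (Rmax_r S T). split; [apply HS | apply HT]; lra.
Qed.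

Lemma near_inf_impl (P Q : R -> Prop) : (forall s, P s -> Q s) -> near_inf P -> near_inf Q.
Proof. intros H [S HS]. exists S; auto. Qed.

Lemma near_inf_ge T : near_inf (fun s => T <= s).
Proof. exists T; auto. Qed.

Lemma near_inf_ex P : near_inf P -> exists s, 0 <= s /\ P s.
Proof.
  intros [S HS]. exists (Rmax 0 S). split; [apply Rmax_l | apply HS, Rmax_r].
Qed.

(** Extracts the leading term. The zero polynomial is set apart because a Horner form may end in
    zeros. *)
Lemma poly_asymp Q : polyf Q -> (forall s, Q s = 0) \/
  exists d c, c <> 0 /\ forall e, 0 < e -> near_inf (fun s => Rabs (Q s - c * s ^ d) <= e * s ^ d).
Proof.
  intros HQ. induction HQ as [c|c Q HQ [IH|[d [c' [Hc' IH]]]]].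
  - destruct (Req_dec c 0) as [->|Hc]; [left; auto|right].
    exists 0%nat, c. split; auto. intros e He. exists 0. intros s _. simpl.
    replace (c - c * 1) with 0 by ring. rewrite Rabs_R0. lra.
  - destruct (Req_dec c 0) as [->|Hc]; [left; intro; rewrite IH; ring|right].
    exists 0%nat, c. split; auto. intros e He. exists 0. intros s _. rewrite IH. simpl.
    replace (c + s * 0 - c * 1) with 0 by ring. rewrite Rabs_R0. lra.
  - right. exists (S d), c'. split; auto. intros e He.
    eapply near_inf_impl; [|apply (near_inf_and _ _ (IH (e / 2) ltac:(lra))
      (near_inf_and _ _ (near_inf_ge 1) (near_inf_ge (2 * Rabs c / e))))].
    intros s [H1 [H2 H3]]. simpl.
    replace (c + s * Q s - c' * (s * s ^ d)) with (c + s * (Q s - c' * s ^ d)) by ring.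
    eapply Rle_trans; [apply Rabs_triang|]. rewrite Rabs_mult, (Rabs_pos_eq s) by lra.
    assert (Hd : 1 <= s ^ d) by (apply pow_R1_Rle; lra).
    assert (Hc : Rabs c <= e / 2 * s).
    { apply Rmult_le_reg_r with (2 / e); [apply Rdiv_lt_0_compat; lra|].
      replace (e / 2 * s * (2 / e)) with s by (field; lra).
      replace (Rabs c * (2 / e)) with (2 * Rabs c / e) by (field; lra). auto. }
    assert (s * Rabs (Q s - c' * s ^ d) <= s * (e / 2 * s ^ d)) by (apply Rmult_le_compat_l; lra).
    assert (e / 2 * s * 1 <= e / 2 * s * s ^ d) by (apply Rmult_le_compat_l; nra).
    nra.
Qed.

Lemma poly_exp_bound Q d : polyf Q -> 0 < d ->
  exists C, 0 <= C /\ forall s, 0 <= s -> Rabs (Q s) <= C * exp (d * s).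
Proof.
  intros HQ. revert d. induction HQ as [c|c Q HQ IH]; intros d Hd.
  - exists (Rabs c). split; [apply Rabs_pos|]. intros s Hs.
    assert (1 <= exp (d * s)) by (rewrite <- exp_0; apply exp_le; nra).
    pose proof (Rabs_pos c). nra.
  - destruct (IH (d / 2) ltac:(lra)) as [C [HC B]].
    destruct (pow_le_exp 1 (d / 2) ltac:(lra)) as [C' [HC' B']].
    exists (Rabs c + C' * C). split; [pose proof (Rabs_pos c); nra|]. intros s Hs.
    assert (1 <= exp (d * s)) by (rewrite <- exp_0; apply exp_le; nra).
    eapply Rle_trans; [apply Rabs_triang|]. rewrite Rabs_mult, (Rabs_pos_eq s Hs).
    specialize (B s Hs). specialize (B' s Hs). simpl in B'.
    assert (s * Rabs (Q s) <= (C' * exp (d / 2 * s)) * (C * exp (d / 2 * s))).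
    { apply Rmult_le_compat; auto using Rabs_pos. lra. }
    assert (E : exp (d * s) = exp (d / 2 * s) * exp (d / 2 * s)) by (rewrite <- exp_plus; f_equal; field).
    pose proof (Rabs_pos c). rewrite Rmult_plus_distr_r.
    apply Rplus_le_compat; [nra|]. rewrite E. nra.
Qed.

(** The finite or infinite limit of [Q / W], phrased without division since [W] may have zeros.
    [W >= 0] makes its leading coefficient positive. *)
Lemma poly_ratio Q W : polyf Q -> polyf W -> (exists s, W s <> 0) -> (forall s, 0 <= W s) ->
  (exists w, 0 < w /\ near_inf (fun s => w <= W s)) /\
  ((exists c, forall e, 0 < e -> near_inf (fun s => (c - e) * W s <= Q s <= (c + e) * W s)) \/
   (forall m, near_inf (fun s => m * W s <= Q s)) \/ (forall m, near_inf (fun s => Q s <= m * W s))).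
Proof.
  intros HQ HW [s0 Hs0] Wpos.
  destruct (poly_asymp W HW) as [Z|[b [be [Hbe AW]]]]; [exfalso; apply Hs0, Z|].
  assert (Hb : 0 < be).
  { destruct (near_inf_ex _ (near_inf_and _ _ (AW (Rabs be / 2) ltac:(apply Rabs_pos_lt in Hbe; lra)) (near_inf_ge 1)))
      as [s [_ [H1 H2]]].
    assert (0 < s ^ b) by (apply pow_lt; lra). specialize (Wpos s).
    apply Rabs_le_between in H1.
    destruct (Rlt_le_dec 0 be) as [L|L]; auto. exfalso.
    rewrite (Rabs_left1 be L) in H1. nra. }
  assert (LW : near_inf (fun s => be / 2 * s ^ b <= W s <= 2 * be * s ^ b)).
  { eapply near_inf_impl; [|apply (AW (be / 2) ltac:(lra))]. intros s H.
    apply Rabs_le_between in H. pose proof (Wpos s). split; [lra|].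
    assert (0 <= be * s ^ b) by lra. lra. }
  split.
  { exists (be / 2). split; [lra|].
    eapply near_inf_impl; [|apply (near_inf_and _ _ LW (near_inf_ge 1))].
    intros s [H1 H2]. assert (1 <= s ^ b) by (apply pow_R1_Rle; lra). nra. }
  destruct (poly_asymp Q HQ) as [Z|[a [al [Hal AQ]]]].
  { left. exists 0. intros e He. exists 0. intros s _. rewrite Z. specialize (Wpos s). nra. }
  (* By degrees of [Q] and [W], the limit is 0, the ratio [al / be], or infinite with the sign of
     [al]. *)
  destruct (Nat.lt_trichotomy a b) as [Hab|[Hab|Hab]].
  - left. exists 0. intros e He.
    eapply near_inf_impl; [|apply (near_inf_and _ _ LW (near_inf_and _ _ (AQ 1 Rlt_0_1)
      (near_inf_and _ _ (near_inf_ge 1) (near_inf_ge ((Rabs al + 1) * 2 / (e * be))))))].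
    intros s [H1 [H2 [H3 H4]]].
    assert (Ha : 0 < s ^ a) by (apply pow_lt; lra).
    assert (Hsb : s * s ^ a <= s ^ b).
    { change (s * s ^ a) with (s ^ S a). apply Rle_pow; [lra | lia]. }
    assert (B : Rabs (Q s) <= (Rabs al + 1) * s ^ a).
    { replace (Q s) with ((Q s - al * s ^ a) + al * s ^ a) by ring.
      eapply Rle_trans; [apply Rabs_triang|]. rewrite Rabs_mult, (Rabs_pos_eq (s ^ a)) by lra. lra. }
    assert (D : Rabs al + 1 <= e * be / 2 * s).
    { apply Rmult_le_reg_r with (2 / (e * be)); [apply Rdiv_lt_0_compat; nra|].
      replace (e * be / 2 * s * (2 / (e * be))) with s by (field; lra).
      replace ((Rabs al + 1) * (2 / (e * be))) with ((Rabs al + 1) * 2 / (e * be)) by (field; lra). auto. }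
    assert (B2 : Rabs (Q s) <= e * W s).
    { eapply Rle_trans; [apply B|].
      apply Rle_trans with (e * be / 2 * (s * s ^ a)); [nra|].
      apply Rle_trans with (e * (be / 2 * s ^ b)); [|apply Rmult_le_compat_l; lra].
      replace (e * (be / 2 * s ^ b)) with (e * be / 2 * s ^ b) by field.
      apply Rmult_le_compat_l; [nra | auto]. }
    apply Rabs_le_between in B2. split; lra.
  - subst b. left. exists (al / be). intros e He.
    set (d := e * be / (2 * (1 + Rabs (al / be)))).
    assert (Hr : 0 <= Rabs (al / be)) by apply Rabs_pos.
    assert (Hd : 0 < d) by (apply Rdiv_lt_0_compat; nra).
    eapply near_inf_impl; [|apply (near_inf_and _ _ LW (near_inf_and _ _ (AQ d Hd)
      (near_inf_and _ _ (near_inf_ge 1) (AW d Hd))))].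
    intros s [H1 [H2 [H3 H4]]].
    assert (Ha : 0 < s ^ a) by (apply pow_lt; lra).
    assert (B : Rabs (Q s - al / be * W s) <= e * W s).
    { replace (Q s - al / be * W s) with ((Q s - al * s ^ a) + - (al / be) * (W s - be * s ^ a)) by (field; lra).
      eapply Rle_trans; [apply Rabs_triang|]. rewrite Rabs_mult, Rabs_Ropp.
      apply Rle_trans with (d * s ^ a + Rabs (al / be) * (d * s ^ a)).
      - apply Rplus_le_compat; auto. apply Rmult_le_compat_l; auto.
      - replace (d * s ^ a + Rabs (al / be) * (d * s ^ a)) with (e * (be / 2 * s ^ a))
          by (unfold d; field; lra).
        apply Rmult_le_compat_l; lra. }
    apply Rabs_le_between in B. split; nra.
  - right. destruct (Rdichotomy _ _ Hal) as [Hs|Hs].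
    + right. intros m.
      eapply near_inf_impl; [|apply (near_inf_and _ _ LW (near_inf_and _ _ (AQ (- al / 2) ltac:(lra))
        (near_inf_and _ _ (near_inf_ge 1) (near_inf_ge (2 * (2 * be * Rabs m) / - al)))))].
      intros s [H1 [H2 [H3 H4]]].
      assert (Ha : 0 < s ^ b) by (apply pow_lt; lra).
      assert (Hsb : s * s ^ b <= s ^ a).
      { change (s * s ^ b) with (s ^ S b). apply Rle_pow; [lra | lia]. }
      apply Rabs_le_between in H2.
      assert (D : 2 * be * Rabs m <= - al / 2 * s).
      { apply Rmult_le_reg_r with (2 / - al); [apply Rdiv_lt_0_compat; lra|].
        replace (- al / 2 * s * (2 / - al)) with s by (field; lra).
        replace (2 * be * Rabs m * (2 / - al)) with (2 * (2 * be * Rabs m) / - al) by (field; lra). auto. }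
      assert (M1 : - (Rabs m * W s) <= m * W s).
      { pose proof (Rle_abs (- m)). rewrite Rabs_Ropp in *. specialize (Wpos s). nra. }
      assert (M2 : Rabs m * W s <= 2 * be * Rabs m * s ^ b) by (pose proof (Rabs_pos m); nra).
      assert (M3 : 2 * be * Rabs m * s ^ b <= - al / 2 * (s * s ^ b)) by nra.
      assert (M4 : - al / 2 * (s * s ^ b) <= - al / 2 * s ^ a) by (apply Rmult_le_compat_l; lra).
      lra.
    + left. intros m.
      eapply near_inf_impl; [|apply (near_inf_and _ _ LW (near_inf_and _ _ (AQ (al / 2) ltac:(lra))
        (near_inf_and _ _ (near_inf_ge 1) (near_inf_ge (2 * (2 * be * Rabs m) / al)))))].
      intros s [H1 [H2 [H3 H4]]].
      assert (Ha : 0 < s ^ b) by (apply pow_lt; lra).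
      assert (Hsb : s * s ^ b <= s ^ a).
      { change (s * s ^ b) with (s ^ S b). apply Rle_pow; [lra | lia]. }
      apply Rabs_le_between in H2.
      assert (D : 2 * be * Rabs m <= al / 2 * s).
      { apply Rmult_le_reg_r with (2 / al); [apply Rdiv_lt_0_compat; lra|].
        replace (al / 2 * s * (2 / al)) with s by (field; lra).
        replace (2 * be * Rabs m * (2 / al)) with (2 * (2 * be * Rabs m) / al) by (field; lra). auto. }
      assert (M1 : m * W s <= Rabs m * W s) by (apply Rmult_le_compat_r; auto; apply Rle_abs).
      assert (M2 : Rabs m * W s <= 2 * be * Rabs m * s ^ b) by (pose proof (Rabs_pos m); nra).
      assert (M3 : 2 * be * Rabs m * s ^ b <= al / 2 * (s * s ^ b)) by nra.
      assert (M4 : al / 2 * (s * s ^ b) <= al / 2 * s ^ a) by (apply Rmult_le_compat_l; lra).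
      lra.
Qed.

Section GrowthODE.

Variables q q' Q W : R -> R.
Hypothesis Dq : forall s : R, is_derive q s (q' s).
Hypothesis ODE : forall s, W s * q' s = Q s * q s.
Hypothesis q_pos : forall s, 0 <= q s.
Hypothesis W_low : exists w, 0 < w /\ near_inf (fun s => w <= W s).

Lemma is_derive_damped m (s : R) :
  is_derive (fun t => q t * exp (m * t)) s ((q' s + m * q s) * exp (m * s)).
Proof.
  eapply is_derive_eq; [apply is_derive_Rmult; [apply Dq | apply is_derive_expl]|]. cbv beta. ring.
Qed.

(** Since [W] is eventually at least [w > 0], the equation gives [q' <= m * q], so
    [q s * exp (- m * s)] eventually does not increase. *)
Lemma growth_upper m : near_inf (fun s => Q s <= m * W s) ->
  exists C, 0 <= C /\ near_inf (fun s => q s <= C * exp (m * s)).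
Proof.
  intros HQ. destruct W_low as [w0 [Hw0 HW]].
  destruct (near_inf_and _ _ HQ HW) as [S HS].
  exists (q S * exp (- m * S)). split; [apply Rmult_le_pos; auto; left; apply exp_pos|].
  exists S. intros s Hs.
  destruct (MVT_everywhere _ _ (is_derive_damped (- m)) S s) as [c [Hc E]]. cbv beta in E.
  rewrite Rmin_left, Rmax_right in Hc by lra.
  assert (L : q' c + - m * q c <= 0).
  { destruct (HS c ltac:(lra)) as [H1 H2]. specialize (ODE c). specialize (q_pos c).
    assert (W c * (q' c + - m * q c) <= 0) by nra. nra. }
  assert (L2 : q s * exp (- m * s) <= q S * exp (- m * S)).
  { assert ((q' c + - m * q c) * exp (- m * c) <= 0) by (pose proof (exp_pos (- m * c)); nra). nra. }
  apply Rmult_le_reg_r with (exp (- m * s)); [apply exp_pos|].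
  rewrite (Rmult_assoc _ (exp (m * s))), <- exp_plus. replace (m * s + - m * s) with 0 by ring.
  rewrite exp_0, Rmult_1_r. auto.
Qed.

Lemma growth_lower m : near_inf (fun s => m * W s <= Q s) -> near_inf (fun s => 0 < q s) ->
  exists C, 0 < C /\ near_inf (fun s => C * exp (m * s) <= q s).
Proof.
  intros HQ Hq. destruct W_low as [w0 [Hw0 HW]].
  destruct (near_inf_and _ _ Hq (near_inf_and _ _ HQ HW)) as [S HS].
  exists (q S * exp (- m * S)). split; [apply Rmult_lt_0_compat; [apply HS; lra | apply exp_pos]|].
  exists S. intros s Hs.
  destruct (MVT_everywhere _ _ (is_derive_damped (- m)) S s) as [c [Hc E]]. cbv beta in E.
  rewrite Rmin_left, Rmax_right in Hc by lra.
  assert (L : 0 <= q' c + - m * q c).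
  { destruct (HS c ltac:(lra)) as [_ [H1 H2]]. specialize (ODE c). specialize (q_pos c).
    assert (0 <= W c * (q' c + - m * q c)) by nra. nra. }
  assert (L2 : q S * exp (- m * S) <= q s * exp (- m * s)).
  { assert (0 <= (q' c + - m * q c) * exp (- m * c)) by (pose proof (exp_pos (- m * c)); nra). nra. }
  apply Rmult_le_reg_r with (exp (- m * s)); [apply exp_pos|].
  rewrite (Rmult_assoc _ (exp (m * s))), <- exp_plus. replace (m * s + - m * s) with 0 by ring.
  rewrite exp_0, Rmult_1_r. auto.
Qed.

Hypothesis PQ : polyf Q.
Hypothesis PW : polyf W.
Hypothesis W_pos : forall s, 0 <= W s.
Hypothesis q_sym : forall s, q s * q (- s) = W s.

Lemma exp_unbounded a b : 0 < a -> ~ near_inf (fun s => a * exp s <= b).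
Proof.
  intros Ha H. destruct (near_inf_ex _ (near_inf_and _ _ H (near_inf_ge (b / a)))) as [s [_ [H1 H2]]].
  pose proof (exp_ineq1_le s). assert (b <= a * s).
  { apply Rmult_le_reg_r with (/ a); [apply Rinv_0_lt_compat; auto|].
    replace (a * s * / a) with s by (field; lra). exact H2. }
  nra.
Qed.

(** A finite limit [c] of [Q / W] gives the growth at plus infinity. At minus infinity,
    [q s * q (- s) = W s] with [W] polynomial turns a lower bound at plus infinity into an upper
    bound with slope [- c]. An infinite limit is excluded: plus infinity would beat the a priori
    bound, minus infinity would send [W] to 0 against [W_low]. *)
Lemma growth_balanced l C0 : (forall s, q s <= C0 * exp (l * Rabs s)) -> (exists s, W s <> 0) ->
  exists c, forall d, 0 < d -> exists C, 0 <= C /\ forall s, 0 <= s ->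
    q s <= C * exp ((c + d) * s) /\ q (- s) <= C * exp ((- c + d) * s).
Proof.
  intros Hl HW0.
  destruct (poly_ratio Q W PQ PW HW0 W_pos) as [[w [Hw HW]] Cases].
  assert (HC0 : 0 <= C0).
  { specialize (Hl 0). rewrite Rabs_R0, Rmult_0_r, exp_0, Rmult_1_r in Hl. specialize (q_pos 0). lra. }
  assert (Hq : near_inf (fun s => 0 < q s)).
  { eapply near_inf_impl; [|apply HW]. intros s Hs.
    pose proof (q_sym s). pose proof (q_pos s). pose proof (q_pos (- s)).
    destruct (Req_dec (q s) 0) as [E|E]; [rewrite E in *; nra | lra]. }
  assert (Hl' : forall s, 0 <= s -> q s <= C0 * exp (l * s) /\ q (- s) <= C0 * exp (l * s)).
  { intros s Hs. pose proof (Hl s). pose proof (Hl (- s)). rewrite Rabs_Ropp in *.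
    rewrite Rabs_pos_eq in * by auto. auto. }
  destruct Cases as [[c Hc]|[Hc|Hc]].
  - exists c. intros d Hd.
    destruct (growth_upper (c + d)) as [C1 [HC1 U]].
    { eapply near_inf_impl; [|apply (Hc d Hd)]. intros s Hs; apply Hs. }
    (* Half of [d] is spent here, the other half on the polynomial [W]. *)
    destruct (growth_lower (c - d / 2)) as [C2 [HC2 Lo]]; auto.
    { eapply near_inf_impl; [|apply (Hc (d / 2) ltac:(lra))]. intros s Hs; apply Hs. }
    destruct (poly_exp_bound W (d / 2) PW ltac:(lra)) as [C3 [HC3 B3]].
    destruct (near_inf_and _ _ U (near_inf_and _ _ Lo (near_inf_ge 0))) as [S HS].
    set (T := Rmax 0 S).
    assert (HT : 0 <= T) by apply Rmax_l.
    (* on the compact part [0 <= s <= T] the a priori bound suffices *)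
    set (K := C0 * exp (Rabs l * T) * exp ((Rabs c + d) * T)).
    assert (HK : 0 <= K).
    { apply Rmult_le_pos; [apply Rmult_le_pos; auto|]; left; apply exp_pos. }
    assert (HK2 : forall s m, 0 <= s <= T -> Rabs m <= Rabs c + d -> C0 * exp (l * s) <= K * exp (m * s)).
    { intros s m Hs Hm. unfold K. rewrite !Rmult_assoc. apply Rmult_le_compat_l; auto.
      rewrite <- !exp_plus. apply exp_le.
      assert (l * s <= Rabs l * T).
      { pose proof (Rle_abs l). pose proof (Rabs_pos l). nra. }
      assert (- (m * s) <= (Rabs c + d) * T).
      { pose proof (Rle_abs (- m)). rewrite Rabs_Ropp in *. pose proof (Rabs_pos m). nra. }
      lra. }
    assert (Hm1 : Rabs (c + d) <= Rabs c + d).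
    { eapply Rle_trans; [apply Rabs_triang|]. rewrite (Rabs_pos_eq d); lra. }
    assert (Hm2 : Rabs (- c + d) <= Rabs c + d).
    { eapply Rle_trans; [apply Rabs_triang|]. rewrite Rabs_Ropp, (Rabs_pos_eq d); lra. }
    assert (H32 : 0 <= C3 / C2) by (apply Rmult_le_pos; auto; left; apply Rinv_0_lt_compat; auto).
    exists (K + C1 + C3 / C2). split; [lra|]. intros s Hs.
    destruct (Rle_lt_dec s T) as [L|L].
    + destruct (Hl' s Hs) as [A1 A2].
      pose proof (HK2 s (c + d) ltac:(lra) Hm1). pose proof (HK2 s (- c + d) ltac:(lra) Hm2).
      pose proof (exp_pos ((c + d) * s)). pose proof (exp_pos ((- c + d) * s)). split; nra.
    + assert (LS : S <= s) by (pose proof (Rmax_r 0 S); unfold T in L; lra).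
      destruct (HS s LS) as [H1 [H2 _]].
      pose proof (exp_pos ((c + d) * s)). pose proof (exp_pos ((- c + d) * s)). split; [nra|].
      apply Rle_trans with (C3 / C2 * exp ((- c + d) * s)); [|nra].
      assert (P2 : 0 < C2 * exp ((c - d / 2) * s)) by (apply Rmult_lt_0_compat; auto; apply exp_pos).
      apply Rmult_le_reg_l with (C2 * exp ((c - d / 2) * s)); auto.
      apply Rle_trans with (q s * q (- s)); [apply Rmult_le_compat_r; auto|].
      rewrite q_sym.
      replace (C2 * exp ((c - d / 2) * s) * (C3 / C2 * exp ((- c + d) * s)))
        with (C3 * (exp ((c - d / 2) * s) * exp ((- c + d) * s))) by (field; lra).
      rewrite <- exp_plus. replace ((c - d / 2) * s + (- c + d) * s) with (d / 2 * s) by field.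
      eapply Rle_trans; [apply Rle_abs | apply B3; auto].
  - exfalso. destruct (growth_lower (l + 1) (Hc (l + 1)) Hq) as [C [HC Lo]].
    apply (exp_unbounded C C0 HC).
    eapply near_inf_impl; [|apply (near_inf_and _ _ Lo (near_inf_ge 0))]. intros s [H1 H2].
    destruct (Hl' s H2) as [H3 _].
    apply Rmult_le_reg_r with (exp (l * s)); [apply exp_pos|].
    rewrite Rmult_assoc, <- exp_plus. replace (s + l * s) with ((l + 1) * s) by ring. lra.
  - exfalso. destruct (growth_upper (- (l + 1)) (Hc (- (l + 1)))) as [C [HC U]].
    apply (exp_unbounded w (C * C0) Hw).
    eapply near_inf_impl; [|apply (near_inf_and _ _ U (near_inf_and _ _ HW (near_inf_ge 0)))].
    intros s [H1 [H2 H3]]. destruct (Hl' s H3) as [_ H4].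
    pose proof (q_pos s). pose proof (q_pos (- s)).
    assert (H5 : q s * q (- s) <= (C * exp (- (l + 1) * s)) * (C0 * exp (l * s)))
      by (apply Rmult_le_compat; auto).
    rewrite q_sym in H5.
    replace ((C * exp (- (l + 1) * s)) * (C0 * exp (l * s)))
      with (C * C0 * (exp (- (l + 1) * s) * exp (l * s))) in H5 by ring.
    rewrite <- exp_plus in H5. replace (- (l + 1) * s + l * s) with (- s) in H5 by ring.
    apply Rmult_le_reg_r with (exp (- s)); [apply exp_pos|].
    rewrite Rmult_assoc, <- exp_plus, Rplus_opp_r, exp_0, Rmult_1_r. lra.
Qed.

End GrowthODE.


(** * From growth rates to support at one point *)

Definition vanishes_near (c : R) (f : R -> R) : Prop :=
  exists e, 0 < e /\ forall x, Rabs (x - c) < e -> f x = 0.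

Lemma locally_Rabs (x e : R) (P : R -> Prop) : 0 < e ->
  (forall t, Rabs (t - x) < e -> P t) -> locally x P.
Proof. intros He H. exists (mkposreal e He). intros t Ht. apply H, Ht. Qed.

Lemma Derive_n_vanishes f c n : vanishes_near c f -> Derive_n f n c = 0.
Proof.
  intros [e [He H]]. rewrite (Derive_n_ext_loc f (fun _ => 0)).
  - destruct n; [reflexivity | apply Derive_n_const].
  - apply locally_Rabs with e; auto.
Qed.

Lemma vanishes_near_Derive f c : vanishes_near c f -> vanishes_near c (Derive f).
Proof.
  intros [e [He H]]. exists e; split; auto. intros x Hx.
  apply (Derive_n_vanishes f x 1). exists (e - Rabs (x - c)). split; [lra|].
  intros t Ht. apply H. replace (t - c) with ((t - x) + (x - c)) by ring.
  eapply Rle_lt_trans; [apply Rabs_triang | lra].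
Qed.

(** The value of [/ 0] is harmless because [f] is 0 around 0. Letting both [f] and [k] vary gives a
    class closed under differentiation. *)
Lemma smooth_div_pow f k : smooth f -> vanishes_near 0 f -> smooth (fun x => f x * / x ^ k).
Proof.
  intros Hf Hv.
  apply smooth_class with (S := fun h => exists f k, smooth f /\ vanishes_near 0 f /\ h = fun x => f x * / x ^ k);
    [|eauto 6].
  clear. intros h [f [k [Hf [Hv ->]]]].
  exists (fun x => (Derive f x * x + - INR k * f x) * / x ^ S k). split.
  - exists (fun x => Derive f x * x + - INR k * f x), (S k). split; [auto with smooth|]. split; auto.
    destruct (vanishes_near_Derive f 0 Hv) as [e [He H]], Hv as [e' [He' H']].
    exists (Rmin e e'). split; [apply Rmin_pos; auto|]. intros x Hx.
    pose proof (Rmin_l e e'). pose proof (Rmin_r e e').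
    rewrite (H x), (H' x) by lra. rewrite Rmult_0_l, Rmult_0_r. apply Rplus_0_l.
  - intro x. destruct (Req_dec x 0) as [->|Hx].
    + eapply is_derive_ext_loc; [|eapply is_derive_eq; [apply (is_derive_Rconst 0)|]].
      * destruct Hv as [e [He H]]. apply locally_Rabs with e; auto.
        intros t Ht. rewrite (H t Ht). symmetry; apply Rmult_0_l.
      * simpl. destruct Hv as [e [He H]].
        rewrite (H 0) by (rewrite Rminus_0_r, Rabs_R0; auto). ring.
    + eapply is_derive_eq.
      * apply is_derive_Rmult; [apply smooth_is_derive, Hf|].
        apply is_derive_inv; [|apply pow_nonzero, Hx].
        apply (is_derive_pow (fun t => t) k x 1), is_derive_Rid.
      * cbv beta. destruct k as [|k]; [simpl; field; auto|].
        simpl Init.Nat.pred. simpl pow. field. split; auto. apply pow_nonzero; auto.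
Qed.

Definition transl (c : R) (u : (R -> R) -> C) : (R -> R) -> C := fun f => u (fun x => f (x + c)).

Lemma rdist_transl c u : rdist u -> rdist (transl c u).
Proof.
  intros Hu. unfold transl. pose proof Hu as [_ [_ [K [N [A [HK [HA B]]]]]]].
  split; [|split].
  - intros f g Hf Hg. apply (rdist_plus u (fun x => f (x + c)) (fun x => g (x + c)));
      auto using smooth_trans.
  - intros d f Hf. apply (rdist_scal u d (fun x => f (x + c))); auto using smooth_trans.
  - exists K, N, (A + Rabs c). split; auto. split; [pose proof (Rabs_pos c); lra|].
    intros f M Hf Bf. apply B; auto using smooth_trans. intros j x Hj Hx.
    rewrite Derive_n_comp_trans. apply Bf; auto.
    eapply Rle_trans; [apply Rabs_triang|]. lra.
Qed.

Lemma lap_transl c u s : rdist u -> lap (transl c u) s = Cmult (RtoC (exp (s * c))) (lap u s).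
Proof.
  intros Hu. unfold lap, transl. rewrite <- rdist_scal by auto with smooth.
  f_equal. apply functional_extensionality; intro x.
  rewrite Rmult_plus_distr_l, exp_plus. ring.
Qed.

Lemma lap_global_bound u : rdist u ->
  exists l C, 0 <= C /\ forall s, Cmod (lap u s) <= C * exp (l * Rabs s).
Proof.
  intros Hu. destruct (rate_lap u Hu) as [l1 [Hl1 R1]], (rate_lap (refl u) (rdist_refl u Hu)) as [l2 [Hl2 R2]].
  specialize (R1 0%nat). specialize (R2 0%nat). rewrite mulf_pow0 in R1, R2.
  destruct (R1 1 Rlt_0_1) as [C1 [HC1 B1]], (R2 1 Rlt_0_1) as [C2 [HC2 B2]].
  exists (l1 + l2 + 1), (C1 + C2). split; [lra|]. intro s.
  pose proof (Rabs_pos s) as Hs. pose proof (exp_pos ((l1 + l2 + 1) * Rabs s)).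
  destruct (Rle_lt_dec 0 s) as [L|L].
  - rewrite (Rabs_pos_eq s L) in *. eapply Rle_trans; [apply B1, L|].
    assert (exp ((l1 + 1) * s) <= exp ((l1 + l2 + 1) * s)) by (apply exp_le; nra).
    pose proof (exp_pos ((l1 + 1) * s)). nra.
  - rewrite (Rabs_left s L) in *. rewrite <- (Ropp_involutive s), <- lap_refl, Ropp_involutive.
    eapply Rle_trans; [apply B2; lra|].
    assert (exp ((l2 + 1) * - s) <= exp ((l1 + l2 + 1) * - s)) by (apply exp_le; nra).
    pose proof (exp_pos ((l2 + 1) * - s)). nra.
Qed.

Definition nsq (z : C) : R := Re z * Re z + Im z * Im z.

Lemma Cmod_sq z : Cmod z * Cmod z = nsq z.
Proof. pose proof (Cmod2_alt z) as E. simpl in E. unfold nsq. lra. Qed.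

Lemma nsq_mult z w : nsq (Cmult z w) = nsq z * nsq w.
Proof. unfold nsq, Re, Im; simpl. ring. Qed.

Lemma rate_of_nsq B : (forall d, 0 < d -> exists C, 0 <= C /\
   forall s, 0 <= s -> nsq (B s) <= C * exp (d * s)) -> rate 0 B.
Proof.
  intros H. apply (rate_root 0 B 1). rewrite Rmult_0_r. intros d Hd.
  destruct (H d Hd) as [C [HC HB]]. exists C; split; auto. intros s Hs.
  rewrite Cmod_pow. simpl. rewrite Rmult_1_r, Cmod_sq, Rplus_0_l. auto.
Qed.

(* From [P F' = H F] with [P], [H] polynomials, [(ln |F|^2)'] is the rational function
   [2 Re (conj P * H) / |P|^2]; its limit at infinity is twice the support point. *)
Lemma point_support_of_rates g : rdist g ->
  rate 0 (lap (convR g (refl g))) -> rate 0 (lap (refl (convR g (refl g)))) ->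
  exists c, forall f, smooth f -> vanishes_near c f -> g f = RtoC 0.
Proof.
  intros Hg R1 R2. set (p := convR g (refl g)) in *. set (k := convR (xm g) (refl g)).
  assert (Hp : rdist p) by (apply rdist_convR; auto using rdist_refl).
  assert (Hk : rdist k) by (apply rdist_convR; auto using rdist_refl, rdist_xm).
  destruct (lap_polyC p Hp R1 R2) as [P1 P2].
  destruct (lap_polyC k Hk (H_rate g Hg R1) (H_refl_rate g Hg R1)) as [H1 H2].
  set (F := lap g). set (F1 := lap (xm g)).
  assert (EP : forall s, lap p s = Cmult (F s) (F (- s))).
  { intro s. unfold p. rewrite lap_convR, lap_refl; auto using rdist_refl. }
  assert (EH : forall s, lap k s = Cmult (F1 s) (F (- s))).
  { intro s. unfold k. rewrite lap_convR, lap_refl; auto using rdist_refl, rdist_xm. }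
  destruct (classic (exists s, lap p s <> RtoC 0)) as [[s0 Hs0]|Hno].
  (* If [P] vanishes identically then [g = 0], and any point would do. *)
  2:{ exists 0. intros f Hf _. apply (lap_product_zero g Hg); auto.
      intro s. fold (F s) (F (- s)). rewrite <- EP. apply NNPP. intro Hc. apply Hno; eauto. }
  set (W := fun s => nsq (lap p s)).
  set (Q := fun s => 2 * (Re (lap p s) * Re (lap k s) + Im (lap p s) * Im (lap k s))).
  set (q := fun s => nsq (F s)).
  set (q' := fun s => 2 * (Re (F s) * Re (F1 s) + Im (F s) * Im (F1 s))).
  assert (Dq : forall s : R, is_derive q s (q' s)).
  { intro s. destruct (dC_lap g s Hg) as [D1 D2]. eapply is_derive_eq.
    - apply is_derive_Rplus; apply is_derive_Rmult; eauto.
    - unfold q', F, F1. ring. }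
  assert (ODE : forall s, W s * q' s = Q s * q s).
  (* Both sides are [F (s) F' (s) F (- s)]. *)
  { intro s. assert (E : Cmult (lap p s) (F1 s) = Cmult (lap k s) (F s)) by (rewrite EP, EH; ring).
    assert (E1 := f_equal Re E). assert (E2 := f_equal Im E).
    unfold W, Q, q, q', nsq. revert E1 E2.
    destruct (lap p s) as [p1 p2], (lap k s) as [h1 h2], (F s) as [f1 f2], (F1 s) as [d1 d2].
    unfold Re, Im; simpl. intros E1 E2.
    transitivity (2 * (f1 * (p1 * (p1 * d1 - p2 * d2) + p2 * (p1 * d2 + p2 * d1))
      + f2 * (p1 * (p1 * d2 + p2 * d1) - p2 * (p1 * d1 - p2 * d2)))); [ring|].
    rewrite E1, E2. ring. }
  assert (Wpos : forall s, 0 <= W s) by (intro; unfold W; rewrite <- Cmod_sq; apply Rle_0_sqr).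
  assert (qpos : forall s, 0 <= q s) by (intro; unfold q; rewrite <- Cmod_sq; apply Rle_0_sqr).
  assert (qsym : forall s, q s * q (- s) = W s).
  { intro s. unfold q, W. rewrite EP, nsq_mult. reflexivity. }
  assert (PW : polyf W) by (apply poly_plus; apply poly_mult; auto).
  assert (PQ : polyf Q) by (apply poly_scal; apply poly_plus; apply poly_mult; auto).
  assert (W0 : exists s, W s <> 0).
  { exists s0. unfold W. rewrite <- Cmod_sq. intro E. apply Hs0, Cmod_eq_0.
    destruct (Rmult_integral _ _ E); auto. }
  destruct (poly_ratio Q W PQ PW W0 Wpos) as [Wlow _].
  destruct (lap_global_bound g Hg) as [l [C0 [HC0 B0]]].
  assert (qb : forall s, q s <= C0 * C0 * exp (2 * l * Rabs s)).
  { intro s. unfold q. rewrite <- Cmod_sq.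
    replace (2 * l * Rabs s) with (l * Rabs s + l * Rabs s) by ring. rewrite exp_plus.
    replace (C0 * C0 * (exp (l * Rabs s) * exp (l * Rabs s)))
      with ((C0 * exp (l * Rabs s)) * (C0 * exp (l * Rabs s))) by ring.
    apply Rmult_le_compat; auto using Cmod_ge_0; apply B0. }
  destruct (growth_balanced q q' Q W Dq ODE qpos Wlow PQ PW Wpos qsym (2 * l) (C0 * C0) qb W0) as [c Hc].
  set (u := transl (- (c / 2)) g).
  assert (Hu : rdist u) by (apply rdist_transl, Hg).
  assert (nu : forall s, nsq (lap u s) = exp (- c * s) * q s).
  { intro s. unfold u. rewrite lap_transl, nsq_mult by auto. unfold q. f_equal.
    unfold nsq; simpl. rewrite Rmult_0_r, Rplus_0_r, <- exp_plus. f_equal. field. }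
  assert (Ru : rate 0 (lap u)).
  { apply rate_of_nsq. intros d Hd. destruct (Hc d Hd) as [C [HC B]]. exists C; split; auto.
    intros s Hs. rewrite nu. destruct (B s Hs) as [B1 _].
    apply Rle_trans with (exp (- c * s) * (C * exp ((c + d) * s))).
    - apply Rmult_le_compat_l; auto. left; apply exp_pos.
    - right. rewrite <- Rmult_assoc, (Rmult_comm _ C), Rmult_assoc, <- exp_plus. f_equal. f_equal. ring. }
  assert (Ru' : rate 0 (lap (refl u))).
  { apply rate_of_nsq. intros d Hd. destruct (Hc d Hd) as [C [HC B]]. exists C; split; auto.
    intros s Hs. rewrite lap_refl, nu. destruct (B s Hs) as [_ B1].
    apply Rle_trans with (exp (- c * - s) * (C * exp ((- c + d) * s))).
    - apply Rmult_le_compat_l; auto. left; apply exp_pos.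
    - right. rewrite <- Rmult_assoc, (Rmult_comm _ C), Rmult_assoc, <- exp_plus. f_equal. f_equal. ring. }
  destruct (rdist_pow_annihilates u Hu Ru Ru') as [j Hj].
  exists (c / 2). intros f Hf [e [He Hv]].
  set (h := fun x => f (x + c / 2)).
  assert (Hh : vanishes_near 0 h).
  { exists e; split; auto. intros x Hx. apply Hv. replace (x + c / 2 - c / 2) with (x - 0) by ring. auto. }
  (* Since [x ^ j] annihilates [u], and a function vanishing near 0 is [x ^ j] times a smooth one,
     [u] is supported at 0. *)
  rewrite <- (Hj (fun x => h x * / x ^ j)) by (apply smooth_div_pow; auto; apply smooth_trans, Hf).
  unfold u, mulf, transl. f_equal. apply functional_extensionality; intro x.
  destruct (Req_dec (x + - (c / 2)) 0) as [E|E].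
  - rewrite E. destruct Hh as [e' [He' H']]. rewrite (H' 0) by (rewrite Rminus_0_r, Rabs_R0; auto).
    rewrite Rmult_0_l, Rmult_0_r. apply Hv. replace (x - c / 2) with (x + - (c / 2)) by ring.
    rewrite E, Rabs_R0. auto.
  - replace (f x) with (h (x + - (c / 2))) by (unfold h; f_equal; ring).
    field. apply pow_nonzero, E.
Qed.


(** * Cutoff functions *)

(** [flat 0] is the classical [exp (- 1 / x)]; the negative powers arise in its derivatives. *)
Definition flat (a : nat) (x : R) : R :=
  if Rle_dec x 0 then 0 else (/ x) ^ a * exp (- / x).

Lemma flat_neg a x : x <= 0 -> flat a x = 0.
Proof. intros H. unfold flat. destruct (Rle_dec x 0); [reflexivity | lra]. Qed.

Lemma flat_pos a x : 0 < x -> flat a x = (/ x) ^ a * exp (- / x).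
Proof. intros H. unfold flat. destruct (Rle_dec x 0); [lra | reflexivity]. Qed.

Lemma flat_quadratic a x : Rabs (flat a x) <= INR (fact (a + 2)) * (x * x).
Proof.
  pose proof (INR_fact_lt_0 (a + 2)) as Hf.
  destruct (Rle_lt_dec x 0) as [L|L].
  - rewrite flat_neg, Rabs_R0 by auto. apply Rmult_le_pos; [lra | apply Rle_0_sqr].
  - rewrite flat_pos by auto. assert (Hi : 0 < / x) by (apply Rinv_0_lt_compat, L).
    assert (0 < (/ x) ^ a) by (apply pow_lt, Hi).
    rewrite Rabs_pos_eq by (apply Rmult_le_pos; [lra | left; apply exp_pos]).
    pose proof (pow_le_fact_exp (a + 2) (/ x) ltac:(lra)) as B. rewrite pow_add in B.
    apply Rmult_le_reg_r with (/ x * / x * exp (/ x)).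
    { apply Rmult_lt_0_compat; [nra | apply exp_pos]. }
    replace ((/ x) ^ a * exp (- / x) * (/ x * / x * exp (/ x)))
      with ((/ x) ^ a * (/ x) ^ 2 * (exp (- / x) * exp (/ x))) by (simpl; ring).
    rewrite <- exp_plus, Rplus_opp_l, exp_0, Rmult_1_r.
    replace (INR (fact (a + 2)) * (x * x) * (/ x * / x * exp (/ x)))
      with (INR (fact (a + 2)) * exp (/ x)) by (field; lra).
    exact B.
Qed.

Lemma is_derive_flat a (x : R) :
  is_derive (flat a) x (- INR a * flat (S a) x + 1 * flat (S (S a)) x).
Proof.
  destruct (Rtotal_order x 0) as [L|[->|L]].
  - eapply is_derive_ext_loc with (f := fun _ => 0).
    + apply locally_Rabs with (- x); [lra|]. intros t Ht. symmetry. apply flat_neg.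
      apply Rabs_lt_between in Ht. lra.
    + rewrite !flat_neg by lra. eapply is_derive_eq; [apply is_derive_Rconst | ring].
  - rewrite !flat_neg by lra. apply is_derive_quadratic with (INR (fact (a + 2))).
    intros h Hh. rewrite Rplus_0_l, (flat_neg a 0) by lra.
    replace (flat a h - 0 - h * (- INR a * 0 + 1 * 0)) with (flat a h) by ring. apply flat_quadratic.
  - eapply is_derive_ext_loc with (f := fun x => (/ x) ^ a * exp (- / x)).
    + apply locally_Rabs with x; [lra|]. intros t Ht. symmetry. apply flat_pos.
      apply Rabs_lt_between in Ht. lra.
    + rewrite !flat_pos by lra.
      assert (D : is_derive (fun x => / x) x (- 1 / x ^ 2)) by (apply is_derive_inv; [apply is_derive_Rid | lra]).
      eapply is_derive_eq.
      * apply is_derive_Rmult; [apply (is_derive_pow (fun x => / x)), D|].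
        apply (is_derive_Rcomp exp (fun x => - / x)); [apply is_derive_exp|].
        apply (is_derive_Rcomp (fun x => - x) (fun x => / x)); [apply is_derive_Ropp | apply D].
      * cbv beta. destruct a as [|a]; simpl Init.Nat.pred; simpl pow; [simpl; field; lra|].
        field. lra.
Qed.

Inductive flat_span : (R -> R) -> Prop :=
| flat_span_term c a : flat_span (fun x => c * flat a x)
| flat_span_plus f g : flat_span f -> flat_span g -> flat_span (fun x => f x + g x).

Lemma flat_span_scal c f : flat_span f -> flat_span (fun x => c * f x).
Proof.
  intros H. induction H as [d a|f g Hf IHf Hg IHg].
  - replace (fun z => c * (d * flat a z)) with (fun z => (c * d) * flat a z)
      by (apply functional_extensionality; intro; ring). constructor.
  - replace (fun z => c * (f z + g z)) with (fun z => c * f z + c * g z)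
      by (apply functional_extensionality; intro; ring). constructor; auto.
Qed.

Lemma smooth_flat : smooth (flat 0).
Proof.
  apply smooth_class with flat_span.
  - intros f H. induction H as [c a|f g Hf [f' [Hf' Df]] Hg [g' [Hg' Dg]]].
    + exists (fun x => c * (- INR a * flat (S a) x + 1 * flat (S (S a)) x)).
      split; [apply flat_span_scal; repeat constructor|].
      intro x. apply is_derive_scal, is_derive_flat.
    + exists (fun z => f' z + g' z). split; [constructor; auto|].
      intro z; apply is_derive_Rplus; auto.
  - replace (flat 0) with (fun x => 1 * flat 0 x) by (apply functional_extensionality; intro; ring).
    constructor.
Qed.

Lemma flat0_gt x : 0 < x -> 0 < flat 0 x.
Proof. intros H. rewrite flat_pos by auto. simpl. rewrite Rmult_1_l. apply exp_pos. Qed.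

Lemma flat0_ge x : 0 <= flat 0 x.
Proof. destruct (Rle_lt_dec x 0); [rewrite flat_neg by auto; lra | left; apply flat0_gt; auto]. Qed.

(** The quotient [u / (u + v)], with [u] zero outside the large ball and [v] zero inside the small
    one; [r1 < r2] prevents a common zero. Squares avoid the corner of [Rabs]. *)
Lemma cutoff_exists r1 r2 : 0 <= r1 < r2 -> exists k, smooth k /\
  (forall x, Rabs x <= r1 -> k x = 1) /\ (forall x, r2 <= Rabs x -> k x = 0).
Proof.
  intros Hr.
  set (u := fun x => flat 0 (r2 * r2 - x ^ 2)). set (v := fun x => flat 0 (x ^ 2 - r1 * r1)).
  assert (Su : smooth u) by (apply (smooth_comp (flat 0) (fun x => r2 * r2 - x ^ 2)); auto using smooth_flat with smooth).
  assert (Sv : smooth v) by (apply (smooth_comp (flat 0) (fun x => x ^ 2 - r1 * r1)); auto using smooth_flat with smooth).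
  assert (P : forall x, u x + v x <> 0).
  { intro x. pose proof (flat0_ge (r2 * r2 - x ^ 2)). pose proof (flat0_ge (x ^ 2 - r1 * r1)).
    unfold u, v. destruct (Rlt_le_dec (x ^ 2) (r2 * r2)) as [L|L].
    - pose proof (flat0_gt (r2 * r2 - x ^ 2) ltac:(lra)). lra.
    - pose proof (flat0_gt (x ^ 2 - r1 * r1) ltac:(nra)). lra. }
  assert (Sq : forall x, x ^ 2 = Rabs x * Rabs x) by (intro; rewrite <- pow2_abs; ring).
  exists (fun x => u x * / (u x + v x)). split; [|split].
  - apply smooth_mult; auto. apply smooth_inv; auto with smooth.
  - intros x Hx. assert (E : v x = 0).
    { apply flat_neg. rewrite Sq. pose proof (Rabs_pos x). nra. }
    specialize (P x). rewrite E, Rplus_0_r in *. apply Rinv_r, P.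
  - intros x Hx. assert (E : u x = 0) by (apply flat_neg; rewrite Sq; nra).
    rewrite E. ring.
Qed.

(** A cutoff restricts [u] to radius [d / 2], where [exp (s x)] is at most [exp (d s / 2)]; the
    other [d / 2] absorbs the powers of [s] due to derivatives. *)
Lemma rate_of_support u : rdist u -> (forall f, smooth f -> vanishes_near 0 f -> u f = RtoC 0) ->
  rate 0 (lap u).
Proof.
  intros Hu H d Hd. pose proof Hu as [_ [_ [K [N [A [HK [HA B]]]]]]].
  destruct (cutoff_exists (d / 4) (d / 2)) as [k [Sk [K1 K2]]]; [lra|].
  destruct (smooth_bd k N (d / 2) Sk) as [M [HM Bk]].
  destruct (pow_le_exp N (d / 2) ltac:(lra)) as [C [HC HP]].
  assert (H2 : 0 <= 2 ^ N) by (apply pow_le; lra).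
  exists (K * (2 ^ N * M * C)).
  split; [apply Rmult_le_pos; auto; apply Rmult_le_pos; auto; apply Rmult_le_pos; auto|].
  intros s Hs.
  assert (E : lap u s = u (fun x => k x * exp (s * x))).
  { apply rdist_eq_of_minus; auto with smooth. apply H; auto 6 with smooth.
    exists (d / 4). split; [lra|]. intros x Hx. rewrite Rminus_0_r in Hx. rewrite K1 by lra. ring. }
  rewrite E. eapply Rle_trans.
  - apply B; [auto with smooth|]. intros j x Hj _.
    instantiate (1 := 2 ^ N * M * ((1 + Rabs s) ^ N * exp (d / 2 * Rabs s))).
    destruct (Rle_lt_dec (Rabs x) (d / 2)) as [L|L].
    + apply (bd_mult N (fun x => Rabs x <= d / 2) k (fun x => exp (s * x))); auto with smooth.
      apply bd_expl.
    + rewrite Derive_n_vanishes, Rabs_R0.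
      * apply Rmult_le_pos; [apply Rmult_le_pos; auto|].
        apply Rmult_le_pos; [apply pow_le; pose proof (Rabs_pos s); lra | left; apply exp_pos].
      * exists (Rabs x - d / 2). split; [lra|]. intros t Ht. rewrite K2; [ring|].
        pose proof (Rabs_triang_inv x (x - t)). rewrite Rabs_minus_sym in Ht.
        replace (x - (x - t)) with t in * by ring. lra.
  - rewrite (Rabs_pos_eq s Hs), !Rmult_assoc. apply Rmult_le_compat_l; auto.
    apply Rmult_le_compat_l; auto. apply Rmult_le_compat_l; auto.
    replace ((0 + d) * s) with (d / 2 * s + d / 2 * s) by field.
    rewrite exp_plus, <- Rmult_assoc. apply Rmult_le_compat_r; [left; apply exp_pos | auto].
Qed.

Theorem point_support g : rdist g ->
  (forall f, smooth f -> vanishes_near 0 f -> convR g (refl g) f = RtoC 0) ->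
  exists c, forall f, smooth f -> vanishes_near c f -> g f = RtoC 0.
Proof.
  intros Hg H.
  assert (Hp : rdist (convR g (refl g))) by (apply rdist_convR; auto using rdist_refl).
  apply point_support_of_rates; auto.
  - apply rate_of_support; auto.
  - apply rate_of_support; auto using rdist_refl.
    intros f Hf [e [He Hv]]. apply H; auto using smooth_reflect.
    exists e; split; auto. intros x Hx. apply Hv. rewrite Rminus_0_r, Rabs_Ropp in *. auto.
Qed.

(** If [c] lies outside [[a, b]], a cutoff around [c] splits any [f] into a part vanishing near
    [[a, b]] and one vanishing near [c]. Then [u = 0], and the end [a] serves. *)
Lemma point_support_within u a b c : rdist u -> a <= b ->
  (forall f, smooth f -> vanishes_near c f -> u f = RtoC 0) ->
  (forall f, smooth f -> (exists e, 0 < e /\ forall x, a - e < x < b + e -> f x = 0) -> u f = RtoC 0) ->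
  exists c', a <= c' <= b /\ forall f, smooth f -> vanishes_near c' f -> u f = RtoC 0.
Proof.
  intros Hu Hab Hc HI.
  destruct (classic (a <= c <= b)) as [L|L]; [exists c; auto|].
  exists a. split; [lra|]. intros f Hf _.
  assert (exists r, 0 < r /\ (c + r < a \/ b < c - r)) as [r [Hr Hd]].
  { destruct (Rle_lt_dec a c).
    - exists ((c - b) / 2). split; [lra | right; lra].
    - exists ((a - c) / 2). split; [lra | left; lra]. }
  destruct (cutoff_exists (r / 4) (r / 2)) as [k [Sk [K1 K2]]]; [lra|].
  assert (Skc : smooth (fun x => k (x + - c))) by (apply (smooth_trans k), Sk).
  replace f with (fun x => k (x + - c) * f x + (1 - k (x + - c)) * f x)
    by (apply functional_extensionality; intro; ring).
  rewrite rdist_plus, HI, Hc; auto with smooth; [ring | |].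
  - exists (r / 4). split; [lra|]. intros x Hx. rewrite K1; [ring|].
    replace (x + - c) with (x - c) by ring. lra.
  - exists (r / 2). split; [lra|]. intros x Hx. rewrite K2; [ring|].
    destruct Hd as [Hd|Hd]; [rewrite Rabs_pos_eq | rewrite Rabs_left]; lra.
Qed.


(** * Periodization and antiperiodization *)

(** The characters 1 and [(-1) ^ k] of the integers: [true] marks the [PI]-periodic part, [false]
    the antiperiodic one. *)
Definition sg (b : bool) (k : Z) : R := if b then 1 else if Z.even k then 1 else -1.

Lemma sg_add b j k : sg b (j + k) = sg b j * sg b k.
Proof.
  unfold sg. destruct b; [ring|]. rewrite Z.even_add.
  destruct (Z.even j), (Z.even k); simpl; ring.
Qed.

Lemma sg_0 b : sg b 0 = 1.
Proof. destruct b; reflexivity. Qed.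

Lemma sg_sq b k : sg b k * sg b k = 1.
Proof. unfold sg. destruct b, (Z.even k); ring. Qed.

Lemma sg_opp b k : sg b (- k) = sg b k.
Proof. unfold sg. rewrite Z.even_opp. reflexivity. Qed.

Lemma Rabs_sg b k : Rabs (sg b k) = 1.
Proof. unfold sg. destruct b, (Z.even k); try apply Rabs_R1; apply Rabs_m1. Qed.

Definition periodic (b : bool) (f : R -> R) : Prop := forall x, f (x + PI) = sg b 1 * f x.

Lemma periodic_Z b f : periodic b f -> forall k x, f (x + PI * IZR k) = sg b k * f x.
Proof.
  intros H.
  assert (N : forall n x, f (x + PI * IZR (Z.of_nat n)) = sg b (Z.of_nat n) * f x).
  { induction n as [|n IH]; intro x.
    - simpl. rewrite Rmult_0_r, Rplus_0_r, sg_0. ring.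
    - rewrite Nat2Z.inj_succ, <- Z.add_1_r, plus_IZR, sg_add.
      replace (x + PI * (IZR (Z.of_nat n) + 1)) with ((x + PI * IZR (Z.of_nat n)) + PI) by ring.
      rewrite H, IH. ring. }
  intros k x. destruct (Z.le_gt_cases 0 k) as [L|L].
  - rewrite <- (Z2Nat.id k L). apply N.
  - specialize (N (Z.to_nat (- k)) (x + PI * IZR k)). rewrite Z2Nat.id in N by lia.
    rewrite opp_IZR, sg_opp in N.
    replace (x + PI * IZR k + PI * - IZR k) with x in N by ring. rewrite N.
    rewrite <- Rmult_assoc, sg_sq. ring.
Qed.

Lemma periodic_2pi b f : periodic b f -> forall x, f (x + 2 * PI) = f x.
Proof.
  intros H x. replace (x + 2 * PI) with ((x + PI) + PI) by ring.
  rewrite !H, <- Rmult_assoc, sg_sq. ring.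
Qed.

Definition window (m x : R) : Z := Int_part ((x - m) / PI + / 2).

Lemma window_bounds m x : Rabs (x - PI * IZR (window m x) - m) <= PI / 2.
Proof.
  unfold window. pose proof PI_RGT_0 as Hpi.
  destruct (base_Int_part ((x - m) / PI + / 2)) as [H1 H2].
  set (k := IZR (Int_part ((x - m) / PI + / 2))) in *.
  replace (x - PI * k - m) with (PI * ((x - m) / PI - k)) by (field; lra).
  apply Rabs_le_between. nra.
Qed.

(** The signed sum of all translates by multiples of [PI]. If [f] lives within some [r < PI / 2] of
    [m], at most one term is nonzero, so that term is taken directly. *)
Definition per (m : R) (b : bool) (f : R -> R) (x : R) : R :=
  sg b (window m x) * f (x - PI * IZR (window m x)).

Definition supported_within (m r : R) (f : R -> R) : Prop := forall x, r <= Rabs (x - m) -> f x = 0.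

(** Frees [per] from the jumps of [window]: for two different indices the translates are at least
    [PI] apart, so both are at distance at least [r] from [m], where [f] is 0. *)
Lemma per_eval m r b f : r < PI / 2 -> supported_within m r f ->
  forall j x, Rabs (x - PI * IZR j - m) < PI - r -> per m b f x = sg b j * f (x - PI * IZR j).
Proof.
  intros Hr Hs j x Hj. unfold per. pose proof (window_bounds m x) as Hw.
  pose proof PI_RGT_0 as Hpi.
  destruct (Z.eq_dec (window m x) j) as [->|Hne]; [reflexivity|].
  set (k := window m x) in *.
  assert (D : PI <= Rabs (PI * IZR j - PI * IZR k)).
  { rewrite <- Rmult_minus_distr_l, <- minus_IZR, Rabs_mult, (Rabs_pos_eq PI), <- abs_IZR by lra.
    assert (1 <= IZR (Z.abs (j - k))) by (apply IZR_le; lia). nra. }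
  assert (T : Rabs (PI * IZR j - PI * IZR k) <= Rabs (x - PI * IZR k - m) + Rabs (x - PI * IZR j - m)).
  { replace (PI * IZR j - PI * IZR k) with ((x - PI * IZR k - m) + - (x - PI * IZR j - m)) by ring.
    eapply Rle_trans; [apply Rabs_triang|]. rewrite Rabs_Ropp. lra. }
  rewrite (Hs (x - PI * IZR k)) by lra. rewrite (Hs (x - PI * IZR j)) by lra. ring.
Qed.

Lemma per_locally m r b f x : r < PI / 2 -> supported_within m r f ->
  locally x (fun t => sg b (window m x) * f (t + - (PI * IZR (window m x))) = per m b f t).
Proof.
  intros Hr Hs. apply locally_Rabs with (PI / 2 - r); [lra|]. intros t Ht.
  rewrite (per_eval m r b f Hr Hs (window m x) t); [reflexivity|].
  replace (t - PI * IZR (window m x) - m) with ((t - x) + (x - PI * IZR (window m x) - m)) by ring.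
  eapply Rle_lt_trans; [apply Rabs_triang|]. pose proof (window_bounds m x). lra.
Qed.

Lemma smooth_per m r b f : r < PI / 2 -> supported_within m r f -> smooth f -> smooth (per m b f).
Proof.
  intros Hr Hs Hf. apply smooth_loc. intro x.
  exists (fun t => sg b (window m x) * f (t + - (PI * IZR (window m x)))).
  split; [apply smooth_scal, (smooth_trans f), Hf | eapply per_locally; eauto].
Qed.

Lemma Derive_n_per m r b f n x : r < PI / 2 -> supported_within m r f ->
  Derive_n (per m b f) n x = sg b (window m x) * Derive_n f n (x - PI * IZR (window m x)).
Proof.
  intros Hr Hs. rewrite <- (Derive_n_ext_loc _ _ n x (per_locally m r b f x Hr Hs)).
  rewrite Derive_n_scal_l, Derive_n_comp_trans. reflexivity.
Qed.

Lemma per_periodic m r b f : r < PI / 2 -> supported_within m r f -> periodic b (per m b f).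
Proof.
  intros Hr Hs x. pose proof (window_bounds m x) as Hw.
  assert (E : x + PI - PI * IZR (window m x + 1) = x - PI * IZR (window m x)) by (rewrite plus_IZR; ring).
  rewrite (per_eval m r b f Hr Hs (window m x + 1)).
  - rewrite E, sg_add. unfold per. ring.
  - rewrite E. lra.
Qed.

Lemma per_plus m b f g x : per m b (fun t => f t + g t) x = per m b f x + per m b g x.
Proof. unfold per; ring. Qed.

Lemma per_scal m b c f x : per m b (fun t => c * f t) x = c * per m b f x.
Proof. unfold per; ring. Qed.

Lemma test_fn_real f : smooth f -> (forall x, f (x + 2 * PI) = f x) -> test_fn (fun x => RtoC (f x)).
Proof.
  intros Hf Hp. split; [exact Hf|]. split; [exact (smooth_const 0)|]. intro x. rewrite Hp. reflexivity.
Qed.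

Lemma test_fn_parts phi : test_fn phi ->
  smooth (fun x => Re (phi x)) /\ smooth (fun x => Im (phi x)) /\
  (forall x, Re (phi (x + 2 * PI)) = Re (phi x)) /\ (forall x, Im (phi (x + 2 * PI)) = Im (phi x)).
Proof.
  intros [H1 [H2 H3]]. split; [exact H1|]. split; [exact H2|]. split; intro; rewrite H3; reflexivity.
Qed.

Lemma C_parts (z : C) : z = Cplus (RtoC (Re z)) (Cmult Ci (RtoC (Im z))).
Proof. destruct z as [x y]. unfold Re, Im, Ci, Cmult, Cplus, RtoC; simpl. f_equal; ring. Qed.

Section Distribution.

Variable f : distrT.
Hypothesis Hf : is_distribution f.

Definition on_real (u : distrT) (h : R -> R) : C := u (fun x => RtoC (h x)).

Let fr := on_real f.

Lemma fr_plus g h : smooth g -> (forall x, g (x + 2 * PI) = g x) -> smooth h ->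
  (forall x, h (x + 2 * PI) = h x) -> fr (fun x => g x + h x) = Cplus (fr g) (fr h).
Proof.
  intros Sg Pg Sh Ph. unfold fr, on_real. destruct Hf as [H1 _].
  rewrite <- H1 by (apply test_fn_real; auto).
  f_equal. apply functional_extensionality; intro x. apply RtoC_plus.
Qed.

Lemma fr_scal c g : smooth g -> (forall x, g (x + 2 * PI) = g x) ->
  fr (fun x => c * g x) = Cmult (RtoC c) (fr g).
Proof.
  intros Sg Pg. unfold fr, on_real. destruct Hf as [_ [H1 _]].
  rewrite <- H1 by (apply test_fn_real; auto).
  f_equal. apply functional_extensionality; intro x. apply RtoC_mult.
Qed.

Lemma f_extC phi : test_fn phi -> f phi = extC fr phi.
Proof.
  intros Hphi. destruct (test_fn_parts phi Hphi) as [S1 [S2 [P1 P2]]].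
  unfold extC, fr, on_real. destruct Hf as [H1 [H2 _]].
  assert (T1 : test_fn (fun x => RtoC (Re (phi x)))) by (apply test_fn_real; auto).
  assert (T2 : test_fn (fun x => RtoC (Im (phi x)))) by (apply test_fn_real; auto).
  rewrite <- H2 by auto. rewrite <- H1; auto.
  - f_equal. apply functional_extensionality; intro x. apply C_parts.
  - split; [|split].
    + replace (fun x => fst (Cmult Ci (RtoC (Im (phi x))))) with (fun _ : R => 0)
        by (apply functional_extensionality; intro; simpl; ring). apply smooth_const.
    + replace (fun x => snd (Cmult Ci (RtoC (Im (phi x))))) with (fun x => Im (phi x))
        by (apply functional_extensionality; intro; simpl; ring). auto.
    + intro x. rewrite P2. reflexivity.
Qed.

Variables a b r1 r2 : R.
Hypothesis Hab : a <= b.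
Hypothesis Hr1 : (b - a) / 2 < r1.
Hypothesis Hr2 : r1 < r2.
Hypothesis Hr2' : r2 < PI / 4.
Hypothesis Hsupp : supp_in f (R2 (Icc_T a b)).

Variable chi0 : R -> R.
Hypothesis Schi0 : smooth chi0.
Hypothesis chi0_1 : forall x, Rabs x <= r1 -> chi0 x = 1.
Hypothesis chi0_0 : forall x, r2 <= Rabs x -> chi0 x = 0.

Let m := (a + b) / 2.
Let chi (x : R) := chi0 (x + - m).

Let Schi : smooth chi.
Proof. apply (smooth_trans chi0), Schi0. Qed.

(* The pushforward of [f] to [R / pi Z] ([s = true]), or its sign-twisted version. *)
Definition half (s : bool) (h : R -> R) : C := fr (per m s (fun x => chi x * h x)).

Let Hr2pi : r2 < PI / 2.
Proof. pose proof PI_RGT_0. lra. Qed.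

Lemma chi_supported h : supported_within m r2 (fun x => chi x * h x).
Proof.
  intros x Hx. unfold chi. rewrite chi0_0; [ring|]. replace (x + - m) with (x - m) by ring. auto.
Qed.

Lemma rdist_half s : rdist (half s).
Proof.
  pose proof PI_RGT_0 as Hpi.
  assert (SP : forall h, smooth h -> smooth (per m s (fun x => chi x * h x))).
  { intros h Hh. apply (smooth_per m r2); auto using chi_supported with smooth. }
  assert (PP : forall h x, per m s (fun x => chi x * h x) (x + 2 * PI) = per m s (fun x => chi x * h x) x).
  { intros h. apply (periodic_2pi s), (per_periodic m r2); auto using chi_supported. }
  unfold half. split; [|split].
  - intros g h Sg Sh. rewrite <- fr_plus by auto. f_equal. apply functional_extensionality; intro x.
    rewrite <- per_plus. f_equal. apply functional_extensionality; intro; ring.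
  - intros c h Sh. rewrite <- fr_scal by auto. f_equal. apply functional_extensionality; intro x.
    rewrite <- per_scal. f_equal. apply functional_extensionality; intro; ring.
  - destruct Hf as [_ [_ [K [N B]]]].
    (* The translate picked by [window] is within [PI / 2] of [m]. *)
    set (A := Rabs m + PI / 2). assert (HA : 0 <= A) by (unfold A; pose proof (Rabs_pos m); lra).
    destruct (smooth_bd chi N A Schi) as [M0 [HM0 B0]].
    assert (H2 : 0 <= 2 ^ N) by (apply pow_le; lra).
    exists (Rabs K * (2 ^ N * M0)), N, A.
    split; [apply Rmult_le_pos; [apply Rabs_pos | apply Rmult_le_pos; auto]|]. split; auto.
    intros h M Sh Bh.
    assert (HM : 0 <= M).
    { eapply Rle_trans; [apply Rabs_pos | apply (Bh 0%nat 0); [lia | rewrite Rabs_R0; auto]]. }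
    assert (HM2 : 0 <= 2 ^ N * M0 * M) by (apply Rmult_le_pos; auto; apply Rmult_le_pos; auto).
    apply Rle_trans with (K * (2 ^ N * M0 * M)).
    + apply B; [apply test_fn_real; auto|]. intros j x Hj. split.
      * change (fun t => fst (RtoC (per m s (fun x => chi x * h x) t))) with (per m s (fun x => chi x * h x)).
        rewrite (Derive_n_per m r2 s _ j x Hr2pi (chi_supported h)), Rabs_mult, Rabs_sg, Rmult_1_l.
        apply (bd_mult N (fun x => Rabs x <= A)); auto.
        replace (x - PI * IZR (window m x)) with ((x - PI * IZR (window m x) - m) + m) by ring.
        eapply Rle_trans; [apply Rabs_triang|]. unfold A. pose proof (window_bounds m x). lra.
      * change (fun t => snd (RtoC (per m s (fun x => chi x * h x) t))) with (fun _ : R => 0).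
        destruct j as [|j]; [simpl | rewrite Derive_n_const]; rewrite Rabs_R0; auto.
    + rewrite !Rmult_assoc in *. apply Rmult_le_compat_r; [auto | apply Rle_abs].
Qed.

Lemma half_ext s h h' : (forall x, Rabs (x - m) < r2 -> h x = h' x) -> half s h = half s h'.
Proof.
  intros H. unfold half. f_equal. f_equal. apply functional_extensionality; intro x.
  destruct (Rle_lt_dec r2 (Rabs (x - m))) as [L|L].
  - rewrite (chi_supported h x L), (chi_supported h' x L). reflexivity.
  - rewrite H; auto.
Qed.

Lemma R2_Icc_T y : R2 (Icc_T a b) y -> exists j, a <= y - PI * IZR j <= b.
Proof.
  intros [[k Hk]|[k Hk]].
  - exists (2 * k)%Z. rewrite mult_IZR. lra.
  - exists (2 * k + 1)%Z. rewrite plus_IZR, mult_IZR. lra.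
Qed.

Lemma fr_supp h : smooth h -> (forall x, h (x + 2 * PI) = h x) ->
  (exists e, 0 < e /\ forall x j, a - e < x - PI * IZR j < b + e -> h x = 0) -> fr h = RtoC 0.
Proof.
  intros Sh Ph [e [He H]]. apply Hsupp; [apply test_fn_real; auto|].
  exists e; split; auto. intros x [y [Hy Hxy]]. destruct (R2_Icc_T y Hy) as [j Hj].
  rewrite (H x j); auto. apply Rabs_lt_between in Hxy. lra.
Qed.

(** Near every translate of [[a, b]] by a multiple of [PI] the cutoff is 1, and periodicity of type
    [s] rebuilds [h] there. The difference thus vanishes near the support of [f]. *)
Lemma fr_half s h : smooth h -> periodic s h -> fr h = half s h.
Proof.
  intros Sh Ph.
  assert (SP : smooth (per m s (fun x => chi x * h x))).
  { apply (smooth_per m r2); auto using chi_supported with smooth. }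
  assert (PP : periodic s (per m s (fun x => chi x * h x))).
  { apply (per_periodic m r2); auto using chi_supported. }
  assert (E : fr (fun x => h x + (-1) * per m s (fun x => chi x * h x) x) = RtoC 0).
  { apply fr_supp; auto with smooth.
    - intro x. rewrite (periodic_2pi s _ Ph), (periodic_2pi s _ PP). reflexivity.
    - exists (r1 - (b - a) / 2). split; [lra|]. intros x j Hx.
      assert (D : Rabs (x - PI * IZR j - m) <= r1) by (apply Rabs_le_between; unfold m; lra).
      rewrite (per_eval m r2 s _ Hr2pi (chi_supported h) j x) by (pose proof PI_RGT_0; lra).
      unfold chi. rewrite chi0_1 by exact D. rewrite Rmult_1_l.
      replace (x - PI * IZR j) with (x + PI * IZR (- j)) by (rewrite opp_IZR; ring).
      rewrite (periodic_Z s h Ph), sg_opp, <- Rmult_assoc, <- Rmult_assoc.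
      rewrite (Rmult_assoc (-1)), sg_sq. ring. }
  rewrite fr_plus, fr_scal in E; auto with smooth.
  - unfold half. set (w := fr (per m s (fun x => chi x * h x))) in *.
    transitivity (Cplus (Cplus (fr h) (Cmult (RtoC (-1)) w)) w); [ring|]. rewrite E. ring.
  - apply (periodic_2pi s _ PP).
  - apply (periodic_2pi s _ Ph).
  - intro x. rewrite (periodic_2pi s _ PP). reflexivity.
Qed.

Lemma half_supp s h : smooth h -> (exists e, 0 < e /\ forall x, a - e < x < b + e -> h x = 0) ->
  half s h = RtoC 0.
Proof.
  intros Sh [e [He H]]. unfold half. apply fr_supp.
  - apply (smooth_per m r2); auto using chi_supported with smooth.
  - apply (periodic_2pi s), (per_periodic m r2); auto using chi_supported.
  - exists (Rmin e (r1 - (b - a) / 2)). split; [apply Rmin_pos; lra|]. intros x j Hx.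
    pose proof (Rmin_l e (r1 - (b - a) / 2)). pose proof (Rmin_r e (r1 - (b - a) / 2)).
    rewrite (per_eval m r2 s _ Hr2pi (chi_supported h) j x).
    + rewrite H by lra. ring.
    + pose proof PI_RGT_0. apply Rabs_lt_between. unfold m. lra.
Qed.

Hypothesis Hconv : supp_in (conv f (sharp f)) (lift (fun x => x = 0 \/ x = PI)).

(** Reflecting and translating [th] keeps its type [s], and the inner bracket, as a function of [x],
    has type [s] as well. So [fr_half] applies to both brackets and the two parts of [f] do not
    mix. *)
Lemma conv_half s th : smooth th -> periodic s th ->
  conv f (sharp f) (fun x => RtoC (th x)) = convR (half s) (refl (half s)) th.
Proof.
  intros Sth Pth. unfold conv, sharp.
  assert (Hh : rdist (refl (half s))) by apply rdist_refl, rdist_half.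
  assert (E : forall x, f (fun y => RtoC (th (x + - y))) = refl (half s) (fun y => th (x + y))).
  { intro x. apply (fr_half s (fun y => th (x + - y))).
    - apply (smooth_comp th (fun y => x + - y)); auto with smooth.
    - intro y. pose proof (periodic_Z s th Pth (-1) (x + - y)) as Q.
      replace (x + - (y + PI)) with (x + - y + PI * IZR (-1)) by (simpl; ring).
      rewrite Q. apply (f_equal (fun t => t * _)). apply (sg_opp s 1). }
  replace (fun x => f (fun y => RtoC (th (x + - y))))
    with (fun x => refl (half s) (fun y => th (x + y)))
    by (apply functional_extensionality; intro; symmetry; apply E).
  destruct (smooth_corr _ th Hh Sth) as [S1 S2].
  assert (P : forall x, refl (half s) (fun y => th (x + PI + y)) =
     Cmult (RtoC (sg s 1)) (refl (half s) (fun y => th (x + y)))).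
  { intro x. rewrite <- rdist_scal by (auto using smooth_trans_l).
    f_equal. apply functional_extensionality; intro y.
    replace (x + PI + y) with (x + y + PI) by ring. apply Pth. }
  assert (P1 : periodic s (fun x => Re (refl (half s) (fun y => th (x + y))))).
  { intro x. rewrite P. unfold Re; simpl. ring. }
  assert (P2 : periodic s (fun x => Im (refl (half s) (fun y => th (x + y))))).
  { intro x. rewrite P. unfold Im; simpl. ring. }
  rewrite f_extC.
  - unfold convR, extC. rewrite !(fr_half s); auto.
  - split; [exact S1|]. split; [exact S2|]. intro x.
    replace (x + 2 * PI) with (x + PI + PI) by ring. rewrite !P, Cmult_assoc, <- RtoC_mult, sg_sq. ring.
Qed.

Lemma conv_half_ext s h h' : (forall x, Rabs x < 2 * r2 -> h x = h' x) ->
  convR (half s) (refl (half s)) h = convR (half s) (refl (half s)) h'.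
Proof.
  intros H. unfold convR, extC, refl.
  assert (E : forall x, Rabs (x - m) < r2 -> half s (fun y => h (x + - y)) = half s (fun y => h' (x + - y))).
  { intros x Hx. apply half_ext. intros y Hy. apply H.
    replace (x + - y) with ((x - m) + - (y - m)) by ring.
    eapply Rle_lt_trans; [apply Rabs_triang|]. rewrite Rabs_Ropp. lra. }
  f_equal; [|f_equal]; apply half_ext; intros x Hx; rewrite (E x Hx); reflexivity.
Qed.

(** The length bound acts here. Differences stay below [2 * r2 < PI / 2], so a cutoff can be 1 on
    all of them and vanish before [PI / 2], and [h] passes to the circle without overlap. The result
    vanishes near all multiples of [PI], hence near 0 and [PI]. *)
Lemma conv_half_supp s h : smooth h -> vanishes_near 0 h ->
  convR (half s) (refl (half s)) h = RtoC 0.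
Proof.
  intros Sh [e [He H]]. pose proof PI_RGT_0 as Hpi.
  set (r3 := (2 * r2 + PI / 2) / 2).
  destruct (cutoff_exists (2 * r2) r3) as [k [Sk [K1 K0]]]; [unfold r3; lra|].
  assert (Hr3 : r3 < PI / 2) by (unfold r3; lra).
  assert (SW : supported_within 0 r3 (fun x => k x * h x)).
  { intros x Hx. rewrite K0; [ring|]. rewrite Rminus_0_r in Hx; auto. }
  set (th := per 0 s (fun x => k x * h x)).
  assert (Sth : smooth th) by (apply (smooth_per 0 r3); auto with smooth).
  assert (Pth : periodic s th) by (apply (per_periodic 0 r3); auto).
  transitivity (convR (half s) (refl (half s)) th).
  - apply conv_half_ext. intros x Hx. unfold th.
    rewrite (per_eval 0 r3 s _ Hr3 SW 0 x).
    + rewrite sg_0, Rmult_0_r, Rminus_0_r, K1 by lra. ring.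
    + rewrite Rmult_0_r, !Rminus_0_r. lra.
  - rewrite <- conv_half by auto. apply Hconv; [apply test_fn_real; auto; apply (periodic_2pi s), Pth|].
    exists (Rmin e (PI / 2)). split; [apply Rmin_pos; lra|]. intros x [y [[j Hy] Hxy]].
    pose proof (Rmin_l e (PI / 2)). pose proof (Rmin_r e (PI / 2)).
    assert (exists i, y = PI * IZR i) as [i ->].
    { destruct Hy as [Hy|Hy]; [exists (2 * j)%Z | exists (2 * j + 1)%Z];
      rewrite ?plus_IZR, mult_IZR; lra. }
    unfold th. rewrite (per_eval 0 r3 s _ Hr3 SW i x) by (rewrite Rminus_0_r; lra).
    rewrite (H (x - PI * IZR i)) by (rewrite Rminus_0_r; lra).
    f_equal. ring.
Qed.

Lemma half_point_support s : exists c, a <= c <= b /\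
  forall h, smooth h -> vanishes_near c h -> half s h = RtoC 0.
Proof.
  destruct (point_support (half s) (rdist_half s)) as [c Hc].
  { intros h. apply conv_half_supp. }
  apply (point_support_within (half s) a b c); auto using rdist_half.
  intros h Sh. apply half_supp, Sh.
Qed.

(** Splits [h] into its even and odd parts under the shift by [PI]; the factor 1/2 in [mu] and [nu]
    originates here. *)
Lemma fr_decomposition h : smooth h -> (forall x, h (x + 2 * PI) = h x) ->
  fr h = (RtoC (/ 2) * (half true h + half true (fun x => h (x + PI)%R))
        + RtoC (/ 2) * (half false h - half false (fun x => h (x + PI)%R)))%C.
Proof.
  intros Sh Ph.
  assert (Sh' : smooth (fun x => h (x + PI))) by (apply smooth_trans, Sh).
  assert (Ph' : forall x, h (x + PI + PI) = h x).
  { intro x. rewrite <- (Ph x). f_equal. ring. }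
  replace h with (fun x => / 2 * (h x + h (x + PI)) + / 2 * (h x - h (x + PI))) at 1
    by (apply functional_extensionality; intro; field).
  assert (Pp : periodic true (fun x => / 2 * (h x + h (x + PI)))).
  { intro x. rewrite Ph'. simpl. ring. }
  assert (Pm : periodic false (fun x => / 2 * (h x - h (x + PI)))).
  { intro x. rewrite Ph'. simpl. ring. }
  rewrite fr_plus; auto with smooth.
  - rewrite (fr_half true (fun x => / 2 * (h x + h (x + PI)))) by auto with smooth.
    rewrite (fr_half false (fun x => / 2 * (h x - h (x + PI)))) by auto with smooth.
    pose proof (rdist_half true). pose proof (rdist_half false).
    rewrite !rdist_scal, rdist_plus, rdist_minus by auto with smooth. reflexivity.
  - apply (periodic_2pi true _ Pp).
  - apply (periodic_2pi false _ Pm).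
Qed.

End Distribution.


(** * Assembly on the circle *)

Lemma extC_half_distribution u : rdist u ->
  is_distribution (fun phi => Cmult (RtoC (/ 2)) (extC u phi)).
Proof.
  intros Hu. unfold extC. split; [|split].
  - intros phi psi Hphi Hpsi.
    destruct (test_fn_parts phi Hphi) as [S1 [S2 _]], (test_fn_parts psi Hpsi) as [S3 [S4 _]].
    change (fun x => Re (Cplus (phi x) (psi x))) with (fun x => Re (phi x) + Re (psi x)).
    change (fun x => Im (Cplus (phi x) (psi x))) with (fun x => Im (phi x) + Im (psi x)).
    rewrite !rdist_plus by auto. ring.
  - intros c phi Hphi. destruct (test_fn_parts phi Hphi) as [S1 [S2 _]].
    change (fun x => Re (Cmult c (phi x))) with (fun x => Re c * Re (phi x) - Im c * Im (phi x)).
    change (fun x => Im (Cmult c (phi x))) with (fun x => Re c * Im (phi x) + Im c * Re (phi x)).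
    rewrite rdist_minus, rdist_plus, !rdist_scal by auto with smooth.
    (* The fifth occurrence of [c] is the scalar on the right-hand side. *)
    rewrite (C_parts c) at 5.
    assert (E : Cmult Ci Ci = RtoC (-1)).
    { unfold Ci, Cmult, RtoC; simpl. f_equal; ring. }
    set (p := u (fun x => Re (phi x))). set (q := u (fun x => Im (phi x))).
    transitivity (RtoC (/ 2) * (RtoC (Re c) * p + Ci * RtoC (Re c) * q + Ci * RtoC (Im c) * p
       + RtoC (-1) * (RtoC (Im c) * q)))%C; [ring|]. rewrite <- E. ring.
  - destruct Hu as [_ [_ [K [N [A [HK [HA B]]]]]]].
    exists K, N. intros phi M Hphi H. destruct (test_fn_parts phi Hphi) as [S1 [S2 _]].
    rewrite Cmod_mult, Cmod_R, Rabs_pos_eq by lra.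
    assert (B1 : Cmod (u (fun x => Re (phi x))) <= K * M).
    { apply B; auto. intros j x Hj _. apply H, Hj. }
    assert (B2 : Cmod (u (fun x => Im (phi x))) <= K * M).
    { apply B; auto. intros j x Hj _. apply H, Hj. }
    pose proof (Cmod_triangle (u (fun x => Re (phi x))) (Cmult Ci (u (fun x => Im (phi x))))) as T.
    rewrite Cmod_mult, Cmod_Ci in T. lra.
Qed.

Lemma extC_vanishes u c phi :
  (forall h, smooth h -> vanishes_near c h -> u h = RtoC 0) -> test_fn phi ->
  (exists e, 0 < e /\ forall x, Rabs (x - c) < e -> phi x = RtoC 0) -> extC u phi = RtoC 0.
Proof.
  intros H Hphi [e [He Hv]]. destruct (test_fn_parts phi Hphi) as [S1 [S2 _]].
  unfold extC. rewrite (H _ S1), (H _ S2); [ring | |];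
  exists e; split; auto; intros x Hx; rewrite Hv by auto; reflexivity.
Qed.

Lemma test_fn_shift phi c : test_fn phi -> test_fn (fun x => phi (x + c)).
Proof.
  intros [H1 [H2 H3]]. split; [|split].
  - apply (smooth_trans (fun x => fst (phi x))), H1.
  - apply (smooth_trans (fun x => snd (phi x))), H2.
  - intro x. replace (x + 2 * PI + c) with (x + c + 2 * PI) by ring. apply H3.
Qed.

Theorem theorem2 (f : distrT) (a b : R) :
  is_distribution f ->
  - (PI / 2) < a -> a <= b -> b < PI / 2 -> b - a < PI / 2 ->
  supp_in f (R2 (Icc_T a b)) ->
  (forall a' b' : R, a <= a' -> a' <= b' -> b' <= b -> (a' <> a \/ b' <> b) ->
     ~ supp_in f (R2 (Icc_T a' b'))) ->
  supp_in (conv f (sharp f)) (lift (fun x => x = 0 \/ x = PI)) ->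
  supp_in f (lift (fun x => x = a \/ x = b \/ x = PI + a \/ x = PI + b)) /\
  exists mu nu : distrT,
    is_distribution mu /\ is_distribution nu /\
    (exists p : R, supp_in mu (lift (fun x => x = p))) /\
    (exists q : R, supp_in nu (lift (fun x => x = q))) /\
    forall phi, test_fn phi ->
      f phi = Cplus (Cplus (mu phi) (shiftT PI mu phi))
                    (Cminus (nu phi) (shiftT PI nu phi)).
Proof.
  intros Hf _ Hab _ Hlen Hsupp Hmin Hconv.
  set (l := (b - a) / 2). assert (Hl : 0 <= l < PI / 4) by (unfold l; lra).
  (* One third and two thirds of the way from the half-length to [PI / 4]. *)
  set (r1 := l + (PI / 4 - l) / 3). set (r2 := l + 2 * (PI / 4 - l) / 3).
  assert (Hr : l < r1 /\ r1 < r2 /\ r2 < PI / 4) by (unfold r1, r2; lra).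
  destruct Hr as [Hr1 [Hr2 Hr3]].
  destruct (cutoff_exists r1 r2) as [chi [Schi [chi1 chi0]]]; [lra|].
  set (gp := half f a b chi true). set (gm := half f a b chi false).
  assert (Rp : rdist gp) by (eapply rdist_half; eauto).
  assert (Rm : rdist gm) by (eapply rdist_half; eauto).
  assert (exists p, a <= p <= b /\ forall h, smooth h -> vanishes_near p h -> gp h = RtoC 0) as [p [Hp Zp]].
  { apply (half_point_support f Hf a b r1 r2); auto. }
  assert (exists q, a <= q <= b /\ forall h, smooth h -> vanishes_near q h -> gm h = RtoC 0) as [q [Hq Zq]].
  { apply (half_point_support f Hf a b r1 r2); auto. }
  set (mu := fun phi => Cmult (RtoC (/ 2)) (extC gp phi)).
  set (nu := fun phi => Cmult (RtoC (/ 2)) (extC gm phi)).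
  assert (Dec : forall phi, test_fn phi ->
      f phi = Cplus (Cplus (mu phi) (shiftT PI mu phi)) (Cminus (nu phi) (shiftT PI nu phi))).
  { intros phi Hphi. destruct (test_fn_parts phi Hphi) as [S1 [S2 [P1 P2]]].
    rewrite (f_extC f Hf) by auto. unfold extC at 1.
    rewrite (fr_decomposition f Hf a b r1 r2 Hab Hr1 Hr2 Hr3 Hsupp chi Schi chi1 chi0 (fun x => Re (phi x))) by auto.
    rewrite (fr_decomposition f Hf a b r1 r2 Hab Hr1 Hr2 Hr3 Hsupp chi Schi chi1 chi0 (fun x => Im (phi x))) by auto.
    fold gp gm. unfold mu, nu, shiftT, extC. ring. }
  assert (Sf : forall A : R -> Prop, A p -> A (p + PI) -> A q -> A (q + PI) -> supp_in f A).
  { intros A Ap Ap' Aq Aq' phi Hphi [e [He Hv]]. rewrite Dec by auto. unfold mu, nu, shiftT.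
    pose proof (test_fn_shift phi PI Hphi) as Hphi'.
    rewrite (extC_vanishes gp p phi Zp Hphi), (extC_vanishes gp p _ Zp Hphi'),
      (extC_vanishes gm q phi Zq Hphi), (extC_vanishes gm q _ Zq Hphi').
    - ring.
    - exists e; split; auto. intros x Hx. apply Hv. exists (q + PI). split; auto.
      replace (x + PI - (q + PI)) with (x - q) by ring. auto.
    - exists e; split; auto. intros x Hx. apply Hv. exists q. split; auto.
    - exists e; split; auto. intros x Hx. apply Hv. exists (p + PI). split; auto.
      replace (x + PI - (p + PI)) with (x - p) by ring. auto.
    - exists e; split; auto. intros x Hx. apply Hv. exists p. split; auto. }
  (* The interval from [Rmin p q] to [Rmax p q] lies in [[a, b]] and its double carries [f], so
     minimality makes it all of [[a, b]]. Which part sits at which end stays open. *)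
  assert (Hends : (p = a /\ q = b) \/ (p = b /\ q = a)).
  { apply NNPP. intro Hn.
    apply (Hmin (Rmin p q) (Rmax p q)).
    - apply Rmin_glb; lra.
    - apply Rle_trans with p; [apply Rmin_l | apply Rmax_l].
    - apply Rmax_lub; lra.
    - unfold Rmin, Rmax. destruct (Rle_dec p q); lra.
    - pose proof (Rmin_l p q). pose proof (Rmin_r p q). pose proof (Rmax_l p q). pose proof (Rmax_r p q).
      apply Sf; [left | right | left | right]; exists 0%Z; lra. }
  split.
  - apply Sf; exists 0%Z; destruct Hends as [[E1 E2]|[E1 E2]]; rewrite ?E1, ?E2; lra.
  - exists mu, nu. split; [apply extC_half_distribution, Rp|]. split; [apply extC_half_distribution, Rm|].
    assert (Pt : forall u c, (forall h, smooth h -> vanishes_near c h -> u h = RtoC 0) ->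
      supp_in (fun phi => Cmult (RtoC (/ 2)) (extC u phi)) (lift (fun x => x = c))).
    { intros u c Hu phi Hphi [e [He Hv]]. rewrite (extC_vanishes u c phi Hu Hphi); [ring|].
      exists e; split; auto. intros x Hx. apply Hv. exists c. split; auto. exists 0%Z. lra. }
    split; [exists p; apply Pt, Zp|]. split; [exists q; apply Pt, Zq | exact Dec].
Qed.
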